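(* Let $0<\theta\le1$, $\alpha>-\frac12$ and $r>\alpha+\frac12$. Then there exist positive constants $c_1$, $C_2$ depending only on $\alpha$, $\theta$, $r$ such that for all $n\in\mathbb{N}$ $$c_1\,n^{-(r+\frac1\theta-\frac12)}\le\sigma_n(\mathcal{A}^r_{\alpha,\theta},\mathcal{B}_\alpha)_\infty\le C_2\,n^{-(r+\frac1\theta-\frac12)}.$$
   Context: $\mu_\alpha$ is the probability measure on $[-1,1]$ with $d\mu_\alpha(x)=c_\alpha(1-x^2)^\alpha dx$, $c_\alpha=(\int_{-1}^1(1-x^2)^\alpha dx)^{-1}$, with inner product $\langle f,g\rangle=\int_{-1}^1f\bar g\,d\mu_\alpha$. $\mathcal{B}_\alpha=\{L_n^\alpha\}_{n=0}^\infty$ is the system of orthonormal polynomials with respect to $\mu_\alpha$, $L_n^\alpha$ of degree $n$ (orthonormalized Gegenbauer polynomials). $\mathcal{A}^r_{\alpha,\theta}:=\{f\in\mathcal{C}[-1,1]:\sum_{n\in\mathbb{N}_0}|(1+n)^r\langle f,L_n^\alpha\rangle|^\theta\le1\}$. $\sigma_n(\mathbf{F},\mathcal{B}_\alpha)_\infty:=\sup_{f\in\mathbf{F}}\inf\{\max_{x\in[-1,1]}|f(x)-g(x)|: g=\sum_{j\in J}c_jL_j^\alpha,\ J\subset\mathbb{N}_0,\ |J|=n\}$. *)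

(* Defs.v *)
From HB Require Import structures.
From mathcomp Require Import all_boot all_order all_algebra.
From mathcomp Require Import all_classical all_reals all_analysis.
Set Implicit Arguments. Unset Strict Implicit. Unset Printing Implicit Defensive.
Import Order.TTheory GRing.Theory Num.Theory.
Import numFieldNormedType.Exports.
Local Open Scope classical_set_scope.
Local Open Scope ring_scope.

(* Complex-valued functions on [-1,1] are represented by pairs (u, v) of
   real-valued functions (real and imaginary parts); complex numbers by
   pairs (a, b) with modulus sqrt (a^2 + b^2). *)

Section Gegenbauer.
Variable R : realType.
Variable alpha : R.

Definition gweight (x : R) : R := powR (1 - x ^+ 2) alpha.

Definition calpha : R :=
  (fine (\int[@lebesgue_measure R]_(x in `[-1, 1]) (gweight x)%:E))^-1.

Definition gip (h g : R -> R) : R :=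
  calpha * fine (\int[@lebesgue_measure R]_(x in `[-1, 1])
                   (h x * g x * gweight x)%:E).

Definition orthonormal_system (L : nat -> {poly R}) : Prop :=
  (forall n, size (L n) = n.+1) /\
  (forall m n, gip (fun x => (L m).[x]) (fun x => (L n).[x]) = (m == n)%:R).

Definition cmod (a b : R) : R := Num.sqrt (a ^+ 2 + b ^+ 2).

(* |<f, L_n>| for the complex function f = u + i v (L_n is real) *)
Definition coef_abs (L : nat -> {poly R}) (u v : R -> R) (n : nat) : R :=
  cmod (gip u (fun x => (L n).[x])) (gip v (fun x => (L n).[x])).

Definition in_A (L : nat -> {poly R}) (r theta : R) (u v : R -> R) : Prop :=
  {within `[-1, 1], continuous u} /\ {within `[-1, 1], continuous v} /\
  (\sum_(0 <= n <oo)
      (powR (powR (1 + n%:R) r * coef_abs L u v n) theta)%:E <= 1%:E)%E.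

Definition supnorm (p q : R -> R) : \bar R :=
  ereal_sup [set (cmod (p x) (q x))%:E | x in `[-1, 1]].

Definition best_nterm_err (L : nat -> {poly R}) (n : nat) (u v : R -> R)
  : \bar R :=
  ereal_inf [set e | exists (J : seq nat) (a b : nat -> R),
     [/\ uniq J, size J = n &
          e = supnorm (fun x => u x - \sum_(j <- J) a j * (L j).[x])
                      (fun x => v x - \sum_(j <- J) b j * (L j).[x])]].

Definition sigma_n (L : nat -> {poly R}) (r theta : R) (n : nat) : \bar R :=
  ereal_sup [set e | exists u v : R -> R,
     in_A L r theta u v /\ e = best_nterm_err L n u v].

End Gegenbauer.

(* Main.v *)
Require Import Defs.
From HB Require Import structures.
From mathcomp Require Import all_boot all_order all_algebra.
From mathcomp Require Import all_classical all_reals all_analysis.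
From mathcomp Require Import measurable_realfun.
From mathcomp Require Import ring lra zify.
Set Implicit Arguments. Unset Strict Implicit. Unset Printing Implicit Defensive.
Import Order.TTheory GRing.Theory Num.Theory.
Import numFieldNormedType.Exports.
Local Open Scope classical_set_scope.
Local Open Scope ring_scope.

(* Put [lam = alpha + 1/2]. Lower bound: an approximant with [n] terms misses
   at least [n] of the [2n] equal coefficients of a flat sum of [L_j],
   [n <= j < 3n], and the norm of [L^2(mu_alpha)] is at most the sup norm.

   Upper bound: the series of [f] is cut into blocks [N <= j < 2N] with
   [N = n 2^k], and block [k] is approximated by [O(n kappa^k)] terms, for a
   suitable [kappa < 1]. The largest coefficients of a block are kept; the
   others have a small [l^1] norm and are sparsified by partial colouring: a
   perturbation [a_j (1 + x_j)] with half of the [x_j] equal to [+-1], chosen as a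
   maximiser of [sum x_j^2] minus a penalty of even degree [p], removes a fixed
   proportion of the terms and changes the sup norm by at most
   [O (b sqrt t (N/t)^(lam + 1/p))] if there are [t] terms bounded by [b]. It
   suffices to control the sum at [O(N)] Chebyshev nodes (by the Fejer kernels).
   At the few nodes close to [+-1] the sum is made to vanish; at the others one uses
   [(1 - x^2)^lam L_j(x)^2 <= C], which follows from the monotonicity of
   energy functionals (Sonin) of the Gegenbauer equation. What remains after
   finitely many blocks is small since [lam < r] and continuous functions are
   recovered uniformly from rapidly converging Gegenbauer series, which is
   checked against powers of peaking polynomials. *)

(** The endpoints shape the upper bound: [L_j] grows like [j^lam] at [+-1], so treating all nodes of
    a block alike would lose a factor [N^lam], whereas nothing may be lost when [N] and the number
    of terms are both close to [n]. Annihilating about [t/32] nodes at each end costs only a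
    fraction of the [t] degrees of freedom, and the other nodes satisfy [1 - x^2 >= c (t/N)^2],
    where [|L_j| <= C (N/t)^lam]. The penalty (of degree [p.+2] in the code) costs a further small
    power of [N/t], which is affordable because [lam < r] is strict. The colouring also keeps
    [sum |a_j|] fixed, so thinning can be iterated with one [l^1] bound; the errors grow
    geometrically as the support shrinks, and the last one dominates. With [A = lam + 1/p],
    approximating a block by [m] terms costs [N^(A-r) m^(-(1/theta - 1/2 + A))], and [kappa] is
    chosen to keep this summable for [N = n 2^k], [m = n kappa^k]. *)

(** * Partial colouring: linear algebra, power inequalities, extremal points of a polytope *)

(** Gram-Schmidt in the kernel of [A]: while fewer than [t] rows are present in [E] and [A]
    together, some unit vector is orthogonal to all of them. *)
Lemma orthonormal_rows (R : realType) (c t q : nat) (A : 'M[R]_(c, t)) :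
  (c + q <= t)%N ->
  exists E : 'M[R]_(q, t), E *m E^T = 1%:M /\ E *m A^T = 0.
Proof.
elim: q => [|q IHq] cqt.
  by exists 0; split; rewrite ?mul0mx //; apply/matrixP => -[].
have {IHq}[|E [EE EA]] := IHq; first by lia.
have [v vn0 vker] : exists2 v : 'rV[R]_t, v != 0 & v *m (col_mx E A)^T = 0.
  have : kermx (col_mx E A)^T != 0.
    rewrite kermx_eq0 /row_free; apply/negP => /eqP rk.
    have := rank_leq_col (col_mx E A)^T; rewrite rk; lia.
  move=> /rowV0Pn[v /sub_kermxP v0 vn0]; by exists v.
move: vker; rewrite tr_col_mx mul_mx_row -(@row_mx0 _ 1) => /eq_row_mx[vE vA].
pose s := (v *m v^T) 0 0.
have s_gt0 : 0 < s.
  rewrite /s mxE lt_neqAle; apply/andP; split; last first.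
    by apply: sumr_ge0 => i _; rewrite mxE -expr2 sqr_ge0.
  rewrite eq_sym psumr_eq0; last by move=> i _; rewrite mxE -expr2 sqr_ge0.
  apply: contraNN vn0 => /allP v0; apply/eqP/rowP => j.
  have := v0 j (mem_index_enum _); rewrite /= !mxE -expr2 sqrf_eq0.
  by move=> /eqP ->; rewrite ?mxE.
pose e := (Num.sqrt s)^-1 *: v.
have eE : e *m E^T = 0 by rewrite -scalemxAl vE scaler0.
have eA : e *m A^T = 0 by rewrite -scalemxAl vA scaler0.
have ee : e *m e^T = 1%:M.
  rewrite /e linearZ -scalemxAl -scalemxAr scalerA.
  rewrite [v *m v^T]mx11_scalar -/s -[in RHS]scalemx1 -scalemx1 scalerA.
  by rewrite -invfM -expr2 sqr_sqrtr ?ltW // mulVf // gt_eqF.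
rewrite -[q.+1]/(1 + q)%N; exists (col_mx e E); split.
  rewrite tr_col_mx mul_col_row ee eE EE scalar_mx_block; congr block_mx.
  by rewrite -[LHS]trmxK trmx_mul trmxK eE trmx0.
by rewrite mul_col_mx eA EA col_mx0.
Qed.

(** Bessel's inequality: the defect is the squared norm of [v - E^T E v]. *)
Lemma bessel_rows (R : realType) (t q : nat) (E : 'M[R]_(q, t)) (b : 'I_t -> R) :
  E *m E^T = 1%:M ->
  \sum_i (\sum_j E i j * b j) ^+ 2 <= \sum_j b j ^+ 2.
Proof.
move=> EE; pose v : 'cV[R]_t := \col_j b j.
have sq n (x : 'cV[R]_n) : (x^T *m x) 0 0 = \sum_j (x j 0) ^+ 2.
  by rewrite mxE; apply: eq_bigr => j _; rewrite mxE expr2.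
have Ev i : (E *m v) i 0 = \sum_j E i j * b j.
  by rewrite mxE; apply: eq_bigr => j _; rewrite mxE.
under eq_bigr do rewrite -Ev.
have vE j : b j = v j 0 by rewrite mxE.
under [leRHS]eq_bigr do rewrite vE.
rewrite -(sq _ v) -(sq _ (E *m v)) -subr_ge0.
suff -> : (v^T *m v) 0 0 - ((E *m v)^T *m (E *m v)) 0 0 =
   ((v - E^T *m (E *m v))^T *m (v - E^T *m (E *m v))) 0 0.
  by rewrite sq; apply: sumr_ge0 => j _; exact: sqr_ge0.
set w := E *m v.
have wT : w^T = v^T *m E^T by rewrite trmx_mul.
have vEw : v^T *m (E^T *m w) = w^T *m w by rewrite mulmxA -wT.
have -> : (v - E^T *m w)^T = v^T - w^T *m E.
  by rewrite [LHS]linearB /= trmx_mul trmxK.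
rewrite mulmxBl !mulmxBr vEw.
have -> : w^T *m E *m v = w^T *m w by rewrite -mulmxA.
have -> : w^T *m E *m (E^T *m w) = w^T *m w.
  by rewrite mulmxA -(mulmxA w^T) EE mulmx1.
by rewrite subrr subr0 [RHS]mxE; congr (_ + _); rewrite [RHS]mxE.
Qed.

Lemma pow_diff_bound (R : realType) (p : nat) (a h B : R) :
  0 <= h -> `|a| + h <= B ->
  `|(a + h) ^+ p.+1 - (a - h) ^+ p.+1| <= 2 * p.+1%:R * h * B ^+ p.
Proof.
move=> h0 aB; have B0 : 0 <= B by apply: le_trans aB; rewrite addr_ge0.
have l1 : `|a + h| <= B by apply: le_trans aB; rewrite -[X in _ <= _ + X]ger0_norm // ler_normD.
have l2 : `|a - h| <= B by apply: le_trans aB; rewrite -[X in _ <= _ + X]ger0_norm // ler_normB.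
rewrite subrXX normrM (_ : a + h - (a - h) = h + h); last by ring.
have -> : 2 * p.+1%:R * h * B ^+ p = `|h + h| * (p.+1%:R * B ^+ p).
  by rewrite ger0_norm ?addr_ge0 //; ring.
rewrite ler_wpM2l //; apply: le_trans (ler_norm_sum _ _ _) _.
have -> : p.+1%:R * B ^+ p = \sum_(i < p.+1) B ^+ p.
  by rewrite sumr_const card_ord mulr_natl.
apply: ler_sum => i _; rewrite normrM !normrX.
have -> : B ^+ p = B ^+ (p.+1.-1 - i) * B ^+ i.
  by rewrite -exprD subnK //= -ltnS.
by rewrite ler_pM ?exprn_ge0 ?lerXn2r ?nnegrE //.
Qed.

(** The induction carries the factor [(p+2)(p+1)], since raising the exponent turns the second
    difference into [a] times the old one plus [h] times a first difference; the square is a rounder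
    form. *)
Lemma pow_second_diff (R : realType) (p : nat) (a h B : R) :
  0 <= h -> `|a| + h <= B ->
  `|(a + h) ^+ p.+2 + (a - h) ^+ p.+2 - 2 * a ^+ p.+2|
    <= p.+2%:R ^+ 2 * h ^+ 2 * B ^+ p.
Proof.
move=> h0 aB; have B0 : 0 <= B by apply: le_trans aB; rewrite addr_ge0.
have aB' : `|a| <= B by apply: le_trans aB; rewrite lerDl.
suff H : `|(a + h) ^+ p.+2 + (a - h) ^+ p.+2 - 2 * a ^+ p.+2|
    <= (p.+2%:R * p.+1%:R) * h ^+ 2 * B ^+ p.
  apply: le_trans H _; rewrite ler_wpM2r ?exprn_ge0 // ler_wpM2r ?exprn_ge0 //.
  by rewrite expr2 ler_wpM2l // ler_nat.
elim: p => [|p IHp].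
  rewrite expr0 mulr1 (_ : _ - _ = 2 * h ^+ 2); last by ring.
  by rewrite ger0_norm ?mulr_ge0 ?exprn_ge0 // mulr1.
have -> : (a + h) ^+ p.+3 + (a - h) ^+ p.+3 - 2 * a ^+ p.+3 =
  a * ((a + h) ^+ p.+2 + (a - h) ^+ p.+2 - 2 * a ^+ p.+2) +
  h * ((a + h) ^+ p.+2 - (a - h) ^+ p.+2).
  by rewrite !(exprS _ p.+2); ring.
apply: le_trans (ler_normD _ _) _; rewrite !normrM (ger0_norm h0).
have d1 := @pow_diff_bound R p.+1 a h B h0 aB.
apply: (@le_trans _ _ (B * ((p.+2%:R * p.+1%:R) * h ^+ 2 * B ^+ p) +
   h * (2 * p.+2%:R * h * B ^+ p.+1))).
  by rewrite lerD ?ler_pM ?ler_wpM2l.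
rewrite le_eqVlt; apply/orP; left; apply/eqP.
rewrite (exprS B p) -(@natr1 _ p.+2) -(@natr1 _ p.+1); ring.
Qed.

(** Yields one step length that respects finitely many strict inequalities at once. *)
Lemma common_scale (R : realType) (K : finType) (b s : K -> R) :
  (forall k, 0 < s k) -> exists2 e : R, 0 < e & forall k, e * `|b k| <= s k.
Proof.
move=> s0; pose S := \sum_k `|b k| / s k.
have S0 : 0 <= S by apply: sumr_ge0 => k _; by rewrite divr_ge0 // ltW ?s0.
exists (S + 1)^-1 => [|k]; first by rewrite invr_gt0 ltr_wpDl.
rewrite mulrC ler_pdivrMr ?ltr_wpDl // mulrC -ler_pdivrMr //.
apply: (@le_trans _ _ S); last by rewrite lerDl.
rewrite /S (bigD1 k) //= lerDl; apply: sumr_ge0 => i _; by rewrite divr_ge0 // ltW ?s0.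
Qed.

Lemma continuous_lin (R : realType) (t : nat) (f : 'I_t -> R) :
  continuous (fun v : 'rV[R]_t => \sum_j v 0 j * f j).
Proof.
apply: (@continuous_big R _ +%R 0 xpredT _ _ _ (fun j (v : 'rV[R]_t) => v 0 j * f j)).
  exact: add_continuous.
move=> j _ x; apply: continuousM; first exact: coord_continuous.
exact: cst_continuous.
Qed.

Lemma polytope_max (R : realType) (t : nat) (K : finType) (f : K -> 'I_t -> R)
    (c : K -> R) (F : 'rV[R]_t -> R) :
  (forall k, 0 <= c k) -> continuous F ->
  (forall v : 'rV[R]_t, (forall k, `|\sum_j v 0 j * f k j| <= c k) ->
     forall j, `|v 0 j| <= 1) ->
  exists v : 'rV[R]_t,
    (forall k, `|\sum_j v 0 j * f k j| <= c k) /\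
    forall u : 'rV[R]_t, (forall k, `|\sum_j u 0 j * f k j| <= c k) -> F u <= F v.
Proof.
move=> c0 cF Pbox.
pose P := [set v : 'rV[R]_t | forall k, `|\sum_j v 0 j * f k j| <= c k].
have cP : compact P.
  have cB : compact [set v : 'rV[R]_t | forall i, v ord0 i \in `[(-1 : R), 1]].
    by apply: (@rV_compact _ _ (fun=> `[(-1 : R), 1]%classic)) => _; exact: segment_compact.
  apply: (subclosed_compact _ cB).
  - have -> : P = \bigcap_(k in [set: K])
        [set v : 'rV[R]_t | `|\sum_j v 0 j * f k j| <= c k].
      by apply/seteqP; split => v Pv k => [_|]; apply: Pv.
    apply: closed_bigI => k _.
    apply: (@preimage_closed _ _ (fun v : 'rV[R]_t => `|\sum_j v 0 j * f k j|) [set x | x <= c k]); last exact: closed_le.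
    move=> v _; apply: (continuous_comp (@continuous_lin _ _ _ v)).
    exact: norm_continuous.
  - by move=> v Pv j; rewrite /= in_itv /= -ler_norml; exact: Pbox.
have [|v Pv vmax] := @EVT_max_rV R t F P _ cP (continuous_subspaceT cF).
  exists 0 => k; rewrite big1 ?normr0 // => j _; by rewrite mxE mul0r.
exists v; split; first by rewrite inE in Pv.
by move=> u Pu; apply: vmax; rewrite inE.
Qed.

(* A maximiser of [F] on the polytope admits many two-sided feasible orthonormal directions, and [F] is midpoint-dominated along each of them. *)
Lemma polytope_max_directions (R : realType) (t q : nat) (K : finType)
    (f : K -> 'I_t -> R) (c : K -> R) (v : 'rV[R]_t) (F : 'rV[R]_t -> R)
    (B : finType) (b : B -> 'I_t -> R) (d : R) :
  (forall k, `|\sum_j v 0 j * f k j| <= c k) ->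
  (forall u : 'rV[R]_t, (forall k, `|\sum_j u 0 j * f k j| <= c k) -> F u <= F v) ->
  (#|[pred k : K | (`|\sum_(j < t) v 0 j * f k j| == c k)%R]| + q <= t)%N -> 0 < d ->
  exists E : 'M[R]_(q, t), exists2 e : R, 0 < e &
    [/\ E *m E^T = 1%:M,
        forall i y, e * `|\sum_j E i j * b y j| <= d &
        forall i, F (v + e *: row i E) + F (v - e *: row i E) <= 2 * F v].
Proof.
move=> vP vmax act_le d0.
pose act := [pred k : K | `|\sum_(j < t) v 0 j * f k j| == c k].
pose A : 'M[R]_(#|act|, t) := \matrix_(i, j) f (enum_val i) j.
have [E [EE EA]] := @orthonormal_rows R #|act| t q A act_le.
have EAk i k : k \in act -> \sum_j E i j * f k j = 0.
  move=> kact; have /matrixP/(_ i (enum_rank_in kact k)) := EA.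
  rewrite !mxE => EA0; rewrite -[RHS]EA0; apply: eq_bigr => j _.
  by rewrite !mxE enum_rankK_in.
(* The step [e] must respect the slack of every inactive constraint and the bound [d] on the forms
   [b]. Active constraints do not move along [E], so they receive the dummy pair 0 and 1. *)
pose bb (z : 'I_q * K + 'I_q * B) := match z with
  | inl (i, k) => if k \in act then 0 else \sum_j E i j * f k j
  | inr (i, y) => \sum_j E i j * b y j end.
pose ss (z : 'I_q * K + 'I_q * B) := match z with
  | inl (i, k) => if k \in act then 1 else c k - `|\sum_j v 0 j * f k j|
  | inr _ => d end.
have ss0 z : 0 < ss z.
  case: z => [[i k]|] //=; case: ifPn => // kact.
  by rewrite subr_gt0 lt_neqAle vP andbT.
have [e e0 ebs] := @common_scale R _ bb ss ss0.
exists E, e => //; split => // [i y|i]; first exact: ebs (inr (i, y)).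
have lin_row (s : R) k : \sum_j (v + s *: row i E) 0 j * f k j =
    \sum_j v 0 j * f k j + s * \sum_j E i j * f k j.
  rewrite mulr_sumr -big_split /=; apply: eq_bigr => j _.
  by rewrite !mxE mulrDl mulrA.
have feas (s : R) : `|s| = e ->
    forall k, `|\sum_j (v + s *: row i E) 0 j * f k j| <= c k.
  move=> se k; rewrite lin_row.
  have [kact|kact] := boolP (k \in act).
    by rewrite (EAk i k kact) mulr0 addr0.
  apply: le_trans (ler_normD _ _) _.
  have := ebs (inl (i, k)); rewrite /bb /ss (negbTE kact) normrM se; lra.
have Fp := vmax _ (feas e (gtr0_norm e0)).
have := vmax _ (feas (- e) _); rewrite scaleNr normrN gtr0_norm // => /(_ erefl) Fm.
by rewrite mulr2n mulrDl !mul1r lerD.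
Qed.

(** The bound involves the penalty [a^(p+2)] itself, which maximality controls. If [|a| <= eta] the
    term [eta^p] suffices; otherwise [|a|^p <= |a|^(p+2) / eta^2]. *)
Lemma pow_second_diff_le (R : realType) (p : nat) (a h eta : R) :
  ~~ odd p -> 0 < eta -> `|h| <= eta ->
  (a + h) ^+ p.+2 + (a - h) ^+ p.+2 - 2 * a ^+ p.+2
    <= p.+2%:R ^+ 2 * h ^+ 2 * (2 ^+ p * (eta ^+ p + a ^+ p.+2 / eta ^+ 2)).
Proof.
move=> podd eta0 heta.
have ev x : x ^+ p.+2 = `|x| ^+ p.+2 :> R.
  by rewrite -normrX ger0_norm // exprn_even_ge0 /= ?negbK.
apply: le_trans (ler_norm _) _.
have H := @pow_second_diff R p a `|h| (`|a| + eta) (normr_ge0 _).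
have -> : `|(a + h) ^+ p.+2 + (a - h) ^+ p.+2 - 2 * a ^+ p.+2| =
    `|(a + `|h|) ^+ p.+2 + (a - `|h|) ^+ p.+2 - 2 * a ^+ p.+2|.
  by case: (ger0P h) => // _; rewrite opprK [(a + h) ^+ _ + _]addrC.
apply: le_trans (H _) _; first by rewrite lerD2l.
rewrite real_normK ?num_real //.
apply: ler_wpM2l; first by rewrite mulr_ge0 ?sqr_ge0.
pose m := Num.max `|a| eta.
have m0 : 0 <= m by rewrite le_max normr_ge0.
apply: (@le_trans _ _ ((2 * m) ^+ p)).
  rewrite lerXn2r ?nnegrE ?addr_ge0 ?mulr_ge0 ?(ltW eta0) //.
  by rewrite mulr2n mulrDl mul1r lerD // le_max lexx ?orbT.
rewrite exprMn ler_wpM2l ?exprn_ge0 // /m maxEle.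
case: ifPn => [_|]; first by rewrite lerDl divr_ge0 ?sqr_ge0 // exprn_even_ge0 /= ?negbK.
rewrite -ltNge => /ltW ale.
rewrite ev; apply: (@le_trans _ _ (`|a| ^+ p.+2 / eta ^+ 2)); last first.
  by rewrite lerDr exprn_ge0 // ltW.
rewrite ler_pdivlMr ?exprn_gt0 // -(addn2 p) exprD ler_wpM2l ?exprn_ge0 //.
by rewrite lerXn2r ?nnegrE // ltW.
Qed.

(* Partial colouring: maximise [sum x_j^2 - 8 sum_y (g_y(x) / lambda)^(p+2)] over the cube cut by the constraints; if fewer than half of the coordinates were extreme, the second-order condition summed over an orthonormal family of free directions would contradict [hbig]. *)
Lemma partial_coloring (R : realType) (t p : nat) (Z Y : finType)
    (g : Z -> 'I_t -> R) (b : Y -> 'I_t -> R) (sigma eta lambda : R) :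
  ~~ odd p -> (0 < t)%N -> (8 * #|Z| <= t)%N ->
  (forall y j, `|b y j| <= sigma) -> 0 < eta -> 0 < lambda ->
  #|Y|%:R * eta ^+ p.+2 <= t%:R ->
  2 ^+ (p + 5) * p.+2%:R ^+ 2 * t%:R * sigma ^+ 2 < (lambda * eta) ^+ 2 ->
  exists x : 'I_t -> R,
    [/\ forall j, `|x j| <= 1,
        (t <= 2 * #|[pred j | (`|x j| == 1)%R]|)%N,
        forall z, \sum_j x j * g z j = 0 &
        forall y, `|\sum_j x j * b y j| <= lambda].
Proof.
move=> podd t0 Zt bs eta0 lam0 Yt hbig.
pose K := ('I_t + (Z + Y))%type.
pose f (k : K) : 'I_t -> R := match k with
  | inl i => fun j => (i == j)%:R | inr (inl z) => g z | inr (inr y) => b y end.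
pose c (k : K) : R := match k with
  | inl i => 1 | inr (inl z) => 0 | inr (inr y) => lambda end.
have c0 k : 0 <= c k by case: k => [|[|]] //= _; apply: ltW.
have coordE (v : 'rV[R]_t) i : \sum_j v 0 j * f (inl i) j = v 0 i.
  rewrite (bigD1 i) //= eqxx mulr1 big1 ?addr0 // => j.
  by rewrite eq_sym => /negbTE ->; rewrite mulr0.
pose T (y : Y) (v : 'rV[R]_t) := (\sum_j v 0 j * b y j) / lambda.
pose F (v : 'rV[R]_t) := \sum_j v 0 j ^+ 2 - 8 * \sum_y T y v ^+ p.+2.
have cF : continuous F.
  have c1 : continuous (fun v : 'rV[R]_t => \sum_j v 0 j ^+ 2).
    apply: (@continuous_big R _ +%R 0 xpredT _ _ _ (fun j (v : 'rV[R]_t) => v 0 j ^+ 2)).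
      exact: add_continuous.
    move=> j _ w; apply: (@continuous_comp _ _ _ (fun u : 'rV[R]_t => u 0 j) (fun z : R => z ^+ 2)).
      exact: coord_continuous.
    exact: exprn_continuous.
  have c2 : continuous (fun v : 'rV[R]_t => \sum_y T y v ^+ p.+2).
    apply: (@continuous_big R _ +%R 0 xpredT _ _ _ (fun y v => T y v ^+ p.+2)).
      exact: add_continuous.
    move=> y _ w; apply: (@continuous_comp _ _ _ (T y) (fun z : R => z ^+ p.+2)); last exact: exprn_continuous.
    by rewrite /T; apply: continuousM; [exact: continuous_lin|exact: cst_continuous].
  move=> v; apply: (cvgB (c1 v)); apply: cvgM (c2 v); exact: cvg_cst.
have [|v [vP vmax]] := @polytope_max R t K f c F c0 cF.
  by move=> v vP j; have := vP (inl j); rewrite coordE.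
have vj j : `|v 0 j| <= 1 by have := vP (inl j); rewrite coordE.
have Tv y : `|T y v| <= 1.
  rewrite normrM normfV (gtr0_norm lam0) ler_pdivrMr // mul1r.
  exact: vP (inr (inr y)).
have ev x : 0 <= x ^+ p.+2 :> R by rewrite exprn_even_ge0 /= ?negbK.
(* Comparison with the feasible point 0, where [F] vanishes. *)
have sumT : 8 * \sum_y T y v ^+ p.+2 <= t%:R.
  have : F 0 <= F v.
    by apply: vmax => k; rewrite big1 ?normr0 // => j _; rewrite mxE mul0r.
  have -> : F 0 = 0.
    rewrite /F big1 => [|j _]; last by rewrite mxE expr0n.
    rewrite big1 ?mulr0 ?subr0 // => y _.
    by rewrite /T big1 ?mul0r ?expr0n // => j _; rewrite mxE mul0r.
  rewrite subr_ge0 => /le_trans; apply.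
  apply: (@le_trans _ _ (\sum_(j < t) 1)); last by rewrite sumr_const card_ord.
  apply: ler_sum => j _; rewrite -real_normK ?num_real //.
  by rewrite -(expr1n _ 2) lerXn2r ?nnegrE.
exists (v 0); split => //; last 2 first.
- move=> z; have := vP (inr (inl z)); rewrite /= normr_le0 => /eqP; exact.
- by move=> y; exact: vP (inr (inr y)).
rewrite leqNgt; apply/negP => few.
pose act := [pred k : K | `|\sum_(j < t) v 0 j * f k j| == c k].
pose Yact := [pred y : Y | `|T y v| == 1].
(* An active [y] has [|T y v| = 1], so it pays a full unit of the penalty bounded in [sumT]. *)
have Yact_le : (8 * #|Yact| <= t)%N.
  rewrite -(ler_nat R) natrM; apply: le_trans sumT; rewrite ler_wpM2l //.
  rewrite -sum1_card natr_sum big_mkcond /=; apply: ler_sum => y _.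
  case: ifPn => // /eqP Ty1.
  have -> : T y v ^+ p.+2 = `|T y v| ^+ p.+2.
    by rewrite -normrX ger0_norm.
  by rewrite Ty1 expr1n.
have act_le : (#|act| <= #|[pred j | (`|v 0 j| == 1)%R]| + (#|Z| + #|Yact|))%N.
  rewrite -!sum1_card !(big_mkcond (fun _ => _ \in _)) /= !big_sumType /=.
  apply: leq_add; first by apply: leq_sum => j _; rewrite inE /= coordE.
  apply: leq_add.
    by apply: leq_sum => z _; case: ifP.
  apply: leq_sum => y _; rewrite !inE /= /T normrM normfV (gtr0_norm lam0).
  have -> // : forall x : R, (x / lambda == 1) = (x == lambda).
  move=> x; apply/eqP/eqP => [x1|->]; last by rewrite divff ?gt_eqF.
  by rewrite -[x](divfK (lt0r_neq0 lam0)) x1 mul1r.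
pose q := (t - #|act|)%N.
(* Active are fewer than [t/2] cube constraints and at most [t/8] each from [Z] and [Y]; a quarter
   of the directions remains free. *)
have q4 : (t <= 4 * q)%N by move: few Zt Yact_le act_le; rewrite /q; lia.
have actq : (#|act| + q <= t)%N by rewrite /q; move: q4; rewrite /q; lia.
have [E [e e0 [EE Eb Emid]]] := @polytope_max_directions R t q K f c v F Y b
  (eta * lambda) vP vmax actq (mulr_gt0 eta0 lam0).
pose h i y := \sum_j E i j * b y j.
(* Along row [i] the squares gain [2 e^2], and the second difference of the penalty must take it
   back. *)
have key i : 2 <= 8 * \sum_y p.+2%:R ^+ 2 * (h i y / lambda) ^+ 2 *
    (2 ^+ p * (eta ^+ p + T y v ^+ p.+2 / eta ^+ 2)).
  have Erow : \sum_j E i j ^+ 2 = 1.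
    have /matrixP/(_ i i) := EE; rewrite !mxE eqxx => Eii; rewrite -[RHS]Eii.
    by apply: eq_bigr => j _; rewrite mxE expr2.
  have TE (s : R) y : T y (v + s *: row i E) = T y v + s * (h i y / lambda).
    rewrite /T /h mulrA -mulrDl; congr (_ / _).
    rewrite mulr_sumr -big_split /=; apply: eq_bigr => j _.
    by rewrite !mxE mulrDl mulrA.
  have QE (s : R) : \sum_j (v + s *: row i E) 0 j ^+ 2 =
      \sum_j v 0 j ^+ 2 + 2 * s * (\sum_j v 0 j * E i j) + s ^+ 2.
    have -> : s ^+ 2 = s ^+ 2 * \sum_j E i j ^+ 2 by rewrite Erow mulr1.
    rewrite !mulr_sumr -!big_split /=.
    by apply: eq_bigr => j _; rewrite !mxE; ring.
  have := Emid i; rewrite -scaleNr /F !QE.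
  set S1 := \sum_y T y (v + e *: _) ^+ _; set S2 := \sum_y T y (v + - e *: _) ^+ _.
  set S0 := \sum_y T y v ^+ p.+2 => mid.
  have S12 : 2 * e ^+ 2 <= 8 * (S1 + S2 - 2 * S0).
    move: mid; rewrite sqrrN; lra.
  have : S1 + S2 - 2 * S0 <= e ^+ 2 * \sum_y p.+2%:R ^+ 2 * (h i y / lambda) ^+ 2 *
      (2 ^+ p * (eta ^+ p + T y v ^+ p.+2 / eta ^+ 2)).
    rewrite /S1 /S2 /S0 mulr_sumr mulr_sumr -sumrN -!big_split /=; apply: ler_sum => y _.
    rewrite !TE mulNr.
    apply: le_trans (@pow_second_diff_le R p _ _ eta podd eta0 _) _.
      rewrite mulrA normrM normfV (gtr0_norm lam0) ler_pdivrMr //.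
      by rewrite normrM (gtr0_norm e0); exact: Eb.
    rewrite exprMn le_eqVlt; apply/orP; left; apply/eqP; ring.
  move=> le2; rewrite -(ler_pM2l (exprn_gt0 2 e0)) [e ^+ 2 * 2]mulrC.
  apply: le_trans S12 _; rewrite [leRHS]mulrCA ler_wpM2l //.
(* Bessel bounds [\sum_i h i y ^+ 2] by [t sigma^2] for each [y]; the sums over [y] of the two terms
   in parentheses are each at most [t / eta^2]. *)
have sumkey : \sum_(i < q) (2 : R) <= 8 * (p.+2%:R ^+ 2 * 2 ^+ p / lambda ^+ 2 *
    (t%:R * sigma ^+ 2) * (2 * t%:R / eta ^+ 2)).
  apply: le_trans (ler_sum _ (fun i _ => key i)) _.
  rewrite -mulr_sumr ler_wpM2l // exchange_big /=.
  have bes y : \sum_i h i y ^+ 2 <= t%:R * sigma ^+ 2.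
    apply: le_trans (@bessel_rows R t q E (b y) EE) _.
    apply: (@le_trans _ _ (\sum_(j < t) sigma ^+ 2)).
      apply: ler_sum => j _; rewrite -real_normK ?num_real //.
      by rewrite lerXn2r ?nnegrE // (le_trans _ (bs y j)).
    by rewrite sumr_const card_ord mulr_natl.
  apply: (@le_trans _ _ (\sum_y (p.+2%:R ^+ 2 * 2 ^+ p / lambda ^+ 2 *
    (t%:R * sigma ^+ 2)) * (eta ^+ p + T y v ^+ p.+2 / eta ^+ 2))).
    apply: ler_sum => y _.
    rewrite (eq_bigr (fun i => h i y ^+ 2 * (p.+2%:R ^+ 2 * 2 ^+ p / lambda ^+ 2 *
       (eta ^+ p + T y v ^+ p.+2 / eta ^+ 2)))); last first.
      by move=> i _; rewrite exprMn exprVn; ring.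
    rewrite -mulr_suml [leRHS]mulrAC [leRHS]mulrC ler_wpM2r //.
    rewrite !mulr_ge0 ?invr_ge0 ?exprn_ge0 ?ler0n ?(ltW lam0) //.
    by rewrite addr_ge0 ?divr_ge0 ?sqr_ge0 ?ev // exprn_ge0 // ltW.
  rewrite -mulr_sumr ler_wpM2l //.
    apply: mulr_ge0; last by apply: mulr_ge0; rewrite ?ler0n ?sqr_ge0.
    apply: mulr_ge0; last by rewrite invr_ge0 sqr_ge0.
    by apply: mulr_ge0; rewrite ?sqr_ge0 ?exprn_ge0.
  rewrite big_split /= -mulr_suml sumr_const -[eta ^+ p *+ _]mulr_natl.
  rewrite ler_pdivlMr ?exprn_gt0 // mulrDl mulfVK ?gt_eqF ?exprn_gt0 //.
  rewrite -mulrA -exprD addn2 mulr2n mulrDl mul1r lerD //.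
  apply: le_trans sumT; rewrite ler_peMl //; last by rewrite ler1n.
  by apply: sumr_ge0.
move: sumkey; rewrite sumr_const card_ord -[2 *+ q]mulr_natl.
apply/negP; rewrite -ltNge.
have q4R : (t%:R : R) <= 4 * q%:R by rewrite -natrM ler_nat.
have tR : 0 < t%:R :> R by rewrite ltr0n.
apply: (@lt_le_trans _ _ (t%:R / 2)); last by lra.
(* The 32 in [2 ^+ (p + 5)] collects the 8 of [F], the 2 of the two terms in [sumkey], and a 2
   because [2 q] is only known to be at least [t / 2]. *)
set W := p.+2%:R ^+ 2 in hbig *.
rewrite [ltLHS](_ : _ = (2 ^+ (p + 5) * W * t%:R * sigma ^+ 2) /
    (lambda * eta) ^+ 2 * (t%:R / 2)); last first.
  by rewrite exprD; move: (2 ^+ p : R) => P2; field; rewrite !gt_eqF.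
by rewrite gtr_pMl ?divr_gt0 // ltr_pdivrMr ?mul1r ?exprn_gt0 ?mulr_gt0.
Qed.

(** * Fejer kernels and norming by Chebyshev nodes *)

(** Angles on the whole circle. For [M = 4n] the cosines with [i < 2n] are the zeros of the
    Chebyshev polynomial of degree [2n]; the other half repeats them. *)
Definition node {R : realType} (M i : nat) : R := (2 * i + 1)%:R * (pi / M%:R).

(** The squared modulus of the sum of [exp(i l x)] over [l < m], that is, [m] times the usual Fejer
    kernel. *)
Definition fejer (R : realType) (m : nat) (x : R) : R :=
  \sum_(l < m) \sum_(l' < m) cos ((l%:R - l'%:R) * x).

Lemma fejer_ge0 (R : realType) (m : nat) (x : R) : 0 <= fejer m x.
Proof.
suff -> : fejer m x = (\sum_(l < m) cos (l%:R * x)) ^+ 2 +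
    (\sum_(l < m) sin (l%:R * x)) ^+ 2 by rewrite addr_ge0 ?sqr_ge0.
rewrite !expr2 !mulr_suml -big_split /=; apply: eq_bigr => l _.
rewrite !mulr_sumr -big_split /=; apply: eq_bigr => l' _.
by rewrite mulrBl cosB.
Qed.

Lemma sin_addn2pi (R : realType) (a : R) (j : nat) :
  sin (a + j%:R * (pi *+ 2)) = sin a.
Proof. by elim: j => [|j IH]; rewrite ?mul0r ?addr0 // -natr1 mulrDl mul1r addrA sinD2pi. Qed.

(** Multiplied by the sine of [j pi / M] the sum telescopes, and the arguments at its two ends
    differ by [j] full turns. *)
Lemma node_sum_nat (R : realType) (M j : nat) (a : R) : (0 < j < M)%N ->
  \sum_(i < M) cos (a + j%:R * node M i) = 0.
Proof.
move=> /andP[j0 jM].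
have M0 : 0 < M%:R :> R by rewrite ltr0n; lia.
pose s := j%:R * (pi / M%:R) : R.
have s0 : 0 < sin s.
  apply: sin_gt0_pi; rewrite /s mulr_gt0 ?(divr_gt0 (pi_gt0 R) M0) ?ltr0n //=.
  by rewrite mulrCA gtr_pMr ?pi_gt0 // ltr_pdivrMr // mul1r ltr_nat.
apply: (mulfI (lt0r_neq0 s0)); rewrite mulr0 mulr_sumr.
pose f (i : nat) := sin (a + (2 * i)%:R * s) / 2.
rewrite (eq_bigr (fun i : 'I_M => f i.+1 - f i)) => [|i _]; last first.
  rewrite /f /node.
  have -> : a + (2 * i.+1)%:R * s = (a + j%:R * ((2 * i + 1)%:R * (pi / M%:R))) + s.
    by rewrite /s mulnS addnC !natrD; ring.
  have -> : a + (2 * i)%:R * s = (a + j%:R * ((2 * i + 1)%:R * (pi / M%:R))) - s.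
    by rewrite /s !natrD; ring.
  rewrite sinD sinB; by field.
have := telescope_sumr f (leq0n M); rewrite big_mkord => ->; rewrite /f.
rewrite muln0 mul0r addr0.
have -> : (2 * M)%:R * s = j%:R * (pi *+ 2).
  rewrite /s natrM -mulr_natr; field; rewrite gt_eqF //.
by rewrite sin_addn2pi subrr.
Qed.

Lemma node_sum (R : realType) (M : nat) (J : int) (a : R) : (`|J| < M)%N ->
  \sum_(i < M) cos (a + J%:~R * node M i) = M%:R * (J == 0)%:R * cos a.
Proof.
have [->|J0] := eqVneq J 0 => JM.
  rewrite mulr1 (eq_bigr (fun=> cos a)) => [|i _]; last by rewrite mul0r addr0.
  by rewrite sumr_const card_ord mulr_natl.
rewrite mulr0 mul0r; case: J J0 JM => j j0 jM.
  by apply: node_sum_nat; move: j0 jM; lia.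
apply: etrans (@node_sum_nat R M j.+1 (- a) _); last by move: jM; lia.
by apply: eq_bigr => i _; rewrite -cosN opprD NegzE mulrNz mulNr opprK.
Qed.

(** Frequency [k] comes from the [m - k] pairs with [l = l' + k], none if [k >= m], and from the
    mirrored pairs. There is no aliasing, as [k + |l - l'| < 3n] stays below the number [4n] of
    nodes. *)
Lemma fejer_reproduce (R : realType) (n m k : nat) (x : R) :
  (0 < n)%N -> (m <= 2 * n)%N -> (k <= n)%N ->
  \sum_(i < 4 * n) cos (k%:R * node (4 * n) i) * fejer m (x - node (4 * n) i)
    = (4 * n)%:R * (m - k)%:R * cos (k%:R * x).
Proof.
move=> n0 mn kn; set M := (4 * n)%N.
have dbl (l l' : 'I_m) : \sum_(i < M) cos (k%:R * node M i) *
      cos ((l%:R - l'%:R) * (x - node M i)) =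
    M%:R / 2 * cos (k%:R * x) * ((l == l' + k :> nat)%N%:R + (l' == l + k :> nat)%N%:R).
  pose D := l%:Z - l'%:Z.
  have DE : l%:R - l'%:R = D%:~R :> R by rewrite intrB.
  have H1 := @node_sum R M (k%:Z - D) (D%:~R * x).
  have H2 := @node_sum R M (k%:Z + D) (- (D%:~R * x)).
  have lm := ltn_ord l; have lm' := ltn_ord l'.
  have {}H1 := H1 ltac:(rewrite /D /M; lia).
  have {}H2 := H2 ltac:(rewrite /D /M; lia).
  rewrite (eq_bigr (fun i : 'I_M => 2^-1 * (cos (D%:~R * x + (k%:Z - D)%:~R * node M i) +
     cos (- (D%:~R * x) + (k%:Z + D)%:~R * node M i)))); last first.
    move=> i _; rewrite DE; set c := node M i.
    have -> : D%:~R * x + (k%:Z - D)%:~R * c = k%:R * c + D%:~R * (x - c) by rewrite intrB; ring.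
    have -> : - (D%:~R * x) + (k%:Z + D)%:~R * c = k%:R * c - D%:~R * (x - c) by rewrite intrD; ring.
    rewrite cosD cosB; by field.
  rewrite -mulr_sumr big_split /= H1 H2 cosN.
  have -> : (k%:Z - D == 0) = (l == l' + k :> nat)%N by rewrite /D; lia.
  have -> : (k%:Z + D == 0) = (l' == l + k :> nat)%N by rewrite /D; lia.
  set b1 := (l == _ :> nat)%N; set b2 := (l' == _ :> nat)%N.
  have e1 : b1%:R * cos (D%:~R * x) = b1%:R * cos (k%:R * x).
    rewrite /b1; case: eqP => [lE|]; last by rewrite !mul0r.
    by rewrite -DE lE natrD; congr (_ * cos _); ring.
  have e2 : b2%:R * cos (D%:~R * x) = b2%:R * cos (k%:R * x).
    rewrite /b2; case: eqP => [lE|]; last by rewrite !mul0r.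
    by rewrite -DE lE natrD -[cos (_ * x)]cosN; congr (_ * cos _); ring.
  move: (b1%:R : R) (b2%:R : R) e1 e2 => B1 B2 e1 e2.
  transitivity (M%:R / 2 * (B1 * cos (D%:~R * x) + B2 * cos (D%:~R * x))); first by field.
  by rewrite e1 e2; field.
rewrite /fejer (eq_bigr (fun i : 'I_M => \sum_(l < m) \sum_(l' < m)
   cos (k%:R * node M i) * cos ((l%:R - l'%:R) * (x - node M i)))); last first.
  by move=> i _; rewrite mulr_sumr; apply: eq_bigr => l _; rewrite mulr_sumr.
rewrite exchange_big /=; under eq_bigr => l _.
  rewrite exchange_big /=; under eq_bigr => l' _ do rewrite dbl.
  rewrite -mulr_sumr; over.
rewrite -mulr_sumr; under eq_bigr => l _ do rewrite big_split /=.
rewrite big_split /=.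
have cnt : \sum_(l < m) \sum_(l' < m) (l == l' + k :> nat)%N%:R = (m - k)%:R :> R.
  rewrite exchange_big /=.
  have in1 (l' : 'I_m) : \sum_(l < m) (l == l' + k :> nat)%N%:R = (l' < m - k)%N%:R :> R.
    case: ltnP => lk.
      have lt : (l' + k < m)%N by lia.
      rewrite (bigD1 (Ordinal lt)) //= eqxx big1 ?addr0 // => i.
      by rewrite -val_eqE /= => /negbTE ->.
    rewrite big1 // => i _; case: eqP => // iE; move: (ltn_ord i); lia.
  rewrite (eq_bigr _ (fun l _ => in1 l)).
  have -> : (m - k)%:R = \sum_(i < m - k) (1 : R) by rewrite sumr_const card_ord.
  rewrite (big_ord_widen m (fun=> 1)) ?leq_subr // [RHS]big_mkcond /=.
  by apply: eq_bigr => i _; case: ifP.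
rewrite cnt exchange_big /= cnt; by field.
Qed.

Lemma poly_cos_expansion (R : realType) (n : nat) (p : {poly R}) :
  (size p <= n.+1)%N ->
  exists c : nat -> R, forall x, p.[cos x] = \sum_(k < n.+1) c k * cos (k%:R * x).
Proof.
(* For [m = 0] the absolute value [|m - 1| = 1] is right because the cosine is even. *)
have shift (m : nat) (x : R) : cos (m%:R * x) * cos x =
    (cos (m.+1%:R * x) + cos ((`|m%:Z - 1|)%N%:R * x)) / 2.
  case: m => [|m]; first by rewrite mul0r cos0 !mul1r; field.
  have -> : m.+2%:R * x = m.+1%:R * x + x by rewrite -natr1; ring.
  have -> : `|m.+1%:Z - 1|%N%:R * x = m.+1%:R * x - x.
    have -> : `|m.+1%:Z - 1|%N = m by lia.
    by rewrite -(@natr1 _ m); ring.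
  by rewrite cosD cosB; field.
elim: n p => [|n IH] p sp.
  exists (fun=> p`_0) => x.
  by rewrite (size1_polyC sp) hornerC coefC /= big_ord1 mul0r cos0 mulr1.
have [c cE] := IH (drop_poly 1 p) ltac:(rewrite size_drop_poly; lia).
pose S (f : R -> R) := exists c : nat -> R,
  forall x, f x = \sum_(k < n.+2) c k * cos (k%:R * x).
have Scos a m : (m < n.+2)%N -> S (fun x => a * cos (m%:R * x)).
  move=> mn; exists (fun k => a * (k == m)%:R) => x.
  rewrite (bigD1 (Ordinal mn)) //= eqxx mulr1 big1 ?addr0 // => k.
  by rewrite -val_eqE /= => /negbTE ->; rewrite mulr0 mul0r.
have SD f g : S f -> S g -> S (fun x => f x + g x).
  move=> [cf fE] [cg gE]; exists (fun k => cf k + cg k) => x.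
  by rewrite fE gE -big_split /=; apply: eq_bigr => k _; rewrite mulrDl.
have Ssum m (f : nat -> R -> R) : (forall k, (k < m)%N -> S (f k)) ->
    S (fun x => \sum_(k < m) f k x).
  elim: m => [|m IHm] Sf.
    by exists (fun=> 0) => x; rewrite big_ord0 big1 // => k _; exact: mul0r.
  have [c' c'E] := SD _ _ (IHm (fun k km => Sf k (ltnW km))) (Sf m (ltnSn m)).
  by exists c' => x; rewrite big_ord_recr /= -c'E.
have [c' c'E] : S (fun x => p`_0 * cos (0%:R * x) +
    \sum_(k < n.+1) (c k / 2 * cos (k.+1%:R * x) + c k / 2 * cos (`|k%:Z - 1|%N%:R * x))).
  apply: (SD (fun x => _ * cos (0%:R * x))); first exact: Scos.
  apply: (Ssum n.+1 (fun k x => c k / 2 * cos (k.+1%:R * x) + c k / 2 * cos (`|k%:Z - 1|%N%:R * x))).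
  by move=> k kn; apply: SD; apply: Scos; lia.
exists c' => x; rewrite -c'E mul0r cos0 mulr1.
rewrite -{1}(poly_take_drop 1 p) hornerD hornerM hornerXn expr1 cE mulr_suml.
congr (_ + _).
  have -> : take_poly 1 p = (p`_0)%:P.
    apply/polyP => i; rewrite coef_take_poly coefC; by case: i => [|i].
  by rewrite hornerC.
by apply: eq_bigr => k _; rewrite -[LHS]mulrA shift; field.
Qed.

(* The nodes stay away from the endpoints [+-1], where the weight degenerates. *)
Lemma poly_norming (R : realType) (n : nat) (p : {poly R}) (B : R) :
  (0 < n)%N -> (size p <= n.+1)%N ->
  (forall i, (i < 2 * n)%N -> `|p.[cos (node (4 * n) i)]| <= B) ->
  forall x, -1 <= x <= 1 -> `|p.[x]| <= 3 * B.
Proof.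
move=> n0 sp pB x x1.
set M := (4 * n)%N; have M0 : 0 < M%:R :> R by rewrite ltr0n /M; lia.
have nR : 0 < n%:R :> R by rewrite ltr0n.
have {}pB i : (i < M)%N -> `|p.[cos (node M i)]| <= B.
  move=> iM; have [i2|i2] := ltnP i (2 * n); first exact: pB.
  have -> : cos (node M i) = cos (node M (M.-1 - i)) :> R.
    rewrite -[RHS]cosN -[RHS]cosD2pi; congr cos; rewrite /node.
    have -> : (2 * i + 1)%:R = 2 * M%:R - (2 * (M.-1 - i) + 1)%:R :> R.
      rewrite -natrM -natrB; last by move: iM; rewrite /M; lia.
      by congr (_%:R); move: iM i2; rewrite /M; lia.
    by rewrite -[pi *+ 2]mulr_natl; field; rewrite gt_eqF.
  by apply: pB; move: iM i2; rewrite /M; lia.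
rewrite -(@acosK _ x); last by rewrite in_itv.
set th := acos x; have [c cE] := @poly_cos_expansion R n p sp.
have nn2 : (n <= 2 * n)%N by lia.
(* De la Vallee Poussin: [(2n - k) - (n - k) = n] for every [k <= n], so the difference of two Fejer
   kernels reproduces degree [n]. *)
have rep : M%:R * n%:R * p.[cos th] =
    \sum_(i < M) p.[cos (node M i)] *
      (fejer (2 * n) (th - node M i) - fejer n (th - node M i)).
  rewrite cE mulr_sumr.
  under [RHS]eq_bigr => i _ do rewrite cE mulr_suml.
  rewrite exchange_big /=; apply: eq_bigr => k _.
  have kn : (k <= n)%N by rewrite -ltnS.
  under eq_bigr => i _ do rewrite -mulrA mulrBr.
  rewrite -mulr_sumr sumrB !fejer_reproduce //.
  have -> : (n - k)%:R = n%:R - k%:R :> R by rewrite natrB.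
  have -> : (2 * n - k)%:R = 2 * n%:R - k%:R :> R by rewrite natrB ?natrM //; lia.
  by rewrite -/M; ring.
(* The kernels are nonnegative with total masses proportional to [2n] and [n]; their sum over [n]
   gives the constant 3. *)
have tot m : (m <= 2 * n)%N -> \sum_(i < M) fejer m (th - node M i) = M%:R * m%:R.
  move=> mn; have := @fejer_reproduce R n m 0 th n0 mn (leq0n _).
  rewrite subn0 mul0r cos0 mulr1 => <-; apply: eq_bigr => i _.
  by rewrite mul0r cos0 mul1r.
have B0 : 0 <= B by apply: le_trans (pB 0%N _); rewrite // /M; lia.
rewrite -(ler_pM2l (mulr_gt0 M0 nR)).
rewrite -[M%:R * n%:R in leLHS]gtr0_norm ?mulr_gt0 // -normrM rep.
apply: le_trans (ler_norm_sum _ _ _) _.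
apply: (@le_trans _ _ (\sum_(i < M) B * (fejer (2 * n) (th - node M i) + fejer n (th - node M i)))).
  apply: ler_sum => i _; rewrite normrM ler_pM // ?pB //.
  by apply: le_trans (ler_normB _ _) _; rewrite !ger0_norm ?fejer_ge0.
rewrite -mulr_sumr big_split /= !tot // natrM le_eqVlt; apply/orP; left; apply/eqP; ring.
Qed.

(** * Integration against the Gegenbauer weight *)

Lemma is_derive_powR_poly (R : realType) (s x : R) (q : {poly R}) : 0 < 1 - x ^+ 2 ->
  is_derive x 1 (fun x => powR (1 - x ^+ 2) s * q.[x])
    (powR (1 - x ^+ 2) (s - 1) * ((1 - x ^+ 2) * q^`().[x] - 2 * s * x * q.[x])).
Proof.
move=> w0.
have dw : is_derive x 1 (fun x : R => 1 - x ^+ 2) (- (2 * x)).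
  have -> : (fun x : R => 1 - x ^+ 2) = horner (1 - 'X^2).
    by apply/funext => z; rewrite !hornerE.
  apply: is_derive_eq; rewrite derivB derivXn -polyC1 derivC !hornerE /=; ring.
have dp : is_derive x 1 (fun x : R => powR (1 - x ^+ 2) s)
    (s * powR (1 - x ^+ 2) (s - 1) * (- (2 * x))).
  exact: (@is_derive1_comp _ (@powR R ^~ s) (fun x => 1 - x ^+ 2) x _ _ (is_derive1_powR s w0) dw).
apply: (is_derive_eq (is_deriveM dp (is_derive_poly q x))).
rewrite /GRing.scale /= {1}(_ : powR (1 - x ^+ 2) s = powR (1 - x ^+ 2) (s - 1) * (1 - x ^+ 2)).
  ring.
rewrite -[X in _ * X](powRr1 (ltW w0)) -powRD; last by rewrite (gt_eqF w0) implybT.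
by rewrite subrK.
Qed.

Lemma weight_pos (R : realType) (x : R) : -1 < x < 1 -> 0 < 1 - x ^+ 2.
Proof. by move=> /andP[? ?]; nra. Qed.

Lemma powR_poly_continuous (R : realType) (s x : R) (q : {poly R}) : -1 < x < 1 ->
  {for x, continuous (fun x : R => powR (1 - x ^+ 2) s * q.[x])}.
Proof.
move=> /weight_pos w0; apply/differentiable_continuous/derivable1_diffP.
by have [] := is_derive_powR_poly s q w0.
Qed.

(** Stated on [[-b, b]] with [b < 1] because powers of [1 - x^2] may be singular at [+-1]; limits
    are taken afterwards. *)
Lemma FTC_powR_poly (R : realType) (s b : R) (q : {poly R}) : 0 < b < 1 ->
  (\int[@lebesgue_measure R]_(x in `[(- b)%R, b])
     (powR (1 - x ^+ 2) (s - 1) * ((1 - x ^+ 2) * q^`().[x] - 2 * s * x * q.[x]))%:E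
   = (powR (1 - b ^+ 2) s * (q.[b] - q.[- b]))%:E)%E.
Proof.
move=> /andP[b0 b1].
have bb : - b < b by lra.
have inI x : x \in `[- b, b] -> -1 < x < 1 by rewrite in_itv /=; lra.
pose q2 := (1 - 'X^2) * q^`() - (2 * s)%:P * 'X * q.
have q2E x : (1 - x ^+ 2) * q^`().[x] - 2 * s * x * q.[x] = q2.[x].
  by rewrite /q2 !hornerE.
under eq_integral do rewrite q2E.
rewrite (@continuous_FTC2 _ _ (fun x => powR (1 - x ^+ 2) s * q.[x])) //.
- by rewrite sqrrN -EFinB mulrBr.
- apply: continuous_in_subspaceT => x /set_mem xI.
  by apply: powR_poly_continuous; exact: inI.
- split.
  + move=> x xI; have /weight_pos w0 : -1 < x < 1.
      by apply: inI; apply: subset_itv_oo_cc.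
    by have [] := is_derive_powR_poly s q w0.
  + by apply: cvg_at_right_filter; apply: powR_poly_continuous; lra.
  + by apply: cvg_at_left_filter; apply: powR_poly_continuous; lra.
- move=> x xI; have /weight_pos w0 : -1 < x < 1.
    by apply: inI; apply: subset_itv_oo_cc.
  by have [_ ] := is_derive_powR_poly s q w0; rewrite derive1E q2E.
Qed.

(** A bound independent of [b]. With [w = 1 - x^2], the derivative of [w^(alpha+1) x] is
    [w^alpha (w - 2(alpha+1) x^2)]; adding [(2 alpha + 2) w^alpha] gives
    [(2 alpha + 3) w^(alpha+1)], which is at most [2 alpha + 3]. *)
Lemma gweight_itv_bound (R : realType) (alpha b : R) : -1 < alpha -> 0 < b < 1 ->
  (\int[@lebesgue_measure R]_(x in `[(- b)%R, b]) (gweight alpha x)%:E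
     <= ((2 * alpha + 3) * 2 / (2 * alpha + 2))%:E)%E.
Proof.
move=> a1 b01; have /andP[b0 b1] := b01.
pose mu := @lebesgue_measure R.
have inI x : (`[- b, b]%classic : set R) x -> -1 < x < 1 by rewrite /= in_itv /=; lra.
have ci s (q : {poly R}) : mu.-integrable `[- b, b] (EFin \o (fun x => powR (1 - x ^+ 2) s * q.[x])).
  apply: continuous_compact_integrable; first exact: segment_compact.
  by apply: continuous_in_subspaceT => x /set_mem xI; apply: powR_poly_continuous; exact: inI.
pose q2 : {poly R} := (1 - 'X^2) - (2 * (alpha + 1))%:P * 'X * 'X.
have FT := @FTC_powR_poly R (alpha + 1) b 'X b01.
rewrite addrK derivX in FT.
have {}FT : \int[mu]_(x in `[(- b)%R, b]) (powR (1 - x ^+ 2) alpha * q2.[x]) = powR (1 - b ^+ 2) (alpha + 1) * (2 * b).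
  have -> : powR (1 - b ^+ 2) (alpha + 1) * (2 * b) =
      powR (1 - b ^+ 2) (alpha + 1) * (('X : {poly R}).[b] - 'X.[- b]).
    by rewrite !hornerX; congr (_ * _); ring.
  rewrite /Rintegral -[RHS]/(fine (EFin _)) -FT; congr fine.
  apply: eq_integral => x _; congr (EFin (_ * _)).
  by rewrite /q2 !hornerE; ring.
have q2E x : q2.[x] = (1 - x ^+ 2) - 2 * (alpha + 1) * x * x.
  by rewrite /q2 !hornerE; ring.
have one x : (1 : {poly R}).[x] = 1 by rewrite -polyC1 hornerC.
have mI : measurable (`[- b, b] : set R) by [].
have S : (2 * alpha + 2) * \int[mu]_(x in `[(- b)%R, b]) (powR (1 - x ^+ 2) alpha * (1 : {poly R}).[x])
    + \int[mu]_(x in `[(- b)%R, b]) (powR (1 - x ^+ 2) alpha * q2.[x]) <= (2 * alpha + 3) * (2 * b).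
  have e1 : (2 * alpha + 3) * (2 * b) = \int[mu]_(x in `[(- b)%R, b]) (2 * alpha + 3).
    rewrite Rintegral_cst //.
    congr (_ * _); rewrite -[LHS]/(fine (2 * b)%:E); congr fine; apply: esym.
    apply: etrans (@lebesgue_measure_itv R `[- b, b]) _; rewrite /= lte_fin.
    by rewrite (_ : - b < b = true); [rewrite -EFinB; congr EFin; ring|lra].
  rewrite e1 -RintegralZl // -RintegralD //; last first.
    by apply: eq_integrable (ci alpha (2 * alpha + 2)%:P) => // x _ /=; rewrite one hornerC; congr EFin; ring.
  apply: le_Rintegral => //.
  - apply: eq_integrable (ci alpha ((2 * alpha + 2)%:P + q2)) => // x _ /=.
    by rewrite hornerD one hornerC; congr EFin; ring.
  - apply: continuous_compact_integrable; first exact: segment_compact.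
    by apply: continuous_subspaceT => x; exact: cst_continuous.
  - move=> x /inI/weight_pos w0.
    have -> : (2 * alpha + 2) * ((1 - x ^+ 2) `^ alpha * (1 : {poly R}).[x]) + (1 - x ^+ 2) `^ alpha * q2.[x] = (2 * alpha + 3) * powR (1 - x ^+ 2) (alpha + 1).
      rewrite powRD; last by rewrite (gt_eqF w0) implybT.
      by rewrite powRr1 ?ltW // one q2E; ring.
    rewrite ler_piMr //; first by lra.
    apply: (@le_trans _ _ (powR 1 (alpha + 1))); last by rewrite powR1.
    apply: ge0_ler_powR; rewrite ?nnegrE; [by lra|by apply: ltW|by []|].
    by rewrite gerBl sqr_ge0.
rewrite FT in S.
have P0 : 0 <= (1 - b ^+ 2) `^ (alpha + 1) by exact: powR_ge0.
have -> : (\int[@lebesgue_measure R]_(x in `[(- b)%R, b]) (gweight alpha x)%:E)%E =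
    (\int[mu]_(x in `[(- b)%R, b]) (powR (1 - x ^+ 2) alpha * (1 : {poly R}).[x]))%:E.
  rewrite /Rintegral fineK; first by apply: eq_integral => x _; rewrite hornerC mulr1.
  by apply: integrable_fin_num => //; exact: ci alpha 1.
rewrite lee_fin ler_pdivlMr; last by lra.
nra.
Qed.

Definition trunc (R : realType) (k : nat) : R := 1 - k.+2%:R^-1.

Lemma trunc_bound (R : realType) (k : nat) : 0 < (trunc R k) < 1.
Proof.
rewrite /trunc gtrBl invr_gt0 ltr0n andbT subr_gt0 invf_lt1 ?ltr0n //.
by rewrite ltr1n.
Qed.

Lemma trunc_mono (R : realType) (k l : nat) : (k <= l)%N -> trunc R k <= trunc R l.
Proof. by move=> kl; rewrite lerB // lef_pV2 ?posrE ?ltr0n // ler_nat. Qed.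

Lemma trunc_cover (R : realType) (x : R) : -1 < x < 1 ->
  exists k, forall l, (k <= l)%N -> - trunc R l <= x <= trunc R l.
Proof.
move=> x1; have d0 : 0 < 1 - `|x| by rewrite subr_gt0 ltr_norml.
exists (Num.truncn (1 - `|x|)^-1) => l kl; rewrite -ler_norml /trunc lerBrDl -lerBrDr.
rewrite -[leRHS]invrK lef_pV2 ?posrE ?invr_gt0 ?ltr0n //.
apply: ltW; apply: lt_le_trans (truncnS_gt _) _.
by rewrite ler_nat; apply: leq_trans (_ : l.+1 <= _)%N.
Qed.

Lemma measurable_gweight (R : realType) (alpha : R) (A : set R) :
  measurable_fun A (gweight alpha).
Proof.
apply: measurable_funTS; rewrite /gweight.
apply: (measurableT_comp (measurable_powR alpha)) => //.
by apply: measurable_funB => //; exact: measurable_funX.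
Qed.

Lemma gweight_ge0 (R : realType) (alpha x : R) : 0 <= gweight alpha x.
Proof. exact: powR_ge0. Qed.

(** Monotone convergence along [[- trunc k, trunc k]]; the two endpoints form a null set. *)
Lemma gweight_integrable (R : realType) (alpha : R) : -1 < alpha ->
  (@lebesgue_measure R).-integrable `[-1, 1] (EFin \o gweight alpha).
Proof.
move=> a1; pose mu := @lebesgue_measure R.
have mg (A : set R) : measurable_fun A (EFin \o gweight alpha).
  by apply/measurable_EFinP; exact: measurable_gweight.
apply/integrableP; split; first exact: mg.
under eq_integral => x _ do rewrite gee0_abs ?lee_fin ?gweight_ge0 //.
have -> : (\int[mu]_(x in `[(-1)%R, 1%R]) (EFin \o gweight alpha) x =
    \int[mu]_(x in `](-1)%R, 1%R[) (EFin \o gweight alpha) x)%E.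
  rewrite (@integral_itv_bndo_bndc R (BRight (-1)) 1 (EFin \o gweight alpha)); last exact: mg.
  by rewrite (@integral_itv_obnd_cbnd R (-1) (BRight 1) (EFin \o gweight alpha)) //; exact: mg.
pose F k : set R := `[- trunc R k, trunc R k]%classic.
have <- : \bigcup_k F k = `]-1, 1[%classic.
  apply/seteqP; split => [x [k _]|x] /=; rewrite /F /= !in_itv /=.
    by have := trunc_bound R k; lra.
  move=> /trunc_cover[k kx]; exists k => //=; rewrite in_itv /=; exact: kx.
have ndF : nondecreasing_seq F.
  move=> k l kl; rewrite subsetEset => x; rewrite /F /= !in_itv /=.
  by have := trunc_mono R kl; lra.
have mF k : measurable (F k) by exact: measurable_itv.
have cv : (\int[mu]_(x in F k) (EFin \o gweight alpha) x @[k --> \oo] -->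
    \int[mu]_(x in \bigcup_k F k) (EFin \o gweight alpha) x)%E.
  apply: ge0_nondecreasing_set_cvg_integral => //.
  - by move=> k; exact: mg.
  - by move=> k x _; rewrite lee_fin gweight_ge0.
apply: le_lt_trans (ltry ((2 * alpha + 3) * 2 / (2 * alpha + 2))).
apply: (cvge_to_le cv); apply: nearW => k.
by apply: gweight_itv_bound => //; exact: trunc_bound.
Qed.

Lemma gweightM_integrable (R : realType) (alpha : R) (h : R -> R) : -1 < alpha ->
  {within `[-1, 1], continuous h} ->
  (@lebesgue_measure R).-integrable `[-1, 1] (EFin \o (fun x => h x * gweight alpha x)).
Proof.
move=> a1 ch.
have -> : EFin \o (fun x => h x * gweight alpha x) =
    ((EFin \o h) \* (EFin \o gweight alpha))%E by [].
apply: integrableMr => //; last exact: gweight_integrable.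
  exact: subspace_continuous_measurable_fun.
have := compact_bounded (continuous_compact ch (@segment_compact R (-1) 1)).
by move=> [M [Mr hM]]; exists M; split => // N MN x xI; apply: (hM N MN); exists x.
Qed.

Definition gexp (R : realType) (alpha : R) (h : R -> R) : R :=
  calpha alpha * \int[@lebesgue_measure R]_(x in `[-1, 1]) (h x * gweight alpha x).

Lemma gipE (R : realType) (alpha : R) (h g : R -> R) :
  gip alpha h g = gexp alpha (fun x => h x * g x).
Proof. by []. Qed.

(** [[a, b]] lies inside the open interval, so the continuous weight has a positive minimum
    there. *)
Lemma Rintegral_gweight_gt0 (R : realType) (alpha a b c : R) (h : R -> R) : -1 < alpha ->
  {within `[-1, 1], continuous h} -> (forall x, -1 <= x <= 1 -> 0 <= h x) ->
  -1 < a -> a < b -> b < 1 -> 0 < c -> (forall x, a <= x <= b -> c <= h x) ->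
  0 < \int[@lebesgue_measure R]_(x in `[-1, 1]) (h x * gweight alpha x).
Proof.
move=> a1 ch h0 aN1 ab b1 c0 hc.
pose mu := @lebesgue_measure R.
have ih := gweightM_integrable a1 ch.
have sub : (`[a, b]%classic : set R) `<=` `[-1, 1]%classic.
  by move=> x /=; rewrite !in_itv /=; lra.
have [d d0 dw] : exists2 d : R, 0 < d & forall x, a <= x <= b -> d <= gweight alpha x.
  have [|x0 x0I x0min] := @EVT_min R (fun x => powR (1 - x ^+ 2) alpha * (1 : {poly R}).[x]) a b (ltW ab).
    apply: continuous_in_subspaceT => x /set_mem /=; rewrite in_itv /= => xI.
    by apply: powR_poly_continuous; lra.
  exists (gweight alpha x0).
    apply: powR_gt0; apply: weight_pos; move: x0I; rewrite in_itv /=; lra.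
  move=> x xI; have := x0min x; rewrite in_itv /= => /(_ xI).
  by rewrite -polyC1 !hornerC !mulr1.
rewrite -lte_fin /Rintegral fineK; last exact: integrable_fin_num.
apply: (@lt_le_trans _ _ (\int[mu]_(x in `[a, b]) (c * d)%:E)%E).
  have -> : (\int[mu]_(x in `[a, b]) (c * d)%:E = (c * d * (b - a))%:E)%E.
    rewrite integral_cst // [RHS]EFinM; congr (_ * _)%E.
    by apply: etrans (@lebesgue_measure_itv R `[a, b]) _; rewrite /= lte_fin ab.
  by rewrite lte_fin !mulr_gt0 // subr_gt0.
apply: (@le_trans _ _ (\int[mu]_(x in `[a, b]) (h x * gweight alpha x)%:E)%E).
  apply: ge0_le_integral => //=.
  - by move=> x _; rewrite lee_fin mulr_ge0 // ltW.
  - by apply/measurable_EFinP; apply: measurable_funS sub _ => //; apply/measurable_EFinP; case/integrableP : ih.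
  - move=> x; rewrite in_itv /= => xI; rewrite lee_fin ler_pM ?(ltW c0) ?(ltW d0) //; [exact: hc|exact: dw].
apply: ge0_subset_integral => //=.
  by case/integrableP : ih.
by move=> x; rewrite in_itv /= => xI; rewrite lee_fin mulr_ge0 ?gweight_ge0 // h0.
Qed.

Lemma within_continuousD (R : realType) (A : set R) (h g : R -> R) :
  {within A, continuous h} -> {within A, continuous g} ->
  {within A, continuous (fun x => h x + g x)}.
Proof. by move=> ch cg x; apply: cvgD; [exact: ch|exact: cg]. Qed.

Lemma within_continuousM (R : realType) (A : set R) (h g : R -> R) :
  {within A, continuous h} -> {within A, continuous g} ->
  {within A, continuous (fun x => h x * g x)}.
Proof. by move=> ch cg x; apply: cvgM; [exact: ch|exact: cg]. Qed.

Lemma within_continuous_cst (R : realType) (A : set R) (a : R) :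
  {within A, continuous (fun=> a)}.
Proof. by move=> x; exact: cvg_cst. Qed.

Lemma within_continuous_poly (R : realType) (A : set R) (p : {poly R}) :
  {within A, continuous (horner p)}.
Proof. by apply: continuous_subspaceT; exact: continuous_horner. Qed.

Lemma gweight_mass_gt0 (R : realType) (alpha : R) : -1 < alpha ->
  0 < \int[@lebesgue_measure R]_(x in `[-1, 1]) gweight alpha x.
Proof.
move=> a1.
have -> : \int[@lebesgue_measure R]_(x in `[-1, 1]) gweight alpha x =
    \int[@lebesgue_measure R]_(x in `[-1, 1]) (1 * gweight alpha x).
  by apply: eq_Rintegral => x _; rewrite mul1r.
apply: (@Rintegral_gweight_gt0 R alpha (-1/2) (1/2) 1 (fun=> 1)) => //; try lra.
exact: within_continuous_cst.
Qed.

Lemma calpha_gt0 (R : realType) (alpha : R) : -1 < alpha -> 0 < calpha alpha.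
Proof. by move=> a1; rewrite /calpha invr_gt0; exact: gweight_mass_gt0. Qed.

Lemma gexp_cst (R : realType) (alpha a : R) : -1 < alpha -> gexp alpha (fun=> a) = a.
Proof.
move=> a1; rewrite /gexp RintegralZl //; last exact: gweight_integrable.
by rewrite /calpha mulrCA mulVf ?mulr1 // gt_eqF // gweight_mass_gt0.
Qed.

Lemma eq_gexp (R : realType) (alpha : R) (h g : R -> R) :
  (forall x, -1 <= x <= 1 -> h x = g x) -> gexp alpha h = gexp alpha g.
Proof.
move=> hg; rewrite /gexp; congr (_ * _); apply: eq_Rintegral => x /set_mem /=.
by rewrite in_itv /= => xI; rewrite hg.
Qed.

Lemma gexpD (R : realType) (alpha : R) (h g : R -> R) : -1 < alpha ->
  {within `[-1, 1], continuous h} -> {within `[-1, 1], continuous g} ->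
  gexp alpha (fun x => h x + g x) = gexp alpha h + gexp alpha g.
Proof.
move=> a1 ch cg; rewrite /gexp -mulrDr; congr (_ * _).
under eq_Rintegral do rewrite mulrDl.
by rewrite RintegralD //; exact: gweightM_integrable.
Qed.

Lemma gexpZ (R : realType) (alpha a : R) (h : R -> R) : -1 < alpha ->
  {within `[-1, 1], continuous h} ->
  gexp alpha (fun x => a * h x) = a * gexp alpha h.
Proof.
move=> a1 ch; rewrite /gexp mulrCA; congr (_ * _).
under eq_Rintegral do rewrite -mulrA.
by rewrite RintegralZl //; exact: gweightM_integrable.
Qed.

Lemma le_gexp (R : realType) (alpha : R) (h g : R -> R) : -1 < alpha ->
  {within `[-1, 1], continuous h} -> {within `[-1, 1], continuous g} ->
  (forall x, -1 <= x <= 1 -> h x <= g x) -> gexp alpha h <= gexp alpha g.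
Proof.
move=> a1 ch cg hg; rewrite ler_pM2l ?calpha_gt0 //.
apply: le_Rintegral => //; [exact: gweightM_integrable|exact: gweightM_integrable|].
by move=> x; rewrite /= in_itv /= => xI; rewrite ler_wpM2r ?gweight_ge0 // hg.
Qed.

Lemma gexp_gt0 (R : realType) (alpha a b c : R) (h : R -> R) : -1 < alpha ->
  {within `[-1, 1], continuous h} -> (forall x, -1 <= x <= 1 -> 0 <= h x) ->
  -1 < a -> a < b -> b < 1 -> 0 < c -> (forall x, a <= x <= b -> c <= h x) ->
  0 < gexp alpha h.
Proof.
move=> a1 ch h0 aN1 ab b1 c0 hc; rewrite mulr_gt0 ?calpha_gt0 //.
exact: (@Rintegral_gweight_gt0 R alpha a b c).
Qed.

(* Pearson's identity: [w^alpha (w q' - 2(alpha+1) x q)] is the derivative of [w^(alpha+1) q], which vanishes at [+-1]. *)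
Lemma gexp_pearson (R : realType) (alpha : R) (q : {poly R}) : -1 < alpha ->
  gexp alpha (fun x => (1 - x ^+ 2) * q^`().[x] - 2 * (alpha + 1) * x * q.[x]) = 0.
Proof.
move=> a1; set h := (fun x : R => _ - _).
rewrite /gexp.
have hE : h = horner ((1 - 'X^2) * q^`() - (2 * (alpha + 1))%:P * 'X * q).
  by apply/funext => x; rewrite /h !hornerE.
have ch : {within `[-1, 1], continuous h} by rewrite hE; exact: within_continuous_poly.
have ih := gweightM_integrable a1 ch.
pose f x := (h x * gweight alpha x)%:E.
pose mu := @lebesgue_measure R.
have mf (A : set R) : measurable_fun A f.
  apply/measurable_EFinP; apply: measurable_funM; last exact: measurable_gweight.
  apply: measurable_funTS; rewrite hE.
  by apply: continuous_measurable_fun; exact: continuous_horner.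
have openE : (\int[mu]_(x in `[(-1)%R, 1%R]) f x = \int[mu]_(x in `](-1)%R, 1%R[) f x)%E.
  rewrite (@integral_itv_bndo_bndc R (BRight (-1)) 1 f); last exact: mf.
  by rewrite (@integral_itv_obnd_cbnd R (-1) (BRight 1) f) //; exact: mf.
suff -> : \int[mu]_(x in `[-1, 1]) (h x * gweight alpha x) = 0 by rewrite mulr0.
rewrite /Rintegral openE.
pose F k : set R := `[- trunc R k, trunc R k]%classic.
have FD k : F k `<=` `]-1, 1[%classic.
  by move=> x; rewrite /F /= !in_itv /=; have := trunc_bound R k; lra.
have mF k : measurable (F k) by exact: measurable_itv.
(* The integrals over [F k] tend to the full integral. By [FTC_powR_poly] they are boundary terms,
   which tend to 0 because [alpha + 1 > 0]. *)
have [] := @dominated_convergence _ _ R (@lebesgue_measure R) `]-1, 1[%classic _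
   (fun k => f \_ (F k)) f (abse \o f).
- exact: measurable_itv.
- by move=> k; apply/(measurable_restrict f (mF k) (measurable_itv _)); exact: mf.
- exact: mf.
- apply: aeW => x; rewrite /= in_itv /= => /trunc_cover[k kx].
  apply: cvg_near_cst; near=> l; rewrite patchE mem_set // /F /= in_itv /=.
  by apply: kx; near: l; exact: nbhs_infty_ge.
- apply: integrable_abse; apply: integrableS ih => //.
  by move=> x; rewrite /= !in_itv /=; lra.
- apply: aeW => x k _; rewrite patchE /=.
  by case: ifP => // _; rewrite abse0.
move=> _ _; under eq_fun => k.
  rewrite -integral_mkcondr setIidr; last exact: FD.
  over.
move=> cv.
have tr1 : trunc R k @[k --> \oo] --> (1 : R).
  rewrite -[X in _ --> X]subr0; apply: cvgB; first exact: cvg_cst.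
  by have := @cvg_harmonic R; rewrite -cvg_shiftS.
have wk0 : powR (1 - trunc R k ^+ 2) (alpha + 1) @[k --> \oo] --> (0 : R).
  have ap1 : 0 < alpha + 1 by lra.
  have /cvg_at_rightP := @powR_cvg0 R _ ap1.
  move=> /(_ (fun k => 1 - trunc R k ^+ 2)); apply; split.
    by move=> k; apply: weight_pos; have := trunc_bound R k; lra.
  rewrite [X in _ --> X](_ : 0 = 1 - 1 * 1 :> R); last by ring.
  by apply: cvgB; [exact: cvg_cst|exact: (cvgM tr1 tr1)].
have qk : (q.[trunc R k] - q.[- trunc R k]) @[k --> \oo] --> q.[1] - q.[-1].
  apply: cvgB; first by apply: continuous_cvg => //; exact: continuous_horner.
  apply: continuous_cvg; first exact: continuous_horner.
  exact: cvgN.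
have cv0 : (\int[mu]_(x in F k) f x @[k --> \oo] --> 0)%E.
  have -> : (fun k => \int[mu]_(x in F k) f x)%E = EFin \o
      (fun k => powR (1 - trunc R k ^+ 2) (alpha + 1) * (q.[trunc R k] - q.[- trunc R k])).
    apply/funext => k; rewrite /= -(FTC_powR_poly _ _ (trunc_bound R k)).
    by apply: eq_integral => x _; rewrite /f /h /gweight addrK mulrC.
  by apply: cvg_EFin; [by apply: nearW|rewrite -[X in _ --> X](mul0r (q.[1] - q.[-1])); exact: cvgM].
by rewrite (cvg_unique _ cv cv0).
Unshelve. all: by end_near. Qed.

(** * Orthonormal polynomials and the Gegenbauer equation *)

Lemma graded_basis (R : realType) (L : nat -> {poly R}) (n : nat) (p : {poly R}) :
  (forall n, size (L n) = n.+1) -> (size p <= n)%N ->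
  exists c : nat -> R, p = \sum_(j < n) c j *: L j.
Proof.
move=> sL; elim: n p => [|n IH] p sp.
  exists (fun=> 0); rewrite big_ord0; apply/eqP; by rewrite -size_poly_leq0.
have Ln0 : lead_coef (L n) != 0 by rewrite lead_coef_eq0 -size_poly_eq0 sL.
pose a := p`_n / lead_coef (L n).
have [|c cE] := IH (p - a *: L n).
  apply/leq_sizeP => j nj; rewrite coefB coefZ.
  have [->|jn] := eqVneq j n.
    by rewrite /a -[(L n)`_n]/((L n)`_((n.+1).-1)) -(sL n) -/(lead_coef _) divfK ?subrr.
  rewrite (nth_default _ (_ : size (L n) <= j)%N) ?sL; last by lia.
  by rewrite (nth_default _ (_ : size p <= j)%N) ?mulr0 ?subr0 //; apply: leq_trans sp _; lia.
exists (fun j => if j == n then a else c j); rewrite big_ord_recr /= eqxx.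
rewrite -[LHS](subrK (a *: L n)) cE; congr (_ + _); apply: eq_bigr => j _.
by rewrite ifN // neq_ltn ltn_ord.
Qed.

Definition pexp (R : realType) (alpha : R) (p : {poly R}) : R := gexp alpha (horner p).

Lemma pexpD (R : realType) (alpha : R) (p q : {poly R}) : -1 < alpha ->
  pexp alpha (p + q) = pexp alpha p + pexp alpha q.
Proof.
move=> a1; rewrite /pexp -gexpD //; try exact: within_continuous_poly.
by apply: eq_gexp => x _; rewrite hornerD.
Qed.

Lemma pexpZ (R : realType) (alpha a : R) (p : {poly R}) : -1 < alpha ->
  pexp alpha (a *: p) = a * pexp alpha p.
Proof.
move=> a1; rewrite /pexp -gexpZ //; try exact: within_continuous_poly.
by apply: eq_gexp => x _; rewrite hornerZ.
Qed.

Lemma pexp_sum (R : realType) (alpha : R) (n : nat) (p : 'I_n -> {poly R}) : -1 < alpha ->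
  pexp alpha (\sum_i p i) = \sum_i pexp alpha (p i).
Proof.
move=> a1; apply: (big_morph (pexp alpha)); first by move=> p' q; exact: pexpD.
by rewrite -(scale0r 0) pexpZ // mul0r.
Qed.

Lemma gip_poly (R : realType) (alpha : R) (p q : {poly R}) :
  gip alpha (horner p) (horner q) = pexp alpha (p * q).
Proof. by rewrite gipE; apply: eq_gexp => x _; rewrite hornerM. Qed.

Lemma orthonormal_low_degree (R : realType) (alpha : R) (L : nat -> {poly R}) (n : nat)
    (p : {poly R}) : -1 < alpha -> orthonormal_system alpha L -> (size p <= n)%N ->
  pexp alpha (p * L n) = 0.
Proof.
move=> a1 [sL oL] sp; have [c ->] := graded_basis sL sp.
rewrite mulr_suml pexp_sum // big1 // => j _.
by rewrite -scalerAl pexpZ // -gip_poly oL (ltn_eqF (ltn_ord j)) mulr0.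
Qed.

Lemma orthonormal_eq0 (R : realType) (alpha : R) (L : nat -> {poly R}) (n : nat)
    (p : {poly R}) : -1 < alpha -> orthonormal_system alpha L -> (size p <= n)%N ->
  (forall j, (j < n)%N -> pexp alpha (p * L j) = 0) -> p = 0.
Proof.
move=> a1 [sL oL] sp p0; have [c cE] := graded_basis sL sp.
rewrite cE big1 // => j _; suff -> : c j = 0 by rewrite scale0r.
have := p0 j (ltn_ord j); rewrite cE mulr_suml pexp_sum // (bigD1 j) //= big1.
  by rewrite -scalerAl pexpZ // -gip_poly oL eqxx mulr1 addr0.
by move=> i; rewrite -val_eqE /= => /negbTE ij; rewrite -scalerAl pexpZ // -gip_poly oL ij mulr0.
Qed.

(** This is [w^(-alpha) (w^(alpha+1) p')'] with [w = 1 - x^2]. *)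
Definition gegenbauer_op (R : realType) (alpha : R) (p : {poly R}) : {poly R} :=
  (1 - 'X^2) * p^`()^`() - (2 * (alpha + 1)) *: ('X * p^`()).

(** Integration by parts, that is, Pearson's identity for [p' q]. The right side is symmetric in [p]
    and [q], so the operator is self-adjoint. *)
Lemma pexp_gegenbauer_op (R : realType) (alpha : R) (p q : {poly R}) : -1 < alpha ->
  pexp alpha (gegenbauer_op alpha p * q) = - pexp alpha ((1 - 'X^2) * (p^`() * q^`())).
Proof.
move=> a1; apply/eqP; rewrite -addr_eq0 -pexpD //; apply/eqP.
rewrite -[RHS](@gexp_pearson _ _ (p^`() * q) a1); apply: eq_gexp => x _.
rewrite derivM /gegenbauer_op -polyC1.
by rewrite !(hornerD, hornerN, hornerM, hornerZ, hornerX, hornerXn, hornerC); ring.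
Qed.

Lemma coef_gegenbauer_op (R : realType) (alpha : R) (p : {poly R}) (i : nat) :
  (gegenbauer_op alpha p)`_i =
    (i.+1 * i.+2)%:R * p`_i.+2 - i%:R * (i%:R + (2 * alpha + 1)) * p`_i.
Proof.
have cd (q : {poly R}) j : q^`()`_j = j.+1%:R * q`_j.+1.
  by rewrite coef_deriv mulr_natl.
rewrite /gegenbauer_op coefB coefZ mulrBl mul1r coefB coefXnM coefXM.
case: i => [|[|i]]; rewrite /= ?subn2 /= !cd; rewrite natrM; ring.
Qed.

(** The leading coefficients cancel, so the difference of the two sides has degree below [n]. It is
    orthogonal to each [L j] with [j < n], because the operator is self-adjoint and does not raise
    degrees. *)
Lemma gegenbauer_ode (R : realType) (alpha : R) (L : nat -> {poly R}) (n : nat) :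
  -1 < alpha -> orthonormal_system alpha L ->
  gegenbauer_op alpha (L n) = - (n%:R * (n%:R + (2 * alpha + 1))) *: L n.
Proof.
move=> a1 oLL; have [sL oL] := oLL; set m := _ * _.
have size_op (p : {poly R}) k : (size p <= k)%N -> (size (gegenbauer_op alpha p) <= k)%N.
  move=> pk; apply/leq_sizeP => j kj; rewrite coef_gegenbauer_op.
  by rewrite !nth_default ?mulr0 ?subrr //; apply: leq_trans pk _; lia.
apply/eqP; rewrite -subr_eq0 scaleNr opprK; apply/eqP.
apply: (orthonormal_eq0 a1 oLL (n := n)).
  apply/leq_sizeP => j nj; rewrite coefD coefZ coef_gegenbauer_op.
  rewrite (nth_default _ (_ : size _ <= j.+2)%N); last by rewrite sL; lia.
  have [->|jn] := eqVneq j n; first by rewrite mulr0 sub0r addNr.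
  by rewrite (nth_default _ (_ : size _ <= j)%N) ?mulr0 ?subrr ?addr0 // sL; lia.
move=> j jn; rewrite mulrDl pexpD // -scalerAl pexpZ // -(gip_poly _ (L n)) oL (gtn_eqF jn) mulr0 addr0.
rewrite pexp_gegenbauer_op // [(L n)^`() * _]mulrC -pexp_gegenbauer_op //.
by apply: orthonormal_low_degree => //; apply: size_op; rewrite sL.
Qed.

(** * Energy functionals and the weighted pointwise bound *)

Lemma is_derive_ge0_le (R : realType) (f df : R -> R) (a b : R) : a <= b ->
  (forall x, a <= x <= b -> is_derive x 1 f (df x)) ->
  (forall x, a <= x <= b -> 0 <= df x) -> f a <= f b.
Proof.
move=> ab fd df0.
have cf : {within `[a, b], continuous f}.
  apply: derivable_within_continuous => x; rewrite in_itv /= => /fd xd.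
  by have [] := xd.
have [|//|c cab E] := @MVT_segment R f df a b ab.
  by move=> x; rewrite in_itv /= => xI; apply: fd; lra.
by rewrite in_itv /= in cab; rewrite -subr_ge0 E mulr_ge0 ?df0 ?subr_ge0.
Qed.

Definition gegenbauer_eq (R : realType) (lam mu : R) (y : {poly R}) : Prop :=
  forall x : R, (1 - x ^+ 2) * y^`()^`().[x] = (2 * lam + 1) * x * y^`().[x] - mu * y.[x].

(** For [u(theta) = y(cos theta)] this is [u'^2 + mu u^2]. *)
Definition energy (R : realType) (mu : R) (y : {poly R}) : {poly R} :=
  (1%:P - 'X^2) * (y^`() * y^`()) + mu *: (y * y).

Definition polE := (hornerD, hornerN, hornerM, hornerZ, hornerX, hornerXn, hornerC).

Lemma energyE (R : realType) (mu x : R) (y : {poly R}) :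
  (energy mu y).[x] = (1 - x ^+ 2) * y^`().[x] ^+ 2 + mu * y.[x] ^+ 2.
Proof. by rewrite /energy !polE; ring. Qed.

Lemma deriv_energy (R : realType) (lam mu x : R) (y : {poly R}) : gegenbauer_eq lam mu y ->
  (energy mu y)^`().[x] = 4 * lam * x * y^`().[x] ^+ 2.
Proof.
move=> ode; rewrite /energy !(derivD, derivN, derivM, derivZ, derivC, derivXn) /=.
rewrite !(polE, hornerMn).
have := ode x; move: (y^`()^`().[x]) (y^`().[x]) (y.[x]) => c b a E.
apply/eqP; rewrite -subr_eq0; apply/eqP.
transitivity (2 * b * ((1 - x ^+ 2) * c - ((2 * lam + 1) * x * b - mu * a))); first ring.
by rewrite E subrr mulr0.
Qed.

(** The derivative is [4 lam x y'^2]. The point is to compare the value at 0 with the mean of the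
    energy. *)
Lemma energy_min (R : realType) (lam mu x : R) (y : {poly R}) : 0 < lam ->
  gegenbauer_eq lam mu y -> 0 <= x -> (energy mu y).[0] <= (energy mu y).[x].
Proof.
move=> l0 ode x0.
apply: (@is_derive_ge0_le _ (horner (energy mu y)) (fun t => (energy mu y)^`().[t]) 0 x x0).
move=> t /andP[t0 _]; rewrite (deriv_energy _ ode) mulr_ge0 ?sqr_ge0 // mulr_ge0 //.
by rewrite mulr_ge0 // ltW.
Qed.

(** With the factor [w^(2 lam)] the terms in [y'^2] of the derivative cancel, and [-4 lam x mu y^2]
    is left. This carries bounds from the interior towards the endpoint. *)
Lemma weighted_energy_decr (R : realType) (lam mu a b : R) (y : {poly R}) :
  0 < lam -> 0 <= mu -> gegenbauer_eq lam mu y -> 0 <= a -> a <= b -> b < 1 ->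
  powR (1 - b ^+ 2) (2 * lam) * (energy mu y).[b]
    <= powR (1 - a ^+ 2) (2 * lam) * (energy mu y).[a].
Proof.
move=> l0 m0 ode a0 ab b1; rewrite -lerN2.
pose f := fun x : R => - (powR (1 - x ^+ 2) (2 * lam) * (energy mu y).[x]).
pose df := fun x : R => - (powR (1 - x ^+ 2) (2 * lam - 1) *
  ((1 - x ^+ 2) * (energy mu y)^`().[x] - 2 * (2 * lam) * x * (energy mu y).[x])).
apply: (@is_derive_ge0_le R f df a b ab) => x /andP[ax xb].
  by apply: is_deriveN; apply: is_derive_powR_poly; apply: weight_pos; lra.
rewrite /df (deriv_energy _ ode) energyE -mulrN mulr_ge0 ?powR_ge0 //.
rewrite [leRHS](_ : _ = 4 * lam * x * (mu * y.[x] ^+ 2)); last by ring.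
apply: mulr_ge0; last by rewrite mulr_ge0 // sqr_ge0.
by rewrite !mulr_ge0 //; lra.
Qed.

(** Put [v(theta) = (sin theta)^lam y(cos theta)]. Then [v'' + Q v = 0] with [Q = mu + lam^2 + lam
    (1 - lam) / (sin theta)^2], and [v'^2 + Q v^2] is [(1 - x^2)^(lam-1)] times this polynomial. *)
Definition prufer (R : realType) (lam mu : R) (y : {poly R}) : {poly R} :=
  (1%:P - 'X^2) * (1%:P - 'X^2) * (y^`() * y^`())
   - (2 * lam) *: ('X * (1%:P - 'X^2) * (y * y^`()))
   + (mu *: (1%:P - 'X^2) + lam%:P) * (y * y).

Lemma pruferE (R : realType) (lam mu x : R) (y : {poly R}) :
  (prufer lam mu y).[x] = (lam * x * y.[x] - (1 - x ^+ 2) * y^`().[x]) ^+ 2 +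
     ((mu + lam ^+ 2) * (1 - x ^+ 2) + lam * (1 - lam)) * y.[x] ^+ 2.
Proof. by rewrite /prufer !polE; ring. Qed.

Lemma deriv_prufer (R : realType) (lam mu x : R) (y : {poly R}) : gegenbauer_eq lam mu y ->
  (1 - x ^+ 2) * (prufer lam mu y)^`().[x] - 2 * (lam - 1) * x * (prufer lam mu y).[x] =
  2 * lam * (1 - lam) * x * y.[x] ^+ 2.
Proof.
move=> ode; rewrite /prufer !(derivD, derivN, derivM, derivZ, derivC, derivX, derivXn) /=.
rewrite !(polE, hornerMn).
have := ode x; move: (y^`()^`().[x]) (y^`().[x]) (y.[x]) => c b a E.
apply/eqP; rewrite -subr_eq0; apply/eqP.
transitivity ((2 * (1 - x ^+ 2) ^+ 2 * b - 2 * lam * x * (1 - x ^+ 2) * a) *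
   ((1 - x ^+ 2) * c - ((2 * lam + 1) * x * b - mu * a))); first ring.
by rewrite E subrr mulr0.
Qed.

(** The derivative of [v'^2 + Q v^2] is [Q' v^2], and for [lam >= 1] the function [Q] decreases in
    [x] on [[0, 1)]. *)
Lemma prufer_decr (R : realType) (lam mu x : R) (y : {poly R}) : 1 <= lam ->
  gegenbauer_eq lam mu y -> 0 <= x -> x < 1 ->
  powR (1 - x ^+ 2) (lam - 1) * (prufer lam mu y).[x] <= (prufer lam mu y).[0].
Proof.
move=> l1 ode x0 x1; rewrite -lerN2.
pose f := fun x : R => - (powR (1 - x ^+ 2) (lam - 1) * (prufer lam mu y).[x]).
pose df := fun x : R => - (powR (1 - x ^+ 2) (lam - 1 - 1) *
  ((1 - x ^+ 2) * (prufer lam mu y)^`().[x] - 2 * (lam - 1) * x * (prufer lam mu y).[x])).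
have := @is_derive_ge0_le R f df 0 x x0.
rewrite /f expr0n subr0 powR1 mul1r; apply => t /andP[t0 tx].
  by apply: is_deriveN; apply: is_derive_powR_poly; apply: weight_pos; lra.
rewrite /df (deriv_prufer _ ode) -mulrN mulr_ge0 ?powR_ge0 //.
rewrite [leRHS](_ : _ = 2 * lam * (lam - 1) * t * y.[t] ^+ 2); last by ring.
apply: mulr_ge0; last exact: sqr_ge0.
by rewrite !mulr_ge0 //; lra.
Qed.

(* Sonin's function [prufer / Z]: it decreases on [0, 1] when [lam <= 1]. *)
Lemma sonin_decr (R : realType) (lam mu x : R) (y : {poly R}) : 0 < lam -> lam <= 1 ->
  0 < mu -> gegenbauer_eq lam mu y -> 0 <= x -> x < 1 ->
  powR (1 - x ^+ 2) lam * y.[x] ^+ 2 <= (prufer lam mu y).[0] / (mu + lam).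
Proof.
move=> l0 l1 m0 ode x0 x1.
pose Z : {poly R} := (mu + lam ^+ 2) *: (1%:P - 'X^2) + (lam * (1 - lam))%:P.
have ZE t : Z.[t] = (mu + lam ^+ 2) * (1 - t ^+ 2) + lam * (1 - lam).
  by rewrite /Z !polE.
have dZ t : Z^`().[t] = - 2 * (mu + lam ^+ 2) * t.
  rewrite /Z !(derivD, derivN, derivZ, derivC, derivXn) /= !(polE, hornerMn).
  by ring.
have Zpos t : 0 <= t -> t < 1 -> 0 < Z.[t].
  move=> t0 t1; have w0 : 0 < 1 - t ^+ 2 by apply: weight_pos; lra.
  by rewrite ZE ltr_wpDr ?mulr_gt0 ?mulr_ge0 ?subr_ge0 ?(ltW l0) // ltr_wpDr ?sqr_ge0.
pose f := fun x : R => - (powR (1 - x ^+ 2) lam * (prufer lam mu y).[x] * (Z.[x])^-1).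
pose df := fun x : R => - (powR (1 - x ^+ 2) lam * (prufer lam mu y).[x] *
    (- (Z.[x]) ^- 2 * Z^`().[x]) + (Z.[x])^-1 * (powR (1 - x ^+ 2) (lam - 1) *
  ((1 - x ^+ 2) * (prufer lam mu y)^`().[x] - 2 * lam * x * (prufer lam mu y).[x]))).
have mono : f 0 <= f x.
  apply: (@is_derive_ge0_le R f df 0 x x0) => t /andP[t0 tx].
    have Zt := Zpos t t0 (le_lt_trans tx x1).
    apply: is_deriveN.
    have wt : 0 < 1 - t ^+ 2 by apply: weight_pos; lra.
    have d1 := is_derive_powR_poly lam (prufer lam mu y) wt.
    have d2 : is_derive t 1 (fun x => (Z.[x])^-1) (- (Z.[t]) ^- 2 *: Z^`().[t]).
      by apply: is_deriveV; rewrite gt_eqF.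
    exact: (is_deriveM d1 d2).
  have Zt := Zpos t t0 (le_lt_trans tx x1).
  have wt : 0 < 1 - t ^+ 2 by apply: weight_pos; lra.
  have dP := deriv_prufer t ode.
  have PE := pruferE lam mu t y.
  have pw : powR (1 - t ^+ 2) lam = powR (1 - t ^+ 2) (lam - 1) * (1 - t ^+ 2).
    rewrite -[X in _ * X](powRr1 (ltW wt)) -powRD; last by rewrite (gt_eqF wt) implybT.
    by rewrite subrK.
  have -> : df t = powR (1 - t ^+ 2) (lam - 1) * (Z.[t]) ^- 2 * (2 * lam * (1 - lam) * t *
      (lam * t * y.[t] - (1 - t ^+ 2) * y^`().[t]) ^+ 2).
    rewrite /df pw dZ.
    have -> : (1 - t ^+ 2) * (prufer lam mu y)^`().[t] =
       2 * (lam - 1) * t * (prufer lam mu y).[t] + 2 * lam * (1 - lam) * t * y.[t] ^+ 2.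
      by rewrite -dP; ring.
    rewrite PE.
    have Zn : Z.[t] != 0 by rewrite gt_eqF.
    rewrite -ZE; set p2 := (_ - _) ^+ 2.
    move: (powR (1 - t ^+ 2) (lam - 1)) => W.
    have -> : mu + lam ^+ 2 = (Z.[t] - lam * (1 - lam)) / (1 - t ^+ 2).
      by rewrite ZE; field; rewrite gt_eqF.
    by field; rewrite Zn gt_eqF.
  apply: mulr_ge0; first by rewrite mulr_ge0 ?powR_ge0 // invr_ge0 sqr_ge0.
  by apply: mulr_ge0; rewrite ?sqr_ge0 // !mulr_ge0 ?subr_ge0 ?(ltW l0).
move: mono; rewrite /f lerN2 expr0n subr0 powR1 mul1r (ZE 0) expr0n subr0 mulr1.
rewrite (_ : mu + lam ^+ 2 + lam * (1 - lam) = mu + lam); last by ring.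
apply: le_trans; rewrite ler_pdivlMr ?Zpos // -mulrA ler_wpM2l ?powR_ge0 //.
by rewrite pruferE -ZE mulrC lerDr sqr_ge0.
Qed.

(** For [lam <= 1], [sonin_decr] is enough. For [lam > 1] the coefficient [Q] becomes negative near
    the endpoint; [prufer_decr] works where [n^2 (1 - x^2) >= 2 lam^2], and the remaining zone, of
    bounded ratio thanks to [c], is crossed with [weighted_energy_decr]. *)
Lemma gegenbauer_weighted_bound (R : realType) (lam c : R) : 0 < lam -> 0 < c ->
  exists2 C : R, 0 < C & forall (n : nat) (y : {poly R}) (x : R), (0 < n)%N ->
    gegenbauer_eq lam (n%:R * (n%:R + 2 * lam)) y ->
    (energy (n%:R * (n%:R + 2 * lam)) y).[0] <= 2 * (n%:R * (n%:R + 2 * lam)) ->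
    0 <= x -> x < 1 -> c <= n%:R ^+ 2 * (1 - x ^+ 2) ->
    powR (1 - x ^+ 2) lam * y.[x] ^+ 2 <= C.
Proof.
move=> l0 c0; pose B := powR (2 * lam ^+ 2 / c) lam.
have B0 : 0 <= B by exact: powR_ge0.
exists (4 + 12 * (1 + lam ^+ 2) * B).
  by rewrite ltr_wpDr // mulr_ge0 // mulr_ge0 // addr_ge0 ?sqr_ge0.
move=> n y x n0 ode en0 x0 x1 cw; set mu := _ * _ in ode en0.
have n1 : 1 <= n%:R :> R by rewrite ler1n.
have mu1 : 1 <= mu by rewrite /mu; nra.
have mu0 : 0 < mu by lra.
have w0 : 0 < 1 - x ^+ 2 by apply: weight_pos; lra.
have l2 : 0 <= lam ^+ 2 by exact: sqr_ge0.
have y0 : y.[0] ^+ 2 <= 2.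
  rewrite -(ler_pM2l mu0) [leRHS]mulrC; apply: le_trans en0.
  by rewrite energyE expr0n subr0 mul1r lerDr sqr_ge0.
have Q0 : (prufer lam mu y).[0] <= 2 * (mu + lam).
  move: en0; rewrite pruferE energyE expr0n /= !subr0 !(mulr0, mul0r) !mul1r mulr1 sub0r sqrrN.
  by have := ler_wpM2l (ltW l0) y0; lra.
have [l1|l1] := leP lam 1.
  apply: le_trans (sonin_decr l0 l1 mu0 ode x0 x1) _.
  apply: (@le_trans _ _ 2); first by rewrite ler_pdivrMr ?addr_gt0.
  have : 0 <= 12 * (1 + lam ^+ 2) * B by rewrite mulr_ge0 // mulr_ge0 // addr_ge0.
  lra.
have {}l1 := ltW l1.
have Lam2 : mu + lam ^+ 2 = (n%:R + lam) ^+ 2 by rewrite /mu; ring.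
have muL : mu + lam <= mu + lam ^+ 2 by rewrite lerD2l expr2 ler_peMl // ltW.
(* Here [lam (lam - 1)] takes away at most half of [(mu + lam^2) (1 - t^2)]. *)
have inner t : 0 <= t -> t < 1 -> 2 * lam ^+ 2 <= n%:R ^+ 2 * (1 - t ^+ 2) ->
    powR (1 - t ^+ 2) lam * y.[t] ^+ 2 <= 4 /\
    powR (1 - t ^+ 2) (lam - 1) * (lam * t * y.[t] - (1 - t ^+ 2) * y^`().[t]) ^+ 2
      <= 2 * (mu + lam ^+ 2).
  move=> t0 t1 tw.
  have wt : 0 < 1 - t ^+ 2 by apply: weight_pos; lra.
  have nLam : n%:R ^+ 2 <= mu + lam ^+ 2.
    by rewrite Lam2 lerXn2r ?nnegrE ?addr_ge0 ?lerDl // ltW.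
  have Zt : (mu + lam ^+ 2) * (1 - t ^+ 2) / 2 <= (mu + lam ^+ 2) * (1 - t ^+ 2) + lam * (1 - lam).
    have := ler_wpM2r (ltW wt) nLam; nra.
  have := prufer_decr l1 ode t0 t1; rewrite pruferE mulrDr => H.
  have pw : powR (1 - t ^+ 2) lam = powR (1 - t ^+ 2) (lam - 1) * (1 - t ^+ 2).
    rewrite -[X in _ * X](powRr1 (ltW wt)) -powRD; last by rewrite (gt_eqF wt) implybT.
    by rewrite subrK.
  have P0 : 0 <= powR (1 - t ^+ 2) (lam - 1) by exact: powR_ge0.
  have H1 : 0 <= powR (1 - t ^+ 2) (lam - 1) * (lam * t * y.[t] - (1 - t ^+ 2) * y^`().[t]) ^+ 2.
    by rewrite mulr_ge0 ?sqr_ge0.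
  have ML0 : 0 < mu + lam ^+ 2 by lra.
  have H2 : (mu + lam ^+ 2) / 2 * (powR (1 - t ^+ 2) lam * y.[t] ^+ 2) <=
      powR (1 - t ^+ 2) (lam - 1) * (((mu + lam ^+ 2) * (1 - t ^+ 2) + lam * (1 - lam)) * y.[t] ^+ 2).
    rewrite pw (_ : (mu + lam ^+ 2) / 2 * _ = powR (1 - t ^+ 2) (lam - 1) *
      ((mu + lam ^+ 2) * (1 - t ^+ 2) / 2 * y.[t] ^+ 2)); last by field.
    by rewrite ler_wpM2l // ler_wpM2r ?sqr_ge0.
  have H3 : 0 <= (mu + lam ^+ 2) / 2 * (powR (1 - t ^+ 2) lam * y.[t] ^+ 2).
    by apply: mulr_ge0; [lra|rewrite mulr_ge0 ?powR_ge0 ?sqr_ge0].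
  split; last by lra.
  have ML2 : 0 < (mu + lam ^+ 2) / 2 by lra.
  rewrite -(ler_pM2l ML2); lra.
have C4 : 4 <= 4 + 12 * (1 + lam ^+ 2) * B.
  by rewrite lerDl mulr_ge0 // mulr_ge0 // addr_ge0.
have [big|small] := leP (2 * lam ^+ 2) (n%:R ^+ 2 * (1 - x ^+ 2)).
  by have [H _] := inner x x0 x1 big; apply: le_trans H C4.
have e_ge : mu * y.[x] ^+ 2 <= (energy mu y).[x].
  by rewrite energyE lerDr mulr_ge0 ?sqr_ge0 // ltW.
have n2 : 0 < n%:R ^+ 2 :> R by rewrite exprn_gt0 // ltr0n.
have iw : (1 - x ^+ 2)^-1 <= n%:R ^+ 2 / c.
  by rewrite -[leRHS]invf_div lef_pV2 ?posrE ?divr_gt0 // ler_pdivrMr // mulrC.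
have split_pow : powR (1 - x ^+ 2) (2 * lam) = powR (1 - x ^+ 2) lam * powR (1 - x ^+ 2) lam.
  by rewrite -powRD ?(gt_eqF w0) ?implybT // mulr2n mulrDl mul1r.
have Pw : 0 < powR (1 - x ^+ 2) lam by exact: powR_gt0.
set W := powR (1 - x ^+ 2) lam in split_pow Pw *.
have cl0 : 0 <= 2 * lam ^+ 2 / c by rewrite divr_ge0 ?mulr_ge0 // ltW.
have BW : B * W = powR (2 * lam ^+ 2 / c * (1 - x ^+ 2)) lam.
  by rewrite powRM // ltW.
have [nbig|nsmall] := leP (2 * lam ^+ 2) (n%:R ^+ 2).
  (* [t] is the last point of the zone of [inner], where [n^2 (1 - t^2) = 2 lam^2]. Both estimates
     of [inner] bound the energy there, and [c <= n^2 (1 - x^2)] gives [v^lam <= B W]. *)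
  pose v := 2 * lam ^+ 2 / n%:R ^+ 2.
  have v1 : v <= 1 by rewrite ler_pdivrMr // mul1r.
  have v0 : 0 < v by rewrite divr_gt0 // mulr_gt0 // exprn_gt0.
  pose t := Num.sqrt (1 - v).
  have tE : 1 - t ^+ 2 = v by rewrite sqr_sqrtr ?subr_ge0 //; ring.
  have t0 : 0 <= t by exact: sqrtr_ge0.
  have t1 : t < 1 by nra.
  have xw : 1 - x ^+ 2 <= v by rewrite ler_pdivlMr // mulrC ltW.
  have tx : t <= x by nra.
  have nv : 2 * lam ^+ 2 = n%:R ^+ 2 * v by rewrite /v [RHS]mulrCA divff ?mulr1 ?gt_eqF.
  have [|H1 H2] := inner t t0 t1; first by rewrite tE nv.
  have := weighted_energy_decr l0 (ltW mu0) ode t0 tx x1.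
  rewrite split_pow; rewrite tE in H1 H2 *.
  have -> : powR v (2 * lam) = powR v lam * powR v lam.
    by rewrite -powRD ?(gt_eqF v0) ?implybT // mulr2n mulrDl mul1r.
  have pv : powR v lam = powR v (lam - 1) * v.
    rewrite -[X in _ * X](powRr1 (ltW v0)) -powRD; last by rewrite (gt_eqF v0) implybT.
    by rewrite subrK.
  set V := powR v lam in H1 pv *; have V0 : 0 < V by exact: powR_gt0.
  set V1 := powR v (lam - 1) in H2 pv *; have V10 : 0 < V1 by exact: powR_gt0.
  have et : V * (energy mu y).[t] <= 12 * (mu + lam ^+ 2).
    rewrite energyE tE mulrDr.
    have h1 : V * (mu * y.[t] ^+ 2) <= 4 * (mu + lam ^+ 2).
      rewrite mulrCA [leRHS]mulrC; apply: ler_pM; [exact: ltW| |by rewrite lerDl|exact: H1].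
      by rewrite mulr_ge0 ?sqr_ge0 // ltW.
    have h2 : V * (v * y^`().[t] ^+ 2) <= 8 * (mu + lam ^+ 2).
      have -> : V * (v * y^`().[t] ^+ 2) = V1 * (v * y^`().[t]) ^+ 2 by rewrite pv; ring.
      have hh : (v * y^`().[t]) ^+ 2 <= 2 * (lam * t * y.[t] - v * y^`().[t]) ^+ 2 + 2 * (lam ^+ 2 * y.[t] ^+ 2).
        have : 2 * (lam * t * y.[t]) ^+ 2 <= 2 * (lam ^+ 2 * y.[t] ^+ 2).
          rewrite !exprMn ler_pM2l // ler_wpM2r ?sqr_ge0 // ler_piMr //; nra.
        have := sqr_ge0 (2 * (lam * t * y.[t]) - v * y^`().[t]); nra.
      apply: le_trans (ler_wpM2l (ltW V10) hh) _.
      have -> : V1 * (2 * (lam * t * y.[t] - v * y^`().[t]) ^+ 2 + 2 * (lam ^+ 2 * y.[t] ^+ 2)) =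
        2 * (V1 * (lam * t * y.[t] - v * y^`().[t]) ^+ 2) + n%:R ^+ 2 * (V * y.[t] ^+ 2).
        rewrite pv mulrDr; congr (_ + _); first by ring.
        by transitivity (V1 * (2 * lam ^+ 2 * y.[t] ^+ 2)); [ring|rewrite nv; ring].
      have : n%:R ^+ 2 * (V * y.[t] ^+ 2) <= 4 * (mu + lam ^+ 2).
        rewrite [leRHS]mulrC; apply: ler_pM; [exact: ltW| | |exact: H1].
          by rewrite mulr_ge0 ?sqr_ge0 // ltW.
        by rewrite Lam2 lerXn2r ?nnegrE ?addr_ge0 ?lerDl // ltW.
      lra.
    lra.
  move=> dec.
  have vW : V <= B * W.
    rewrite BW; apply: ge0_ler_powR; rewrite ?nnegrE ?(ltW l0) ?(ltW v0) //.
      by rewrite mulr_ge0 // ltW.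
    rewrite /v -[leRHS]mulrA; apply: ler_wpM2l; first by rewrite mulr_ge0.
    by rewrite [leRHS]mulrC ler_pdivlMr // mulrC ler_pdivrMr // mulrC.
  have fin : W * W * (mu * y.[x] ^+ 2) <= 12 * (mu + lam ^+ 2) * (B * W).
    apply: (@le_trans _ _ (W * W * (energy mu y).[x])).
      by rewrite ler_wpM2l // mulr_ge0 // ltW.
    apply: le_trans dec _; rewrite -mulrA mulrC.
    apply: ler_pM => //; last exact: ltW.
    rewrite mulr_ge0 ?(ltW V0) // energyE tE addr_ge0 // mulr_ge0 ?sqr_ge0 // ltW //.
  apply: (@le_trans _ _ (12 * (1 + lam ^+ 2) * B)); last by rewrite lerDr.
  rewrite -(ler_pM2l (mulr_gt0 Pw mu0)).
  have -> : W * mu * (W * y.[x] ^+ 2) = W * W * (mu * y.[x] ^+ 2) by ring.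
  apply: le_trans fin _.
  have -> : W * mu * (12 * (1 + lam ^+ 2) * B) = 12 * (mu * (1 + lam ^+ 2)) * (B * W) by ring.
  rewrite ler_wpM2r ?mulr_ge0 ?(ltW Pw) // ler_pM2l //.
  by rewrite mulrDr mulr1 lerD2l ler_peMl.
(* If [n^2 < 2 lam^2] the zone of [inner] is empty, and the energy at 0 is carried out instead. *)
have := weighted_energy_decr l0 (ltW mu0) ode (lexx 0) x0 x1.
rewrite expr0n subr0 powR1 mul1r split_pow => dec.
have W1 : 1 <= B * W.
  rewrite BW; apply: (@le_trans _ _ (powR 1 lam)); first by rewrite powR1.
  apply: ge0_ler_powR; rewrite ?nnegrE ?(ltW l0) //.
    by rewrite mulr_ge0 // ltW.
  rewrite mulrAC ler_pdivlMr // mul1r; apply: le_trans cw _.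
  by rewrite ler_wpM2r ?ltW.
apply: (@le_trans _ _ (2 * B)); last first.
  have : 0 <= lam ^+ 2 * B by rewrite mulr_ge0.
  nra.
rewrite -(ler_pM2l (mulr_gt0 Pw mu0)).
have -> : W * mu * (W * y.[x] ^+ 2) = W * W * (mu * y.[x] ^+ 2) by ring.
apply: (@le_trans _ _ (W * W * (energy mu y).[x])).
  by rewrite ler_wpM2l // mulr_ge0 // ltW.
apply: le_trans dec _; apply: le_trans en0 _.
have -> : W * mu * (2 * B) = 2 * mu * (B * W) by ring.
by rewrite ler_peMr // mulr_ge0 // ltW.
Qed.

Definition reflect (R : realType) (y : {poly R}) : {poly R} := y \Po (- 'X).

Lemma reflectE (R : realType) (y : {poly R}) (x : R) : (reflect y).[x] = y.[- x].
Proof. by rewrite /reflect horner_comp !polE. Qed.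

Lemma deriv_reflect (R : realType) (y : {poly R}) : (reflect y)^`() = - reflect y^`().
Proof. by rewrite /reflect deriv_comp derivN derivX mulrN mulr1. Qed.

Lemma gegenbauer_eq_reflect (R : realType) (lam mu : R) (y : {poly R}) :
  gegenbauer_eq lam mu y -> gegenbauer_eq lam mu (reflect y).
Proof.
move=> ode x; rewrite !(deriv_reflect, derivN, opprK, hornerN, reflectE).
by have := ode (- x); rewrite sqrrN => ->; ring.
Qed.

Lemma energy_reflect (R : realType) (mu x : R) (y : {poly R}) :
  (energy mu (reflect y)).[x] = (energy mu y).[- x].
Proof. by rewrite !energyE deriv_reflect hornerN !reflectE !sqrrN. Qed.

Lemma orthonormal_gegenbauer_eq (R : realType) (alpha : R) (L : nat -> {poly R}) (n : nat) :
  -1 < alpha -> orthonormal_system alpha L ->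
  gegenbauer_eq (alpha + 1 / 2) (n%:R * (n%:R + 2 * (alpha + 1 / 2))) (L n).
Proof.
move=> a1 oL x; have := congr1 (horner^~ x) (gegenbauer_ode n a1 oL).
rewrite /gegenbauer_op -polyC1 !polE => E.
have -> : (2 * (alpha + 1 / 2) + 1) = 2 * (alpha + 1) by field.
have -> : 2 * (alpha + 1 / 2) = 2 * alpha + 1 by field.
by move: E; lra.
Qed.

(** The mean of the energy is [2 mu]: integration by parts and the equation give [mu] for the first
    term, normalisation gives [mu] for the second. The value at 0 is the minimum, hence below the
    mean. *)
Lemma orthonormal_energy0 (R : realType) (alpha : R) (L : nat -> {poly R}) (n : nat) :
  - (1 / 2) < alpha -> orthonormal_system alpha L ->
  (energy (n%:R * (n%:R + 2 * (alpha + 1 / 2))) (L n)).[0]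
     <= 2 * (n%:R * (n%:R + 2 * (alpha + 1 / 2))).
Proof.
move=> a2 oL; have a1 : -1 < alpha by lra.
have ode := orthonormal_gegenbauer_eq n a1 oL; set mu := n%:R * (n%:R + 2 * (alpha + 1 / 2)) in ode *.
have -> : 2 * mu = pexp alpha (energy mu (L n)).
  rewrite /energy pexpD // pexpZ // polyC1 -[pexp alpha (_ * (_ * _))]opprK -pexp_gegenbauer_op //.
  rewrite gegenbauer_ode // -scalerAl pexpZ // -gip_poly (oL.2 n n) eqxx.
  by rewrite /mu mulr1n; field.
rewrite -[leLHS](@gexp_cst R alpha _ a1); apply: le_gexp => //.
- exact: within_continuous_cst.
- exact: within_continuous_poly.
- have l0 : 0 < alpha + 1 / 2 by lra.
  move=> x /andP[x1 x2]; have [x0|x0] := leP 0 x; first exact: energy_min l0 ode x0.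
  have xN0 : 0 <= - x by lra.
  have := energy_min l0 (gegenbauer_eq_reflect ode) xN0.
  by rewrite !energy_reflect oppr0 opprK.
Qed.

Lemma orthonormal_weighted_bound (R : realType) (alpha c : R) : - (1 / 2) < alpha -> 0 < c ->
  exists2 C : R, 0 < C & forall (L : nat -> {poly R}), orthonormal_system alpha L ->
    forall (n : nat) (x : R), (0 < n)%N -> -1 < x < 1 -> c <= n%:R ^+ 2 * (1 - x ^+ 2) ->
    powR (1 - x ^+ 2) (alpha + 1 / 2) * (L n).[x] ^+ 2 <= C.
Proof.
move=> a2 c0; have a1 : -1 < alpha by lra.
have l0 : 0 < alpha + 1 / 2 by lra.
have [C C0 bound] := gegenbauer_weighted_bound l0 c0.
exists C => // L oL n x n0 /andP[x1 x2] cx.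
have ode := orthonormal_gegenbauer_eq n a1 oL.
have en := orthonormal_energy0 n a2 oL.
have [x0|x0] := leP 0 x; first exact: bound n0 ode en x0 x2 cx.
have xN0 : 0 <= - x by lra.
have xN1 : - x < 1 by lra.
have := bound n (reflect (L n)) (- x) n0 (gegenbauer_eq_reflect ode).
by rewrite energy_reflect oppr0 reflectE opprK sqrrN; apply.
Qed.

(** * Bounds for [L_j] at the nodes and in sup norm *)

(** A crude Jordan inequality: up to 1 the derivative is at least [cos 1], and beyond 1 the sine
    still increases while [x < 2]. *)
Lemma sin_ge_lin (R : realType) (x : R) : 0 <= x <= pi / 2 -> cos 1 / 2 * x <= sin x.
Proof.
move=> /andP[x0 x1]; have pi2 := @pihalf_lt2 R; have pi2' := @pihalf_ge1 R.
have c1 := @cos1_gt0 R.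
have small (t : R) : 0 <= t -> t <= 1 -> cos 1 * t <= sin t.
  move=> t0 t1.
  pose f := fun u : R => sin u - cos 1 * u; pose df := fun u : R => cos u - cos 1 * 1.
  have := @is_derive_ge0_le R f df 0 t t0.
  rewrite /f sin0 mulr0 subr0 subr_ge0; apply => u /andP[u0 ut].
  rewrite /df mulr1 subr_ge0 leNgt ltr_cos ?in_itv /= ?u0 //; last by lra.
    by rewrite -leNgt; lra.
  by lra.
have [xs|xl] := leP x 1.
  by apply: le_trans (small x x0 xs); rewrite ler_wpM2r //; lra.
have s1 := small 1 ler01 (lexx 1).
have : sin 1 <= sin x.
  by rewrite leNgt ltr_sin ?in_itv /= -?leNgt; [lra|lra|lra].
by nra.
Qed.

(** The hypotheses on [k] say that at least [k] nodes lie on either side of node [i]. *)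
Lemma node_weight (R : realType) (n i k : nat) : (0 < n)%N -> (k <= i)%N -> (k + i < 2 * n)%N ->
  (cos 1 * k.+1%:R / (4 * n%:R)) ^+ 2 <= 1 - cos (node (4 * n) i) ^+ 2 :> R.
Proof.
move=> n0 ki kin; rewrite -sin2cos2.
have nR : 0 < n%:R :> R by rewrite ltr0n.
have c1 := @cos1_gt0 R; have pi2 := @pi_ge2 R.
have key t : k.+1%:R / (2 * n%:R) <= t -> t <= pi / 2 -> cos 1 * k.+1%:R / (4 * n%:R) <= sin t :> R.
  move=> t1 t2; have t0 : 0 <= k.+1%:R / (2 * n%:R) :> R by rewrite divr_ge0 ?mulr_ge0.
  apply: le_trans (sin_ge_lin (_ : 0 <= t <= pi / 2)); last by rewrite t2 (le_trans t0).
  have -> : cos 1 * k.+1%:R / (4 * n%:R) = cos 1 / 2 * (k.+1%:R / (2 * n%:R)) :> R.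
    by field; rewrite gt_eqF.
  by rewrite ler_wpM2l //; lra.
have lo0 : 0 <= cos 1 * k.+1%:R / (4 * n%:R) :> R.
  by rewrite divr_ge0 ?mulr_ge0 // ltW.
have s0 : cos 1 * k.+1%:R / (4 * n%:R) <= sin (node (4 * n) i) :> R.
  have E1 : node (4 * n) i = (2 * i%:R + 1) * pi / (4 * n%:R) :> R.
    by rewrite /node natrD !natrM; field; rewrite gt_eqF.
  have kiR : k.+1%:R <= 2 * i%:R + 1 :> R by rewrite -natrM natr1 ler_nat; lia.
  have kiR2 : k.+1%:R <= 4 * n%:R - (2 * i%:R + 1) :> R.
    by rewrite lerBrDr -!natrM natr1 -natrD ler_nat; lia.
  have scale u : k.+1%:R <= u -> k.+1%:R / (2 * n%:R) <= u * pi / (4 * n%:R) :> R.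
    move=> ku; rewrite ler_pdivlMr ?mulr_gt0 //.
    have -> : k.+1%:R / (2 * n%:R) * (4 * n%:R) = k.+1%:R * 2 :> R by field; rewrite gt_eqF.
    by rewrite ler_pM.
  have [le|gt] := leP (node (4 * n) i : R) (pi / 2).
    by apply: key => //; rewrite E1; exact: scale.
  have -> : sin (node (4 * n) i) = sin (pi - node (4 * n) i) :> R.
    by rewrite sinB sinpi cospi; ring.
  apply: key; last by lra.
  have -> : pi - node (4 * n) i = (4 * n%:R - (2 * i%:R + 1)) * pi / (4 * n%:R) :> R.
    by rewrite E1; field; rewrite gt_eqF.
  exact: scale.
by rewrite lerXn2r ?nnegrE //; apply: le_trans s0.
Qed.

(** The weighted bound applies at every node, the outermost included ([k = 0]): there
    [1 - x^2 >= (q / N)^2], and [j >= N]. *)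
Lemma orthonormal_node_bound (R : realType) (alpha : R) : - (1 / 2) < alpha ->
  exists2 C : R, 0 < C & forall (L : nat -> {poly R}), orthonormal_system alpha L ->
    forall N j i k : nat, (0 < N)%N -> (N <= j)%N -> (k <= i)%N -> (k + i < 4 * N)%N ->
    `|(L j).[cos (node (4 * (2 * N)) i)]| <= C * powR (N%:R / k.+1%:R) (alpha + 1 / 2).
Proof.
move=> a2; have l0 : 0 < alpha + 1 / 2 by lra.
have c1 := @cos1_gt0 R.
pose q : R := cos 1 / 8; have q0 : 0 < q by rewrite divr_gt0.
have [C C0 bound] := orthonormal_weighted_bound a2 (exprn_gt0 2 q0).
exists (Num.sqrt C * powR q^-1 (alpha + 1 / 2)).
  by rewrite mulr_gt0 ?sqrtr_gt0 ?powR_gt0 // invr_gt0.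
move=> L oL N j i k N0 Nj ki kiN.
have NR : 0 < N%:R :> R by rewrite ltr0n.
have kR : 0 < k.+1%:R :> R by rewrite ltr0n.
have w : (q * k.+1%:R / N%:R) ^+ 2 <= 1 - cos (node (4 * (2 * N)) i) ^+ 2 :> R.
  have := @node_weight R (2 * N) i k _ ki _; rewrite natrM => H.
  have -> : q * k.+1%:R / N%:R = cos 1 * k.+1%:R / (4 * (2 * N%:R)) :> R.
    by rewrite /q; field; rewrite gt_eqF.
  by apply: H; lia.
set x := cos _ in w *; set h := q * _ / _ in w.
have h0 : 0 < h by rewrite /h divr_gt0 ?mulr_gt0.
have w0 : 0 < 1 - x ^+ 2 by apply: lt_le_trans w; rewrite exprn_gt0.
have x1 : -1 < x < 1.
  rewrite -ltr_norml ltNge; apply/negP => x1; have := exprn_ege1 2 x1.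
  by rewrite real_normK ?num_real // leNgt -subr_gt0 w0.
have j0 : (0 < j)%N := leq_trans N0 Nj.
have := bound L oL j x j0 x1 _.
have -> : q ^+ 2 <= j%:R ^+ 2 * (1 - x ^+ 2).
  apply: (@le_trans _ _ (j%:R ^+ 2 * h ^+ 2)); last by rewrite ler_wpM2l ?exprn_ge0.
  have qh : q <= j%:R * h.
    rewrite /h mulrA ler_pdivlMr // [leRHS]mulrCA; apply: ler_wpM2l; first exact: ltW.
    by rewrite -natrM ler_nat -[N]muln1 leq_mul.
  rewrite -exprMn lerXn2r ?nnegrE ?(ltW q0) //.
  by rewrite mulr_ge0 // ltW.
move=> /(_ isT) B.
have hp : powR h (alpha + 1 / 2) ^+ 2 <= powR (1 - x ^+ 2) (alpha + 1 / 2).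
  rewrite expr2 -powRM ?(ltW h0) // -expr2.
  by apply: ge0_ler_powR; rewrite ?nnegrE ?exprn_ge0 ?(ltW l0) ?(ltW h0) ?(ltW w0).
have H0 : 0 < powR h (alpha + 1 / 2) by exact: powR_gt0.
have E : powR q^-1 (alpha + 1 / 2) * powR (N%:R / k.+1%:R) (alpha + 1 / 2) *
    powR h (alpha + 1 / 2) = 1.
  have q1 : 0 <= q^-1 by rewrite invr_ge0 ltW.
  have Nk : 0 <= N%:R / k.+1%:R :> R by rewrite divr_ge0.
  rewrite -powRM // -powRM ?(ltW h0) ?mulr_ge0 //.
  rewrite (_ : q^-1 * _ * _ = 1) ?powR1 // /h.
  by field; rewrite !gt_eqF.
rewrite -(ler_pM2r H0) -[leRHS]mulrA -[leRHS]mulrA [X in _ <= _ * X]mulrA E mulr1.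
rewrite -[X in _ * X](gtr0_norm H0) -normrM -[leLHS]sqrtr_sqr.
rewrite ler_wsqrtr // exprMn; apply: le_trans B.
by rewrite mulrC ler_wpM2r ?sqr_ge0.
Qed.

(** The node bound with [k = 0] at all nodes, followed by norming; the constant [L 0] is treated
    apart. *)
Lemma orthonormal_sup_bound (R : realType) (alpha : R) : - (1 / 2) < alpha ->
  exists2 C : R, 0 < C & forall (L : nat -> {poly R}), orthonormal_system alpha L ->
    forall (n : nat) (x : R), -1 <= x <= 1 ->
    `|(L n).[x]| <= C * powR (1 + n%:R) (alpha + 1 / 2).
Proof.
move=> a2; have a1 : -1 < alpha by lra.
have l0 : 0 < alpha + 1 / 2 by lra.
have [C C0 bound] := orthonormal_node_bound a2.
exists (3 * C + 1); first by rewrite addr_gt0 ?mulr_gt0.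
move=> L oL n x x1; have [sL nL] := oL.
have [->|n0] := posnP n.
  have sL0 : (size (L 0%N) <= 1)%N by rewrite sL.
  rewrite (size1_polyC sL0) hornerC addr0 powR1 mulr1.
  have := nL 0%N 0%N; rewrite gip_poly {1 2}(size1_polyC sL0) -polyCM /pexp.
  rewrite (@eq_gexp _ _ _ (fun=> (L 0%N)`_0 * (L 0%N)`_0)); last by move=> t _; rewrite hornerC.
  rewrite gexp_cst // => E.
  have -> : `|(L 0%N)`_0| = 1.
    by apply/eqP; rewrite -sqr_norm_eq1 expr2 E.
  by rewrite lerDr mulr_ge0 // ltW.
have N2 : (0 < 2 * n)%N by lia.
have sz : (size (L n) <= (2 * n).+1)%N by rewrite sL; lia.
apply: le_trans (poly_norming N2 sz (B := C * powR n%:R (alpha + 1 / 2)) _ x1) _.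
  move=> i i4; have := bound L oL n n i 0%N n0 (leqnn n) (leq0n i).
  by rewrite divr1; apply; lia.
apply: (@le_trans _ _ (3 * C * powR (1 + n%:R) (alpha + 1 / 2))).
  rewrite mulrA ler_wpM2l ?mulr_ge0 ?(ltW C0) //.
  by apply: ge0_ler_powR; rewrite ?nnegrE ?(ltW l0) ?addr_ge0 ?ler_wpDl.
by rewrite ler_wpM2r ?powR_ge0 // lerDl.
Qed.

(** * Colouring, thinning and sparsification of one block *)

Lemma ltr_add1_div32 (R : realType) (t : nat) : t%:R / 32 <= (t %/ 32).+1%:R :> R.
Proof.
rewrite ler_pdivrMr // -natrM ler_nat.
by have := divn_eq t 32; have := ltn_pmod t (isT : (0 < 32)%N); lia.
Qed.

(** The factor [(N/t)^lam] is the size of [L_j] at the nodes that are not annihilated, and the extra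
    exponent [1/(p+2)] is the price [1 / eta] of having [4N] nodes for [t] variables. *)
Lemma coloring_block (R : realType) (alpha : R) (p : nat) : - (1 / 2) < alpha -> ~~ odd p ->
  exists2 K : R, 0 < K & forall L : nat -> {poly R}, orthonormal_system alpha L ->
    forall (N : nat) (a : 'I_N -> R) (T : {set 'I_N}) (b : R),
    (32 <= #|T|)%N -> 0 < b -> (forall j, j \in T -> `|a j| <= b) ->
    exists x : 'I_N -> R,
      [/\ forall j, `|x j| <= 1,
          (#|T| <= 2 * #|[pred j in T | (`|x j| == 1)%R]|)%N,
          \sum_(j in T) x j * `|a j| = 0 &
          forall z : R, -1 <= z <= 1 ->
            `|\sum_(j in T) x j * a j * (L (N + j)%N).[z]|
               <= K * b * Num.sqrt #|T|%:R * powR (N%:R / #|T|%:R) (alpha + 1 / 2 + p.+2%:R^-1)].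
Proof.
move=> a2 podd; have l0 : 0 < alpha + 1 / 2 by lra.
have [C C0 bound] := orthonormal_node_bound a2.
pose K1 : R := 2 ^+ (p + 5) * p.+2%:R.
have K10 : 0 < K1 by rewrite mulr_gt0 // ?exprn_gt0.
pose C2 := C * powR 32 (alpha + 1 / 2).
have C20 : 0 < C2 by rewrite mulr_gt0 ?powR_gt0.
exists (3 * (K1 * C2 * powR 4 p.+2%:R^-1)).
  by rewrite mulr_gt0 // mulr_gt0 ?powR_gt0 // mulr_gt0.
move=> L oL N a T b T32 b0 ab; set t := #|T| in T32 *.
have t0 : (0 < t)%N by apply: leq_trans T32.
have tR : 0 < t%:R :> R by rewrite ltr0n.
have tN : (t <= N)%N by rewrite -[N]card_ord max_card.
have N0 : (0 < N)%N by exact: leq_trans t0 tN.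
have NR : 0 < N%:R :> R by rewrite ltr0n.
(* [2k] end nodes and one [l^1] balance equation: [8 (2k + 1) <= t] because [t >= 32]. *)
pose k := (t %/ 32)%N.
have k32 : (k * 32 <= t)%N by exact: leq_trunc_div.
pose it (j : 'I_t) : 'I_N := enum_val j.
pose nd (i : nat) : R := cos (node (4 * (2 * N)) i).
pose far (i : nat) := (k <= i)%N && (k + i < 4 * N)%N.
pose Z := option ('I_k + 'I_k)%type.
pose g (z : Z) (j : 'I_t) : R := match z with
  | None => `|a (it j)|
  | Some (inl i) => a (it j) * (L (N + it j)%N).[nd i]
  | Some (inr i) => a (it j) * (L (N + it j)%N).[nd (4 * N - i.+1)%N]
  end.
pose f (y : 'I_(4 * N)) (j : 'I_t) : R :=
  if far y then a (it j) * (L (N + it j)%N).[nd y] else 0.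
pose sigma := b * (C2 * powR (N%:R / t%:R) (alpha + 1 / 2)).
have sigma0 : 0 < sigma by rewrite mulr_gt0 // mulr_gt0 // powR_gt0 // divr_gt0.
(* Solves [4N eta^(p+2) = t]. *)
pose eta : R := powR (t%:R / (4 * N)%:R) p.+2%:R^-1.
have eta0 : 0 < eta.
  by rewrite powR_gt0 // divr_gt0 // ltr0n muln_gt0.
pose lambda : R := K1 * Num.sqrt t%:R * sigma / eta.
have lambda0 : 0 < lambda by rewrite divr_gt0 // mulr_gt0 // mulr_gt0 // sqrtr_gt0.
have Zcard : (8 * #|{: Z}| <= t)%N.
  by rewrite card_option card_sum !card_ord; move: T32 k32; clear; lia.
have fs y j : `|f y j| <= sigma.
  rewrite /f; case: ifP => [/andP[ky kyN]|_]; last by rewrite normr0 ltW.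
  rewrite normrM ler_pM ?normr_ge0 ?ab ?enum_valP //.
  apply: le_trans (bound L oL N (N + it j)%N y k N0 (leq_addr _ _) ky kyN) _.
  rewrite /C2 -mulrA ler_pM2l // -powRM ?divr_ge0 // ?(ltW NR) ?(ltW tR) //.
  apply: ge0_ler_powR; rewrite ?nnegrE ?(ltW l0) ?divr_ge0 ?mulr_ge0 ?invr_ge0 //.
  rewrite mulrCA ler_pM2l // -[leRHS]invf_div lef_pV2 ?posrE ?divr_gt0 //.
  exact: ltr_add1_div32.
have etaY : #|'I_(4 * N)|%:R * eta ^+ p.+2 <= t%:R.
  rewrite card_ord -powR_mulrn ?powR_ge0 // -powRrM mulVf // powRr1.
    by rewrite mulrC divfK // pnatr_eq0 muln_eq0 negb_or /= -lt0n.
  by rewrite divr_ge0.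
have hb : 2 ^+ (p + 5) * p.+2%:R ^+ 2 * t%:R * sigma ^+ 2 < (lambda * eta) ^+ 2.
  rewrite /lambda divfK ?gt_eqF // [ltRHS]exprMn [X in _ < X * _]exprMn sqr_sqrtr ?(ltW tR) //.
  rewrite ltr_pM2r ?exprn_gt0 // ltr_pM2r // /K1 [ltRHS]exprMn ltr_pM2r ?exprn_gt0 //.
  by rewrite [ltRHS]expr2 ltr_pMr ?exprn_gt0 // exprn_egt1 ?ltr1n // addnS.
have [x [x1 xhalf xg xf]] := @partial_coloring R t p Z 'I_(4 * N) g f sigma eta lambda
  podd t0 Zcard fs eta0 lambda0 etaY hb.
have [j0 j0T] : exists j0, j0 \in T by apply/set0Pn; rewrite -card_gt0.
pose rk := enum_rank_in j0T.
have itK j : rk (it j) = j by rewrite /rk /it enum_valK_in.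
have sumT (h : 'I_N -> R) : \sum_(j in T) x (rk j) * h j = \sum_j x j * h (it j).
  rewrite (big_enum_val (fun j => x (rk j) * h j)) /=.
  by apply: eq_bigr => j _; rewrite -/(it j) itK.
exists (fun j => x (rk j)); split => //.
- apply: leq_trans xhalf _; rewrite leq_mul2l /=.
  rewrite -(fintype.card_image (@enum_val_inj _ (mem T))); apply: subset_leq_card; apply/fintype.subsetP => j /fintype.imageP[i].
  by rewrite inE => xi ->; rewrite inE /= enum_valP /= -/(it i) itK.
- by rewrite (sumT (fun j => `|a j|)); exact: xg None.
move=> z z1.
pose P : {poly R} := \sum_(j in T) (x (rk j) * a j) *: L (N + j)%N.
have PE u : P.[u] = \sum_(j in T) x (rk j) * a j * (L (N + j)%N).[u].
  by rewrite horner_sum; apply: eq_bigr => j _; rewrite hornerZ.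
have PE2 u : P.[u] = \sum_j x j * (a (it j) * (L (N + it j)%N).[u]).
  rewrite PE -(sumT (fun j => a j * (L (N + j)%N).[u])).
  by apply: eq_bigr => j _; rewrite mulrA.
have sP : (size P <= (2 * N).+1)%N.
  apply: leq_trans (size_sum _ _ _) _; apply/bigmax_leqP => j _.
  apply: leq_trans (size_scale_leq _ _) _; rewrite oL.1.
  by have := ltn_ord j; clear; lia.
have N2 : (0 < 2 * N)%N by rewrite muln_gt0.
rewrite -PE.
have -> : 3 * (K1 * C2 * powR 4 p.+2%:R^-1) * b * Num.sqrt t%:R *
    powR (N%:R / t%:R) (alpha + 1 / 2 + p.+2%:R^-1) = 3 * lambda.
  have Nt : 0 < N%:R / t%:R :> R by rewrite divr_gt0.
  rewrite powRD; last by rewrite (gt_eqF Nt) implybT.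
  have -> : lambda = K1 * Num.sqrt t%:R * sigma * (powR 4 p.+2%:R^-1 * powR (N%:R / t%:R) p.+2%:R^-1).
    rewrite /lambda; congr (_ * _); apply: (mulfI (lt0r_neq0 eta0)).
    have t4 : 0 <= t%:R / (4 * N)%:R :> R by rewrite divr_ge0.
    have t4N : 0 <= 4 * (N%:R / t%:R) :> R by rewrite mulr_ge0 // ltW.
    rewrite mulfV ?gt_eqF // -powRM ?(ltW Nt) // -powRM //.
    rewrite (_ : _ / _ * _ = 1) ?powR1 // natrM.
    by field; rewrite !gt_eqF.
  by rewrite /sigma; ring.
apply: (poly_norming N2 sP) => // i i4; rewrite -/(nd i) PE2.
have [kfar|knear] := boolP (far i).
  have i4' : (i < 4 * N)%N by move: i4; clear; lia.
  have := xf (Ordinal i4'); rewrite /f /= kfar; exact.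
have {}i4 : (i < 4 * N)%N by move: i4; clear; lia.
suff -> : \sum_(j < t) x j * (a (it j) * (L (N + it j)%N).[nd i]) = 0 by rewrite normr0 ltW.
move: knear; rewrite /far negb_and -ltnNge -leqNgt => /orP[ik|ik].
  by have := xg (Some (inl (Ordinal ik))).
have ik' : (4 * N - i.+1 < k)%N by move: ik i4; clear; lia.
have := xg (Some (inr (Ordinal ik'))); rewrite /g /=.
by have -> : (4 * N - (4 * N - i.+1).+1)%N = i by move: i4; clear; lia.
Qed.

(** The conclusion of [coloring_block] for arbitrary functions [phi]; thinning uses nothing else
    about polynomials. *)
Definition colorable (R : realType) (K A : R) (N : nat) (phi : 'I_N -> R -> R) : Prop :=
  forall (a : 'I_N -> R) (T : {set 'I_N}) (b : R),
    (32 <= #|T|)%N -> 0 < b -> (forall j, j \in T -> `|a j| <= b) ->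
    exists x : 'I_N -> R,
      [/\ forall j, `|x j| <= 1,
          (#|T| <= 2 * #|[pred j in T | (`|x j| == 1)%R]|)%N,
          \sum_(j in T) x j * `|a j| = 0 &
          forall z : R, -1 <= z <= 1 ->
            `|\sum_(j in T) x j * a j * phi j z|
               <= K * b * Num.sqrt #|T|%:R * powR (N%:R / #|T|%:R) A].

Definition supp (R : realType) (N : nat) (a : 'I_N -> R) : {set 'I_N} := [set j | a j != 0].

(** At least half of the support lies in [T], and at least a quarter of [T] is killed, hence an
    eighth of the support. As [1 + s x_j >= 0], the change of the [l^1] norm is a multiple of
    [\sum_(j in T) x j * |a j|], which is 0. *)
Lemma thinning (R : realType) (K A : R) (N : nat) (phi : 'I_N -> R -> R) (a : 'I_N -> R) (l : R) :
  0 < K -> 0 < A -> colorable K A phi -> 0 < l -> \sum_j `|a j| <= l -> (64 <= #|supp a|)%N ->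
  exists a' : 'I_N -> R,
    [/\ \sum_j `|a' j| <= l, (8 * #|supp a'| <= 7 * #|supp a|)%N &
        forall z : R, -1 <= z <= 1 -> `|\sum_j (a j - a' j) * phi j z| <=
          2 * powR 2 A * K * l * powR N%:R A * powR #|supp a|%:R (- (A + 2^-1))].
Proof.
move=> K0 A0 col l0 al S64; set S := #|supp a| in S64 *.
have S0 : 0 < S%:R :> R by rewrite ltr0n; apply: leq_trans S64.
(* Twice the bound on the mean: at most half of the coefficients exceed it. *)
pose b := 2 * l / S%:R; have b0 : 0 < b by rewrite divr_gt0 ?mulr_gt0.
pose T : {set 'I_N} := [set j in supp a | `|a j| <= b].
pose U : {set 'I_N} := [set j in supp a | b < `|a j|].
have STU : S = (#|T| + #|U|)%N.
  rewrite /S -(cardsID [set j | `|a j| <= b] (supp a)); congr (_ + _)%N; apply: eq_card => j.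
    by rewrite !inE.
  by rewrite !inE -ltNge andbC.
have U2 : (2 * #|U| <= S)%N.
  rewrite -(ler_nat R) natrM -(ler_pM2r l0).
  have bU : b * #|U|%:R <= l.
    apply: le_trans al; apply: (@le_trans _ _ (\sum_(j in U) `|a j|)).
      rewrite mulr_natr -sumr_const; apply: ler_sum => j; rewrite inE => /andP[_ /ltW].
      by [].
    rewrite big_mkcond; apply: ler_sum => j _; case: ifP => // _; exact: normr_ge0.
  by move: bU; rewrite /b -mulrA mulrCA mulrAC ler_pdivrMl //; lra.
have T2 : (S <= 2 * #|T|)%N by move: STU U2; clear; lia.
have T32 : (32 <= #|T|)%N by move: T2 S64; clear; lia.
have TS : (#|T| <= S)%N by rewrite STU leq_addr.
have Tb j : j \in T -> `|a j| <= b by rewrite inE => /andP[].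
have Ta j : j \in T -> a j != 0 by rewrite !inE => /andP[].
clearbody T.
have [x [x1 xhalf x0 xphi]] := col a T b T32 b0 Tb.
(* The sign [s] makes at least half of the extreme coordinates equal to [-1], which kills the corresponding coefficients. *)
have [s [s1 kill]] : exists s : R, `|s| = 1 /\ (#|T| <= 4 * #|[pred j in T | (s * x j == -1)%R]|)%N.
  have cU : (#|[pred j in T | (`|x j| == 1)%R]| <= #|[pred j in T | ((1 : R) * x j == -1)%R]| +
     #|[pred j in T | ((-1 : R) * x j == -1)%R]|)%N.
    rewrite -cardUI; apply: leq_trans (leq_addr _ _); apply: subset_leq_card.
    apply/fintype.subsetP => j; rewrite !inE mul1r mulN1r eqr_opp.
    by case/andP => -> /=; rewrite eqr_norml ler01 andbT orbC.
  have [le|gt] := leqP #|[pred j in T | ((1 : R) * x j == -1)%R]| #|[pred j in T | ((-1 : R) * x j == -1)%R]|.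
    by exists (-1); split; [rewrite normrN normr1|move: xhalf le cU; clear; lia].
  by exists 1; split; [rewrite normr1|move: xhalf gt cU; clear; lia].
pose a' j := if j \in T then a j * (1 + s * x j) else a j.
have sx j : `|s * x j| <= 1 by rewrite normrM s1 mul1r.
have diff j : a j - a' j = if j \in T then - s * (x j * a j) else 0.
  by rewrite /a'; case: ifP => _; ring.
exists a'; split.
- apply: le_trans al; rewrite -subr_ge0 -sumrB.
  have -> : \sum_j (`|a j| - `|a' j|) = - s * \sum_(j in T) x j * `|a j|.
    rewrite [in RHS]big_mkcond mulr_sumr; apply: eq_bigr => j _.
    rewrite /a'; case: ifP => _; last by rewrite subrr mulr0.
    have h : 0 <= 1 + s * x j by have := sx j; rewrite ler_norml; lra.
    by rewrite normrM (ger0_norm h); ring.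
  by rewrite x0 mulr0.
- have sub : supp a' \subset supp a :\: [set j in T | s * x j == -1].
    apply/fintype.subsetP => j; rewrite !inE /a'.
    case: ifP => [jT|_ ->] //=.
    rewrite mulf_eq0 negb_or => /andP[-> h]; rewrite !andbT /=; apply: contra h => /eqP ->.
    by rewrite subrr.
  have := subset_leq_card sub; rewrite cardsD.
  have -> : #|supp a :&: [set j in T | s * x j == -1]| = #|[pred j in T | (s * x j == -1)%R]|.
    apply: eq_card => j; rewrite !inE; have [jT|_] := boolP (j \in T); last by rewrite andbF.
    by rewrite Ta.
  by rewrite -/S; move: kill T2; clear; lia.
move=> z z1.
have -> : \sum_j (a j - a' j) * phi j z = - s * \sum_(j in T) x j * a j * phi j z.
  rewrite [in RHS]big_mkcond mulr_sumr; apply: eq_bigr => j _.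
  by rewrite diff; case: ifP => _; rewrite ?mul0r ?mulr0 //; ring.
rewrite normrM normrN s1 mul1r; apply: le_trans (xphi z z1) _.
have tR : 0 < #|T|%:R :> R by rewrite ltr0n; apply: leq_trans T32.
have -> : 2 * powR 2 A * K * l * powR N%:R A * powR S%:R (- (A + 2^-1)) =
    K * b * Num.sqrt S%:R * powR (N%:R * (2 / S%:R)) A.
  rewrite opprD powRD; last by rewrite (gt_eqF S0) implybT.
  have -> : powR S%:R (- 2^-1) = Num.sqrt S%:R / S%:R :> R.
    apply: (mulIf (lt0r_neq0 S0)); rewrite divfK ?gt_eqF //.
    rewrite -{2}[S%:R](powRr1 (ltW S0)) -powRD; last by rewrite (gt_eqF S0) implybT.
    by rewrite -powR12_sqrt ?ltW //; congr powR; field.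
  rewrite powRM ?divr_ge0 // powRM ?invr_ge0 //.
  have -> : powR S%:R^-1 A = powR S%:R (- A) :> R.
    by rewrite -powR_inv1 // -powRrM mulN1r.
  by rewrite /b; ring.
have Kb : 0 < K * b by rewrite mulr_gt0.
apply: ler_pM; [by rewrite mulr_ge0 ?sqrtr_ge0 // ltW|exact: powR_ge0| |].
  by rewrite ler_pM2l // ler_wsqrtr // ler_nat.
apply: ge0_ler_powR; rewrite ?nnegrE ?divr_ge0 ?mulr_ge0 ?invr_ge0 ?(ltW A0) //.
apply: ler_wpM2l => //; rewrite -[leRHS]invf_div lef_pV2 ?posrE ?divr_gt0 //.
by rewrite ler_pdivrMr // -natrM ler_nat mulnC.
Qed.

Lemma sparsification (R : realType) (K A : R) : 0 < K -> 0 < A ->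
  exists2 E : R, 0 < E & forall (N : nat) (phi : 'I_N -> R -> R), colorable K A phi ->
    forall (m : nat) (l : R) (a : 'I_N -> R), (64 <= m)%N -> 0 < l -> \sum_j `|a j| <= l ->
    exists d : 'I_N -> R, (#|supp d| <= m)%N /\
      forall z : R, -1 <= z <= 1 -> `|\sum_j (a j - d j) * phi j z| <=
         E * l * powR N%:R A * powR m%:R (- (A + 2^-1)).
Proof.
move=> K0 A0; pose K2 := 2 * powR 2 A * K; pose gam := A + 2^-1.
have gam0 : 0 < gam by rewrite /gam; lra.
have K20 : 0 < K2 by rewrite !mulr_gt0 ?powR_gt0.
pose q : R := powR (8 / 7) gam.
have q1 : 1 < q.
  rewrite /q -[ltLHS](_ : powR 1 gam = 1); last by rewrite powR1.
  by apply: gt0_ltr_powR; rewrite ?nnegrE //; lra.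
(* Chosen so that [D q = D + K2]: one thinning raises [D g] by at least its own error [K2 g], so the
   errors telescope. *)
pose D := K2 / (q - 1); have D0 : 0 < D by rewrite divr_gt0 // subr_gt0.
have DK : D * q = D + K2 by rewrite /D; field; rewrite gt_eqF // subr_gt0.
exists (K2 + D); first by rewrite addr_gt0.
move=> N phi col m l a m64 l0.
have mR : 0 < m%:R :> R by rewrite ltr0n; apply: leq_trans m64.
pose g (S : nat) : R := powR S%:R (- gam).
have g0 S : 0 <= g S by exact: powR_ge0.
pose W := l * powR N%:R A; have W0 : 0 <= W by rewrite mulr_ge0 ?powR_ge0 // ltW.
have ganti (S S' : nat) (u : R) : (0 < S')%N -> 0 < u -> u * S'%:R <= S%:R ->
    powR u gam * g S <= g S'.
  move=> S'0 u0 uS.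
  have S'R : 0 < S'%:R :> R by rewrite ltr0n.
  have SR : 0 < S%:R :> R by apply: lt_le_trans uS; rewrite mulr_gt0.
  have gS : g S * powR S%:R gam = 1.
    by rewrite /g -powRD ?addNr ?powRr0 // (gt_eqF SR) implybT.
  have gS' : g S' * powR S'%:R gam = 1.
    by rewrite /g -powRD ?addNr ?powRr0 // (gt_eqF S'R) implybT.
  have -> : g S' = g S' * powR S%:R gam * g S by rewrite -mulrA [_ * g S]mulrC gS mulr1.
  rewrite ler_wpM2r //.
  have -> : powR u gam = g S' * (powR S'%:R gam * powR u gam) by rewrite mulrA gS' mul1r.
  rewrite ler_wpM2l // -powRM ?(ltW u0) ?(ltW S'R) //.
  by apply: ge0_ler_powR; [exact: ltW|rewrite nnegrE mulr_ge0 // ltW|rewrite nnegrE ltW|rewrite mulrC].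
(* The term [- D g] of the current support makes the strong induction on the support close. *)
suff main : \sum_j `|a j| <= l -> exists d : 'I_N -> R, (#|supp d| <= m)%N /\
    forall z : R, -1 <= z <= 1 -> `|\sum_j (a j - d j) * phi j z| <=
      if (#|supp a| <= m)%N then 0 else W * ((K2 + D) * g m - D * g #|supp a|).
  move=> /main[d [dm dz]]; exists d; split => // z z1; apply: le_trans (dz z z1) _.
  have -> : (K2 + D) * l * powR N%:R A * powR m%:R (- (A + 2^-1)) = W * ((K2 + D) * g m).
    by rewrite /W /g; ring.
  case: ifP => _; first by rewrite mulr_ge0 // mulr_ge0 // ltW // addr_gt0.
  by rewrite ler_wpM2l // gerBl mulr_ge0 // ltW.
move=> al; have [S aS] : exists S, #|supp a| = S by eexists.
elim/ltn_ind: S a aS al => S IH a aS al.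
have [Sm|mS] := leqP S m.
  exists a; rewrite aS Sm; split => // z _.
  by rewrite big1 ?normr0 // => j _; rewrite subrr mul0r.
have S64 : (64 <= #|supp a|)%N by rewrite aS; exact: leq_trans m64 (ltnW mS).
have [a' [a'l a'S a'z]] := thinning K0 A0 col l0 al S64.
rewrite aS in a'S a'z.
have S'S : (#|supp a'| < S)%N by move: a'S mS m64; clear; lia.
have [d [dm dz]] := IH _ S'S a' erefl a'l.
exists d; split => // z z1; rewrite aS (leqNgt S) mS /=.
have -> : \sum_j (a j - d j) * phi j z =
    \sum_j (a j - a' j) * phi j z + \sum_j (a' j - d j) * phi j z.
  by rewrite -big_split /=; apply: eq_bigr => j _; ring.
apply: le_trans (ler_normD _ _) _.
apply: le_trans (lerD (a'z z z1) (dz z z1)) _.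
have -> : 2 * powR 2 A * K * l * powR N%:R A * powR S%:R (- (A + 2^-1)) = W * (K2 * g S).
  by rewrite /W /g /K2; ring.
case: ifP => [_|S'm].
  rewrite addr0; apply: ler_wpM2l => //; rewrite lerBrDr -mulrDl.
  apply: ler_wpM2l; first by rewrite ltW // addr_gt0.
  have /= := @ganti S m 1 _ ltr01 _; rewrite powR1 !mul1r; apply.
    exact: leq_trans m64.
  by rewrite ler_nat ltnW.
rewrite -mulrDr; apply: ler_wpM2l => //.
have S'0 : (0 < #|supp a'|)%N by move: S'm m64; clear; lia.
have r87 : 8 / 7 * #|supp a'|%:R <= S%:R :> R.
  by rewrite mulrAC ler_pdivrMr // -!natrM ler_nat mulnC [(S * 7)%N]mulnC mulnC.
have := ler_wpM2l (ltW D0) (ganti S #|supp a'| (8 / 7) S'0 (divr_gt0 (ltr0n R 8) (ltr0n R 7)) r87).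
rewrite -/q mulrA DK => H.
by move: H; move: (g S) (g #|supp a'|) (g m) => x y w; clear; lra.
Qed.

(** * Real powers, greedy selection and the approximation of one block *)

Lemma powR_cancel (R : realType) (x s : R) : 0 < x -> powR x s * powR x (- s) = 1.
Proof. by move=> x0; rewrite -powRD ?subrr ?powRr0 // (gt_eqF x0) implybT. Qed.

Lemma powRDp (R : realType) (x s u : R) : 0 < x -> powR x (s + u) = powR x s * powR x u.
Proof. by move=> x0; rewrite powRD // (gt_eqF x0) implybT. Qed.

Lemma powR_le_exp (R : realType) (x s u : R) : 1 <= x -> s <= u -> powR x s <= powR x u.
Proof. by move=> x1 su; apply: ler_powR. Qed.

Lemma powR_anti (R : realType) (x y s : R) : 0 < x -> x <= y -> 0 <= s ->
  powR y (- s) <= powR x (- s).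
Proof.
move=> x0 xy s0; have y0 : 0 < y by apply: lt_le_trans xy.
rewrite -(ler_pM2l (powR_gt0 s y0)) powR_cancel //.
rewrite -(powR_cancel s x0) ler_wpM2r ?powR_ge0 //.
by apply: ge0_ler_powR; rewrite ?nnegrE // ltW.
Qed.

Lemma le_powR_theta (R : realType) (x theta : R) : 0 <= x -> 0 < theta -> theta <= 1 ->
  powR x theta <= 1 -> x <= powR x theta.
Proof.
move=> x0 t0 t1 xt; have [->|xn0] := eqVneq x 0; first exact: powR_ge0.
have xp : 0 < x by rewrite lt_neqAle eq_sym xn0.
apply: ger1_powR => //; rewrite xp /=; move: xt; apply: contraTT; rewrite -!ltNge => x1.
have -> : 1 = powR 1 theta :> R by rewrite powR1.
by apply: gt0_ltr_powR; rewrite ?nnegrE.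
Qed.

Lemma sum_le_powR_theta (R : realType) (I : finType) (b : I -> R) (theta : R) :
  (forall i, 0 <= b i) -> 0 < theta -> theta <= 1 -> \sum_i powR (b i) theta <= 1 ->
  \sum_i b i <= 1.
Proof.
move=> b0 t0 t1 b1; apply: le_trans (b1); apply: ler_sum => i _.
apply: le_powR_theta => //; apply: le_trans b1.
by rewrite (bigD1 i) //= lerDl; apply: sumr_ge0 => j _; exact: powR_ge0.
Qed.

(** [c - e] keeps the large coefficients. With [v = M^(-1/theta)], at most [M] numbers [Q |c_j|]
    exceed [v], and the others satisfy [x <= x^theta v^(1 - theta)]. *)
Lemma greedy_split (R : realType) (N M : nat) (c : 'I_N -> R) (Q theta : R) :
  0 < theta -> theta <= 1 -> 0 < Q -> (0 < M)%N ->
  \sum_j powR (Q * `|c j|) theta <= 1 ->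
  exists e : 'I_N -> R, (#|supp (fun j => (c j - e j)%R)| <= M)%N /\
    \sum_j `|e j| <= Q^-1 * powR M%:R (1 - theta^-1).
Proof.
move=> th0 th1 Q0 M0 cQ.
have MR : 0 < M%:R :> R by rewrite ltr0n.
pose v := powR M%:R (- theta^-1) : R; have v0 : 0 < v by exact: powR_gt0.
have vth : powR v theta = M%:R^-1.
  by rewrite /v -powRrM mulNr mulVf ?gt_eqF // -powR_inv1 // ltW.
exists (fun j => if Q * `|c j| <= v then c j else 0); split.
  rewrite -(ler_nat R) -[leRHS]mul1r -ler_pdivrMr //; apply: le_trans cQ.
  rewrite mulrC mulr_natr -sumr_const big_mkcond; apply: ler_sum => j _.
  case: ifP => [|_]; last exact: powR_ge0.
  rewrite inE; case: ifP => [_|/negbT]; first by rewrite subrr eqxx.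
  rewrite -ltNge -vth => /ltW vQ _; apply: ge0_ler_powR; rewrite ?nnegrE ?(ltW th0) ?(ltW v0) //.
  by rewrite mulr_ge0 // ltW.
rewrite -(ler_pM2l Q0) mulrA divff ?gt_eqF // mul1r mulr_sumr.
have -> : powR M%:R (1 - theta^-1) = powR v (1 - theta) :> R.
  rewrite /v -powRrM; congr powR; field; by rewrite gt_eqF.
rewrite -[leRHS]mul1r; apply: le_trans (_ : \sum_j powR (Q * `|c j|) theta * powR v (1 - theta) <= _); last first.
  by rewrite -mulr_suml ler_wpM2r ?powR_ge0.
apply: ler_sum => j _; case: ifP => [bv|_]; last first.
  by rewrite normr0 mulr0 mulr_ge0 ?powR_ge0.
have b0 : 0 <= Q * `|c j| by rewrite mulr_ge0 // ltW.
have [->|bn0] := eqVneq (Q * `|c j|) 0; first by rewrite mulr_ge0 ?powR_ge0.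
have bp : 0 < Q * `|c j| by rewrite lt_neqAle eq_sym bn0.
rewrite [leLHS](_ : _ = powR (Q * `|c j|) theta * powR (Q * `|c j|) (1 - theta)); last first.
  by rewrite -powRDp // subrKC powRr1.
rewrite ler_wpM2l ?powR_ge0 //.
by apply: ge0_ler_powR; rewrite ?nnegrE ?subr_ge0 // ltW.
Qed.

Lemma block_approximation (R : realType) (alpha theta r : R) (p : nat) :
  - (1 / 2) < alpha -> 0 < theta -> theta <= 1 -> ~~ odd p ->
  exists2 C : R, 0 < C & forall L : nat -> {poly R}, orthonormal_system alpha L ->
    forall (N : nat) (c : 'I_N -> R) (m : R), (0 < N)%N -> 0 < m ->
    \sum_j powR (powR N%:R r * `|c j|) theta <= 1 ->
    exists d : 'I_N -> R, #|supp d|%:R <= 2 * m /\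
      forall z : R, -1 <= z <= 1 -> `|\sum_j (c j - d j) * (L (N + j)%N).[z]| <=
        C * powR N%:R (alpha + 1 / 2 + p.+2%:R^-1 - r) *
        powR m (- (theta^-1 - 1 / 2 + (alpha + 1 / 2 + p.+2%:R^-1))).
Proof.
move=> a2 th0 th1 podd; have l0 : 0 < alpha + 1 / 2 by lra.
set A := alpha + 1 / 2 + p.+2%:R^-1.
have lA : alpha + 1 / 2 <= A by rewrite lerDl.
have A0 : 0 < A by apply: lt_le_trans lA.
have th1' : 1 <= theta^-1 by rewrite invf_ge1.
set rho := theta^-1 - 1 / 2; have rho0 : 0 < rho by rewrite /rho; lra.
have [K K0 col] := coloring_block a2 podd.
have [E E0 spars] := sparsification K0 A0.
have [C0 C00 supb] := orthonormal_sup_bound a2.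
pose C1 := C0 * powR 3 (alpha + 1 / 2) * powR 65 (rho + A).
pose C2 := E * powR 2 (rho + A).
have C10 : 0 < C1 by rewrite !mulr_gt0 ?powR_gt0.
have C20 : 0 < C2 by rewrite mulr_gt0 ?powR_gt0.
exists (C1 + C2); first by rewrite addr_gt0.
move=> L oL N c m N0 m0 cN.
have NR : 0 < N%:R :> R by rewrite ltr0n.
have N1 : 1 <= N%:R :> R by rewrite ler1n.
have Nr : 0 < powR N%:R r :> R by exact: powR_gt0.
have NrV : (powR N%:R r)^-1 = powR N%:R (- r) :> R.
  by apply: (mulfI (lt0r_neq0 Nr)); rewrite powR_cancel // mulfV // gt_eqF.
have rhoA : 0 < rho + A by rewrite addr_gt0.
(* Distant blocks have [m = n kap^k] as small as one likes; they are replaced by 0, and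
   [65^(rho + A)] in [C1] compensates. Above 65 the integer part of [m] meets the threshold 64 of
   [sparsification]. *)
have [m65|m65] := leP m 65.
  exists (fun=> 0); split.
    rewrite eq_card0 => [|j]; last by rewrite inE eqxx.
    by rewrite mulr_ge0 // ltW.
  move=> z z1; under eq_bigr do rewrite subr0.
  have c1 : \sum_j `|c j| <= powR N%:R (- r).
    rewrite -NrV -(ler_pM2l Nr) mulfV ?gt_eqF // mulr_sumr.
    by apply: sum_le_powR_theta cN => // j; rewrite mulr_ge0 // ltW.
  apply: le_trans (ler_norm_sum _ _ _) _.
  apply: (@le_trans _ _ (\sum_j `|c j| * (C0 * powR (3 * N%:R) (alpha + 1 / 2)))).
    apply: ler_sum => j _; rewrite normrM ler_wpM2l //.
    apply: le_trans (supb L oL (N + j)%N z z1) _; rewrite ler_pM2l //.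
    apply: ge0_ler_powR; rewrite ?nnegrE ?(ltW l0) ?addr_ge0 ?mulr_ge0 //.
    rewrite nat1r -natrM ler_nat; have := ltn_ord j; move: N0; clear; lia.
  rewrite -mulr_suml; apply: (@le_trans _ _ (powR N%:R (- r) * (C0 * powR (3 * N%:R) (alpha + 1 / 2)))).
    by rewrite ler_wpM2r // mulr_ge0 ?powR_ge0 // ltW.
  apply: (@le_trans _ _ (C1 * powR N%:R (A - r) * powR m (- (rho + A)))); last first.
    by do 2 (apply: ler_wpM2r; first exact: powR_ge0); rewrite lerDl ltW.
  rewrite powRM // (powRDp A (- r) NR) /C1.
  have mm : 1 <= powR 65 (rho + A) * powR m (- (rho + A)).
    rewrite [leLHS](_ : _ = powR 65 (rho + A) * powR 65 (- (rho + A))); last by rewrite powR_cancel.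
    by apply: ler_wpM2l; [exact: powR_ge0|apply: powR_anti => //; exact: ltW].
  have NN : powR N%:R (alpha + 1 / 2) <= powR N%:R A :> R by exact: powR_le_exp.
  have -> : C0 * powR 3 (alpha + 1 / 2) * powR 65 (rho + A) * (powR N%:R A * powR N%:R (- r)) *
      powR m (- (rho + A)) = powR N%:R (- r) * (C0 * (powR 3 (alpha + 1 / 2) * powR N%:R A)) *
      (powR 65 (rho + A) * powR m (- (rho + A))) by ring.
  rewrite -[leLHS]mulr1; apply: ler_pM => //.
    by rewrite !mulr_ge0 ?powR_ge0 // ltW.
  by rewrite ler_wpM2l ?powR_ge0 // ler_pM2l // ler_wpM2l ?powR_ge0.
pose M := Num.truncn m.
have /andP[Mm mM] : M%:R <= m < M.+1%:R by apply: truncn_itv; exact: ltW.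
have M64 : (64 <= M)%N by rewrite -ltnS -(ltr_nat R); apply: lt_trans mM; apply: lt_trans m65; rewrite ltr_nat.
have M0 : (0 < M)%N by exact: leq_trans M64.
have MR : 0 < M%:R :> R by rewrite ltr0n.
have [e [eM el]] := greedy_split th0 th1 Nr M0 cN.
pose l := (powR N%:R r)^-1 * powR M%:R (1 - theta^-1) : R.
have l0' : 0 < l by rewrite mulr_gt0 ?invr_gt0 ?powR_gt0.
have colN : @colorable R K A N (fun j z => (L (N + j)%N).[z]).
  move=> a T b T32 b0 ab; have [x [x1 x2 x3 x4]] := col L oL N a T b T32 b0 ab.
  by exists x; split; [exact: x1|exact: x2|exact: x3|exact: x4].
have [d0 [d0M d0z]] := spars N _ colN M l e M64 l0' el.
(* At most [M] large coefficients and at most [M] terms of the sparsified rest. *)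
exists (fun j => d0 j + (c j - e j)); split.
  have sub : supp (fun j => d0 j + (c j - e j)) \subset supp d0 :|: supp (fun j => c j - e j).
    apply/fintype.subsetP => j; rewrite !inE -negb_and; apply: contra => /andP[/eqP -> /eqP ->].
    by rewrite addr0.
  apply: (@le_trans _ _ (2 * M%:R)); last by rewrite ler_pM2l.
  rewrite -natrM ler_nat; apply: leq_trans (subset_leq_card sub) _.
  by apply: leq_trans (leq_card_setU _ _) _; rewrite mul2n -addnn leq_add.
move=> z z1; have -> : \sum_j (c j - (d0 j + (c j - e j))) * (L (N + j)%N).[z] =
    \sum_j (e j - d0 j) * (L (N + j)%N).[z] by apply: eq_bigr => j _; ring.
apply: le_trans (d0z z z1) _.
apply: (@le_trans _ _ (C2 * powR N%:R (A - r) * powR m (- (rho + A)))); last first.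
  by do 2 (apply: ler_wpM2r; first exact: powR_ge0); rewrite lerDr ltW.
have -> : E * l * powR N%:R A * powR M%:R (- (A + 2^-1)) =
    E * powR N%:R (A - r) * powR M%:R (- (rho + A)).
  rewrite /l NrV (powRDp A (- r) NR) (_ : - (rho + A) = (1 - theta^-1) + - (A + 2^-1)).
    by rewrite (powRDp (1 - _) _ MR); ring.
  by rewrite /rho; field; rewrite gt_eqF.
have -> : C2 * powR N%:R (A - r) * powR m (- (rho + A)) =
    E * powR N%:R (A - r) * (powR 2 (rho + A) * powR m (- (rho + A))) by rewrite /C2; ring.
rewrite ler_wpM2l ?mulr_ge0 ?powR_ge0 ?(ltW E0) //.
have -> : powR 2 (rho + A) * powR m (- (rho + A)) = powR (m / 2) (- (rho + A)).
  have m2 : 0 < m / 2 by rewrite divr_gt0.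
  apply: (mulfI (lt0r_neq0 (powR_gt0 (rho + A) m2))); rewrite powR_cancel //.
  rewrite mulrA -powRM ?(ltW m2) // divfK ?gt_eqF // powR_cancel //.
apply: powR_anti; [by rewrite divr_gt0| |exact: ltW].
rewrite ler_pdivrMr // mulr_natr mulr2n; apply: ltW; apply: lt_le_trans mM _.
by rewrite -natrD ler_nat -addn1 leq_add2l.
Qed.

(** * Uniform recovery of a continuous function from its series *)

Lemma bernoulli (R : realType) (e : R) (s : nat) : 0 <= e -> 1 + s%:R * e <= (1 + e) ^+ s.
Proof.
move=> e0; elim: s => [|s IH]; first by rewrite mul0r addr0.
rewrite exprS; apply: le_trans (ler_wpM2l _ IH); last by rewrite addr_ge0.
have : 0 <= s%:R * e * e by rewrite !mulr_ge0.
rewrite -natr1; lra.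
Qed.

Lemma within_continuous_bounded (R : realType) (h : R -> R) : {within `[-1, 1], continuous h} ->
  exists2 B : R, 0 <= B & forall x, -1 <= x <= 1 -> `|h x| <= B.
Proof.
move=> ch; have n1 : (-1 : R) <= 1 by lra.
have cn : {within `[-1, 1], continuous (fun x => `|h x|)}.
  by move=> x; apply: cvg_norm; exact: ch.
have [x0 _ x0max] := EVT_max n1 cn.
exists `|h x0| => // x x1; apply: x0max; by rewrite in_itv.
Qed.

(* The polynomials [q^s] with [q] larger than 1 exactly near [x0] detect the sign of [h x0]. *)
Lemma peak_positive (R : realType) (alpha c x0 : R) (h : R -> R) (Q : nat -> {poly R}) :
  -1 < alpha -> {within `[-1, 1], continuous h} -> -1 <= x0 <= 1 -> 0 < c ->
  4 * c <= h x0 -> (forall k x, -1 <= x <= 1 -> `|(Q k).[x]| <= c) ->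
  (forall k (p : {poly R}), (size p <= k)%N ->
     gexp alpha (fun x => (h x - (Q k).[x]) * p.[x]) = 0) -> False.
Proof.
move=> a1 ch x01 c0 hx0 Qc orth.
have [B B0 hB] := within_continuous_bounded ch.
have [d [d0 d1 hd]] : exists d : R, [/\ 0 < d, d <= 1 &
    forall x, -1 <= x <= 1 -> `|x - x0| < d -> 3 * c <= h x].
  have x0I : (`[-1, 1]%classic : set R) x0 by rewrite /= in_itv /=.
  have /cvgrPdist_lt/(_ c c0) := (subspace_continuousP _ _).1 ch x0 x0I.
  rewrite near_withinE => /nbhs_ballP[d /= d0 db].
  exists (Num.min d 1); split; first by rewrite lt_min d0 ltr01.
    by rewrite ge_min lexx orbT.
  move=> x x1; rewrite lt_min => /andP[xd _].
  have : `|h x0 - h x| < c.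
    by apply: db; [rewrite /ball /= distrC|rewrite /= in_itv].
  by have := ler_norm (h x0 - h x); lra.
(* The factor [1/4] keeps [q >= 0] on [[-1, 1]], where [|x - x0| <= 2]. Moreover [q >= 1 + e] within
   [d/2] of [x0], and [q <= 1] beyond [d]. *)
pose q : {poly R} := 1%:P + (4^-1)%:P * ((d ^+ 2)%:P - ('X - x0%:P) * ('X - x0%:P)).
have qE x : q.[x] = 1 + 4^-1 * (d ^+ 2 - (x - x0) ^+ 2).
  rewrite /q !(hornerD, hornerN, hornerM, hornerX, hornerC); ring.
pose e : R := 3 / 16 * d ^+ 2; have e0 : 0 < e by rewrite mulr_gt0 ?exprn_gt0.
pose w (x : R) := 1 - (2 / d * (x - x0)) ^+ 2.
(* A continuous minorant of the indicator of [|x - x0| < d/2], so that [gexp] applies to it. *)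
pose psi (x : R) := (w x + `|w x|) / 2.
have wE : w = horner (1%:P - (2 / d)%:P * (2 / d)%:P * (('X - x0%:P) * ('X - x0%:P))).
  apply/funext => x; rewrite /w !(hornerD, hornerN, hornerM, hornerX, hornerC); ring.
have cw : {within `[-1, 1], continuous w} by rewrite wE; exact: within_continuous_poly.
have cpsi : {within `[-1, 1], continuous psi}.
  apply: within_continuousM; last exact: within_continuous_cst.
  apply: within_continuousD => // x; apply: cvg_norm; exact: cw.
have psi0 x : 0 <= psi x.
  by have := ler_norm (- w x); rewrite normrN /psi; lra.
have psi1 x : psi x <= 1.
  have w1 : w x <= 1 by rewrite /w gerBl sqr_ge0.
  rewrite /psi; case: (ger0P (w x)) => _; lra.
have psi_out x : d / 2 <= `|x - x0| -> psi x = 0.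
  move=> xd; rewrite /psi ler0_norm ?subrr ?mul0r // /w subr_le0.
  rewrite -real_normK ?num_real // normrM gtr0_norm ?divr_gt0 //.
  by rewrite exprn_ege1 // mulrAC ler_pdivlMr // mul1r; lra.
(* An interval beside [x0] on the side of 0, since [x0] may be an endpoint. *)
have [a [b [aN1 ab b1 abd]]] : exists a b : R, [/\ -1 < a, a < b, b < 1 &
    forall x, a <= x <= b -> `|x - x0| <= d / 4].
  have [x0p|x0n] := leP 0 x0.
    exists (x0 - d / 4), (x0 - d / 8); split; try lra.
    by move=> x xI; rewrite ler_norml; lra.
  exists (x0 + d / 8), (x0 + d / 4); split; try lra.
  by move=> x xI; rewrite ler_norml; lra.
have kap0 : 0 < gexp alpha psi.
  apply: (@gexp_gt0 R alpha a b (3 / 4) psi) => // x xI.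
  have wx : (2 / d * (x - x0)) ^+ 2 <= 1 / 4.
    have -> : (1 : R) / 4 = (1 / 2) ^+ 2 by field.
    have xh : 2 / d * `|x - x0| <= 1 / 2.
      by have := abd x xI; rewrite mulrAC ler_pdivrMr //; lra.
    rewrite -real_normK ?num_real // normrM gtr0_norm ?divr_gt0 //.
    by rewrite lerXn2r ?nnegrE ?divr_ge0 // mulr_ge0 // divr_ge0 // ltW.
  have wx2 : 3 / 4 <= w x by rewrite /w; lra.
  by have := ler_norm (w x); rewrite /psi; lra.
have [s hs] : exists s : nat, B + c < 2 * c * (1 + e) ^+ s * gexp alpha psi.
  pose v := 2 * c * e * gexp alpha psi.
  have v0 : 0 < v by apply: mulr_gt0 => //; apply: mulr_gt0 => //; apply: mulr_gt0.
  exists (Num.truncn ((B + c) / v)).+1.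
  have := truncnS_gt ((B + c) / v); rewrite ltr_pdivrMr // => h1.
  set S := (Num.truncn _).+1 in h1 *.
  have bS : S%:R * e <= (1 + e) ^+ S by apply: le_trans (bernoulli S (ltW e0)); rewrite lerDr.
  apply: lt_le_trans h1 _.
  have -> : S%:R * v = 2 * c * (S%:R * e) * gexp alpha psi by rewrite /v; ring.
  by rewrite ler_pM2r // ler_pM2l ?mulr_gt0.
pose k := size (q ^+ s).
have E := orth k (q ^+ s) (leqnn _).
(* The minorant has positive mean by the choice of [s], whereas the right side has mean 0. *)
have lower x : -1 <= x <= 1 ->
    2 * c * (1 + e) ^+ s * psi x + - (B + c) <= (h x - (Q k).[x]) * (q ^+ s).[x].
  move=> x1; rewrite horner_exp qE.
  have Qx := Qc k x x1; have hBx := hB x x1.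
  have [xd|xd] := ltP `|x - x0| (d / 2).
    have h3 : 2 * c <= h x - (Q k).[x].
      by have := hd x x1 (lt_trans xd _); have := ler_norm (Q k).[x]; lra.
    have q1 : 1 + e <= 1 + 4^-1 * (d ^+ 2 - (x - x0) ^+ 2).
      have : (x - x0) ^+ 2 <= (d / 2) ^+ 2.
        have dh : 0 <= d / 2 by rewrite divr_ge0 // ltW.
        by rewrite -real_normK ?num_real // lerXn2r ?nnegrE // ltW.
      rewrite /e; lra.
    have qs : (1 + e) ^+ s <= (1 + 4^-1 * (d ^+ 2 - (x - x0) ^+ 2)) ^+ s.
      by rewrite lerXn2r ?nnegrE; lra.
    have es0 : 0 < (1 + e) ^+ s by rewrite exprn_gt0; lra.
    apply: (@le_trans _ _ (2 * c * (1 + e) ^+ s)).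
      have : 2 * c * (1 + e) ^+ s * psi x <= 2 * c * (1 + e) ^+ s.
        by rewrite ler_piMr // !mulr_ge0 // ltW.
      by lra.
    by rewrite ler_pM // ?mulr_ge0 // ltW.
  rewrite (psi_out x xd) mulr0 add0r.
  have q0 : 0 <= 1 + 4^-1 * (d ^+ 2 - (x - x0) ^+ 2).
    have : (x - x0) ^+ 2 <= 2 ^+ 2.
      by rewrite -real_normK ?num_real // lerXn2r ?nnegrE // ler_norml; lra.
    by have := sqr_ge0 d; lra.
  have [xd1|xd1] := ltP `|x - x0| d.
    have h3 : 0 <= h x - (Q k).[x].
      by have := hd x x1 xd1; have := ler_norm (Q k).[x]; lra.
    by apply: (@le_trans _ _ 0); [lra|rewrite mulr_ge0 ?exprn_ge0].
  have q1 : 1 + 4^-1 * (d ^+ 2 - (x - x0) ^+ 2) <= 1.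
    have : d ^+ 2 <= (x - x0) ^+ 2.
      by rewrite -[leRHS]real_normK ?num_real // lerXn2r ?nnegrE // ltW.
    by lra.
  rewrite -lerN2 opprK; apply: le_trans (ler_norm _) _; rewrite normrN normrM.
  have qs1 : `|(1 + 4^-1 * (d ^+ 2 - (x - x0) ^+ 2)) ^+ s| <= 1.
    by rewrite ger0_norm ?exprn_ge0 // exprn_ile1.
  apply: le_trans (ler_wpM2l (normr_ge0 _) qs1) _; rewrite mulr1.
  by apply: le_trans (ler_normB _ _) _; rewrite lerD.
have cps : {within `[-1, 1], continuous (fun x => 2 * c * (1 + e) ^+ s * psi x)}.
  by apply: within_continuousM => //; exact: within_continuous_cst.
have := @le_gexp R alpha (fun x => 2 * c * (1 + e) ^+ s * psi x + - (B + c))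
  (fun x => (h x - (Q k).[x]) * (q ^+ s).[x]) a1 _ _ lower.
rewrite E gexpD //; last exact: within_continuous_cst.
rewrite gexpZ // gexp_cst // => H.
have c1 : {within `[-1, 1], continuous (fun x => 2 * c * (1 + e) ^+ s * psi x + - (B + c))}.
  by apply: within_continuousD => //; exact: within_continuous_cst.
have c2 : {within `[-1, 1], continuous (fun x => (h x - (Q k).[x]) * (q ^+ s).[x])}.
  apply: within_continuousM; last exact: within_continuous_poly.
  apply: within_continuousD => // x; apply: cvgN; exact: within_continuous_poly.
by have := H c1 c2; rewrite subr_le0 leNgt hs.
Qed.

(** If the error at [x0] exceeded [4 tau], [peak_positive] would apply to the remainder after [M]
    terms, with the later partial sums as [Q k]: they are at most [tau], and subtracting them leaves
    a function orthogonal to all degrees below [M + k]. *)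
Lemma gexp_uniform_limit (R : realType) (alpha tau : R) (L : nat -> {poly R}) (u : R -> R)
    (M : nat) (x0 : R) :
  -1 < alpha -> orthonormal_system alpha L -> {within `[-1, 1], continuous u} -> 0 <= tau ->
  (forall M' x, (M <= M')%N -> -1 <= x <= 1 ->
     `|\sum_(M <= j < M') gip alpha u (horner (L j)) * (L j).[x]| <= tau) ->
  -1 <= x0 <= 1 ->
  `|u x0 - \sum_(0 <= j < M) gip alpha u (horner (L j)) * (L j).[x0]| <= 4 * tau.
Proof.
move=> a1 oL cu tau0 tail x01; pose a j := gip alpha u (horner (L j)).
pose P (m m' : nat) : {poly R} := \sum_(m <= j < m') a j *: L j.
have PE m m' x : (P m m').[x] = \sum_(m <= j < m') a j * (L j).[x].
  by rewrite horner_sum; apply: eq_bigr => j _; rewrite hornerZ.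
rewrite leNgt; apply/negP; set hx := u x0 - _ => big.
pose c := `|hx| / 4; have c0 : 0 < c by rewrite divr_gt0 //; apply: le_lt_trans big; rewrite mulr_ge0.
have tauc : tau <= c by rewrite ler_pdivlMr // mulrC ltW.
pose s : R := Num.sg hx.
have hx0 : hx != 0 by rewrite -normr_gt0; apply: le_lt_trans big; rewrite mulr_ge0.
have s1 : `|s| = 1 by rewrite normr_sg hx0.
pose h x := s * (u x - (P 0%N M).[x]).
pose Q k : {poly R} := s *: P M (M + k)%N.
have ch0 : {within `[-1, 1], continuous (fun x => u x - (P 0%N M).[x])}.
  apply: within_continuousD => // x; apply: cvgN; exact: within_continuous_poly.
have ch : {within `[-1, 1], continuous h}.
  by apply: within_continuousM => //; exact: within_continuous_cst.
apply: (@peak_positive R alpha c x0 h Q a1 ch x01 c0).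
- by rewrite /h PE -/hx /s -normrEsg /c mulrC divfK.
- move=> k x x1; rewrite /Q hornerZ normrM s1 mul1r PE.
  by apply: le_trans tauc; apply: tail => //; exact: leq_addr.
move=> k p sp.
have cPp m m' : {within `[-1, 1], continuous (fun x => u x - (P m m').[x])}.
  apply: within_continuousD => // x; apply: cvgN; exact: within_continuous_poly.
have base j : (j < M + k)%N ->
    gexp alpha (fun x => (u x - (P 0%N (M + k)%N).[x]) * (L j).[x]) = 0.
  move=> jk.
  rewrite (@eq_gexp _ _ _ (fun x => u x * (L j).[x] + -1 * (P 0%N (M + k)%N * L j).[x])); last first.
    by move=> x _; rewrite hornerM; ring.
  rewrite gexpD //; last 2 first.
    by apply: within_continuousM => //; exact: within_continuous_poly.
    by apply: within_continuousM; [exact: within_continuous_cst|exact: within_continuous_poly].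
  rewrite gexpZ //; last exact: within_continuous_poly.
  rewrite -/(pexp alpha _) -gipE /P big_mkord mulr_suml pexp_sum //.
  rewrite (bigD1 (Ordinal jk)) //= big1 => [|i]; last first.
    rewrite -val_eqE /= => /negbTE ij.
    by rewrite -scalerAl pexpZ // -gip_poly oL.2 ij mulr0.
  by rewrite -scalerAl pexpZ // -gip_poly oL.2 eqxx mulr1 addr0 mulN1r subrr.
have hQ x : h x - (Q k).[x] = s * (u x - (P 0%N (M + k)%N).[x]).
  rewrite /h /Q hornerZ !PE (big_cat_nat (n := M) (leq0n M) (leq_addr k M)) /=; ring.
have spM : (size p <= M + k)%N by apply: leq_trans sp _; exact: leq_addl.
have [b bE] := graded_basis oL.1 spM.
rewrite (@eq_gexp _ _ _ (fun x => s * ((u x - (P 0%N (M + k)%N).[x]) * p.[x]))); last first.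
  by move=> x _; rewrite hQ mulrA.
rewrite gexpZ //; last by apply: within_continuousM => //; exact: within_continuous_poly.
suff -> : gexp alpha (fun x => (u x - (P 0%N (M + k)%N).[x]) * p.[x]) = 0 by rewrite mulr0.
suff gen n : (n <= M + k)%N ->
    gexp alpha (fun x => (u x - (P 0%N (M + k)%N).[x]) * (\sum_(i < n) b i *: L i).[x]) = 0.
  by rewrite bE; exact: gen (leqnn _).
elim: n => [|n IH] nk.
  rewrite big_ord0 -[RHS](@gexp_cst R alpha 0 a1); apply: eq_gexp => x _.
  by rewrite horner0 mulr0.
rewrite big_ord_recr /=.
rewrite (@eq_gexp _ _ _ (fun x => (u x - (P 0%N (M + k)%N).[x]) * (\sum_(i < n) b i *: L i).[x] +
   b n * ((u x - (P 0%N (M + k)%N).[x]) * (L n).[x]))); last first.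
  by move=> x _; rewrite hornerD hornerZ; ring.
rewrite gexpD //; last 2 first.
  by apply: within_continuousM => //; exact: within_continuous_poly.
  apply: within_continuousM; first exact: within_continuous_cst.
  by apply: within_continuousM => //; exact: within_continuous_poly.
rewrite gexpZ //; last by apply: within_continuousM => //; exact: within_continuous_poly.
by rewrite base // mulr0 addr0 IH // ltnW.
Qed.

(** * Summation over the blocks *)

Lemma geometric_sum_le (R : realType) (q : R) (k : nat) : 0 <= q -> q < 1 ->
  \sum_(i < k) q ^+ i <= (1 - q)^-1.
Proof.
move=> q0 q1; rewrite -[leRHS]mul1r ler_pdivlMr ?subr_gt0 //.
suff -> : (\sum_(i < k) q ^+ i) * (1 - q) = 1 - q ^+ k by rewrite gerBl exprn_ge0.
elim: k => [|k IH]; first by rewrite big_ord0 mul0r expr0 subrr.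
rewrite big_ord_recr /= mulrDl IH exprS; ring.
Qed.

Lemma series_approximation (R : realType) (alpha theta r : R) (p : nat) :
  - (1 / 2) < alpha -> 0 < theta -> theta <= 1 -> ~~ odd p ->
  alpha + 1 / 2 + p.+2%:R^-1 < r ->
  exists (K : nat) (C : R), 0 < C /\ forall L : nat -> {poly R}, orthonormal_system alpha L ->
    forall (n k : nat) (a : nat -> R), (0 < n)%N ->
    (forall M, \sum_(j < M) powR (powR (1 + j%:R) r * `|a j|) theta <= 1) ->
    exists (J : seq nat) (b : nat -> R), [/\ uniq J, (size J <= K * n)%N &
      forall x, -1 <= x <= 1 ->
        `|\sum_(0 <= j < n * 2 ^ k) a j * (L j).[x] - \sum_(j <- J) b j * (L j).[x]|
          <= C * powR n%:R (- (r + theta^-1 - 1 / 2))].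
Proof.
move=> a2 th0 th1 podd; set A := alpha + 1 / 2 + p.+2%:R^-1 => Ar.
have l0 : 0 < alpha + 1 / 2 by lra.
have A0 : 0 < A by rewrite /A addr_gt0 // invr_gt0 ltr0n.
have th1' : 1 <= theta^-1 by rewrite invf_ge1.
set rho := theta^-1 - 1 / 2; have rho0 : 0 < rho by rewrite /rho; lra.
have rA : 0 < rho + A by rewrite addr_gt0.
have r0 : 0 < r by apply: lt_trans Ar.
have [C C0 block] := block_approximation r a2 th0 th1 podd.
(* Half of the decay [2^((A - r) k)] of block [k] is spent on having only [n kap^k] terms; the other
   half is [q^k], which makes the errors summable. *)
pose kap : R := powR 2 ((A - r) / (2 * (rho + A))).
pose q : R := powR 2 ((A - r) / 2).
have exp_lt1 (s : R) : s < 0 -> powR 2 s < 1.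
  move=> s0; have -> : s = - - s by rewrite opprK.
  have s0' : 0 < - s by rewrite oppr_gt0.
  have P0 : 0 < powR 2 (- s) :> R by exact: powR_gt0.
  rewrite -(ltr_pM2l P0) powR_cancel // mulr1.
  apply: (@le_lt_trans _ _ (powR 1 (- s))); first by rewrite powR1.
  by apply: gt0_ltr_powR; rewrite ?nnegrE // ltr1n.
have kap0 : 0 < kap by exact: powR_gt0.
have kap1 : kap < 1 by apply: exp_lt1; rewrite pmulr_llt0 ?invr_gt0 ?mulr_gt0 // subr_lt0.
have q0 : 0 < q by exact: powR_gt0.
have q1 : q < 1 by apply: exp_lt1; rewrite pmulr_llt0 // subr_lt0.
have expn_powR (x : R) (i : nat) (s : R) : 0 < x -> powR (x ^+ i) s = powR x s ^+ i.
  by move=> x0; rewrite -!powR_mulrn ?powR_ge0 ?ltW // -!powRrM mulrC.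
pose K := (Num.truncn (1 + 2 / (1 - kap)) + 1)%N.
exists K, (C / (1 - q)); split; first by rewrite divr_gt0 // subr_gt0.
move=> L oL n k a n0 aN.
have nR : 0 < n%:R :> R by rewrite ltr0n.
have -> : - (r + theta^-1 - 1 / 2) = - (r + rho) by rewrite /rho; ring.
suff [J [b [uJ Jlt Js Jb]]] : exists (J : seq nat) (b : nat -> R),
    [/\ uniq J, {in J, forall j, (j < n * 2 ^ k)%N},
      (size J)%:R <= n%:R * (1 + 2 * \sum_(i < k) kap ^+ i) &
      forall x, -1 <= x <= 1 ->
        `|\sum_(0 <= j < n * 2 ^ k) a j * (L j).[x] - \sum_(j <- J) b j * (L j).[x]|
          <= C * powR n%:R (- (r + rho)) * \sum_(i < k) q ^+ i].
  exists J, b; split => //.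
    rewrite -(ler_nat R) natrM mulrC; apply: le_trans Js _; rewrite ler_pM2l //.
    apply: (@le_trans _ _ (1 + 2 / (1 - kap))).
      by rewrite lerD2l ler_pM2l // geometric_sum_le // ltW.
    by rewrite /K addn1 ltW // truncnS_gt.
  move=> x x1; apply: le_trans (Jb x x1) _.
  have -> : C / (1 - q) * powR n%:R (- (r + rho)) = C * powR n%:R (- (r + rho)) * (1 - q)^-1.
    by rewrite mulrAC.
  apply: ler_wpM2l; first by rewrite mulr_ge0 ?powR_ge0 // ltW.
  by apply: geometric_sum_le => //; exact: ltW.
elim: k => [|k [J [b [uJ Jlt Js Jb]]]].
  (* The first [n] coefficients are kept exactly. *)
  exists (iota 0 n), a; split.
  - exact: iota_uniq.
  - by move=> j; rewrite mem_iota muln1.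
  - by rewrite size_iota big_ord0 mulr0 addr0 mulr1.
  - move=> x _; rewrite muln1 /index_iota subn0 subrr normr0.
    by rewrite big_ord0 mulr0.
set N := (n * 2 ^ k)%N in Jlt Jb.
have N0 : (0 < N)%N by rewrite muln_gt0 n0 expn_gt0.
have NR : 0 < N%:R :> R by rewrite ltr0n.
have NE : (n * 2 ^ k.+1)%N = (N + N)%N by rewrite expnS mulnCA mul2n -addnn.
have NRE : N%:R = n%:R * 2 ^+ k :> R by rewrite natrM natrX.
pose c (j : 'I_N) := a (N + j)%N.
have cN : \sum_j powR (powR N%:R r * `|c j|) theta <= 1.
  apply: le_trans (aN (N + N)%N).
  rewrite (big_split_ord) /= -[leLHS]add0r lerD //.
    by apply: sumr_ge0 => j _; exact: powR_ge0.
  apply: ler_sum => j _; apply: ge0_ler_powR; rewrite ?nnegrE ?(ltW th0) ?mulr_ge0 ?powR_ge0 //.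
  rewrite ler_wpM2r //; apply: ge0_ler_powR; rewrite ?nnegrE ?(ltW r0) ?addr_ge0 //.
  by rewrite nat1r ler_nat leqW // leq_addr.
pose m := n%:R * kap ^+ k : R.
have m0 : 0 < m by rewrite mulr_gt0 // exprn_gt0.
have [d [dm dz]] := block L oL N c m N0 m0 cN.
pose Jd := [seq (N + j)%N | j : 'I_N <- enum (supp d)].
pose b' (j : nat) := if (j < N)%N then b j else
  if insub (j - N)%N is Some i then d i else 0.
have b'd (j : 'I_N) : b' (N + j)%N = d j.
  by rewrite /b' ltnNge leq_addr /= addKn insubT /=; [exact: ltn_ord|move=> h; congr d; exact: val_inj].
exists (J ++ Jd), b'; split.
- rewrite cat_uniq uJ /= map_inj_uniq ?enum_uniq ?andbT; last first.
    by move=> i j /addnI; exact: val_inj.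
  apply/hasPn => _ /mapP[j _ ->]; apply/negP => /Jlt.
  by rewrite ltnNge leq_addr.
- move=> j; rewrite mem_cat NE => /orP[/Jlt jN|/mapP[i _ ->]].
    by apply: leq_trans jN _; exact: leq_addr.
  by rewrite ltn_add2l.
- rewrite size_cat size_map -cardE natrD big_ord_recr /=.
  rewrite !mulrDr mulr1 addrA lerD //; first by move: Js; rewrite mulrDr mulr1.
  by rewrite mulrCA.
move=> x x1.
have sumJd : \sum_(j <- Jd) b' j * (L j).[x] = \sum_j d j * (L (N + j)%N).[x].
  rewrite big_map big_enum /= [RHS](bigID (mem (supp d))) /= [X in _ + X]big1 ?addr0.
    by apply: eq_bigr => j _; rewrite b'd.
  by move=> j; rewrite !inE negbK => /eqP ->; rewrite mul0r.
have sumJ : \sum_(j <- J) b' j * (L j).[x] = \sum_(j <- J) b j * (L j).[x].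
  by apply: eq_big_seq => j /Jlt jN; rewrite /b' jN.
have sumN : \sum_(0 <= j < n * 2 ^ k.+1) a j * (L j).[x] =
    \sum_(0 <= j < N) a j * (L j).[x] + \sum_j c j * (L (N + j)%N).[x].
  rewrite NE (big_cat_nat (n := N)) ?leq_addr //=; congr (_ + _).
  by rewrite -{1}[N]add0n big_addn addnK big_mkord; apply: eq_bigr => j _; rewrite addnC.
rewrite big_cat /= sumJd sumJ sumN.
have -> : \sum_(0 <= j < N) a j * (L j).[x] + \sum_j c j * (L (N + j)%N).[x] -
   (\sum_(j <- J) b j * (L j).[x] + \sum_j d j * (L (N + j)%N).[x]) =
   (\sum_(0 <= j < N) a j * (L j).[x] - \sum_(j <- J) b j * (L j).[x]) +
   \sum_j (c j - d j) * (L (N + j)%N).[x].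
  under [X in _ = _ + X]eq_bigr do rewrite mulrBl.
  rewrite sumrB; ring.
apply: le_trans (ler_normD _ _) _; rewrite big_ord_recr /= mulrDr.
apply: lerD; first exact: Jb.
apply: le_trans (dz x x1) _; rewrite -/A -/rho -!mulrA ler_pM2l // le_eqVlt; apply/orP; left; apply/eqP.
rewrite /m NRE !powRM ?exprn_ge0 ?(ltW kap0) //.
rewrite !expn_powR //.
have -> : powR n%:R (A - r) * powR 2 (A - r) ^+ k *
    (powR n%:R (- (rho + A)) * powR kap (- (rho + A)) ^+ k) =
  (powR n%:R (A - r) * powR n%:R (- (rho + A))) * (powR 2 (A - r) * powR kap (- (rho + A))) ^+ k.
  by rewrite exprMn; ring.
rewrite -powRDp //; congr (powR _ _ * _ ^+ _); first by ring.
rewrite /kap /q -powRrM -powRDp //; congr powR.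
by field; rewrite gt_eqF.
Qed.

Lemma series_tail (R : realType) (lam r theta C : R) (phi : nat -> R) (a : nat -> R) :
  0 < theta -> theta <= 1 -> lam < r -> 0 < C ->
  (forall j, `|phi j| <= C * powR (1 + j%:R) lam) ->
  (forall M, \sum_(j < M) powR (powR (1 + j%:R) r * `|a j|) theta <= 1) ->
  forall M M' : nat, `|\sum_(M <= j < M') a j * phi j| <= C * powR (1 + M%:R) (lam - r).
Proof.
move=> th0 th1 lr C0 phiC aM M M'.
have pos (j : nat) : 0 < 1 + j%:R :> R by rewrite ltr_pwDl.
pose b (j : nat) := powR (1 + j%:R) r * `|a j|.
have b0 j : 0 <= b j by rewrite mulr_ge0 ?powR_ge0.
have b1 : \sum_(M <= j < M') b j <= 1.
  apply: (@le_trans _ _ (\sum_(0 <= j < M') b j)); last first.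
    by rewrite big_mkord; exact: (sum_le_powR_theta (b := fun j : 'I_M' => b j) _ th0 th1 (aM M')).
  case: (leqP M M') => MM; last by rewrite big_geq ?(ltnW MM) // sumr_ge0.
  by rewrite [leRHS](big_cat_nat (n := M)) //= lerDr sumr_ge0.
apply: le_trans (ler_norm_sum _ _ _) _.
rewrite -[leRHS]mulr1; apply: le_trans (ler_wpM2l _ b1); last by rewrite mulr_ge0 ?powR_ge0 // ltW.
rewrite mulr_sumr; apply: ler_sum_nat => j /andP[Mj _].
rewrite normrM mulrC.
apply: le_trans (ler_wpM2r (normr_ge0 _) (phiC j)) _.
rewrite -!mulrA; apply: ler_wpM2l; first exact: ltW.
rewrite /b mulrA; apply: ler_wpM2r => //.
have {1}-> : lam = (lam - r) + r by rewrite subrK.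
rewrite powRDp //; apply: ler_wpM2r; first exact: powR_ge0.
rewrite -opprB; apply: powR_anti => //; last by rewrite subr_ge0 ltW.
by rewrite lerD2l ler_nat.
Qed.

Lemma powR_neg_small (R : realType) (delta eps : R) : 0 < delta -> 0 < eps ->
  exists k : nat, forall M : nat, (k <= M)%N -> powR (1 + M%:R) (- delta) <= eps.
Proof.
move=> d0 e0; exists (Num.truncn (powR eps (- delta^-1))).+1 => M kM.
have X0 : 0 < powR eps (- delta^-1) by exact: powR_gt0.
apply: (@le_trans _ _ (powR (powR eps (- delta^-1)) (- delta))).
  apply: powR_anti => //; last exact: ltW.
  apply: ltW; apply: (lt_le_trans (truncnS_gt _)).
  by apply: (@le_trans _ _ M%:R); rewrite ?ler_nat // lerDr.
by rewrite -powRrM mulrNN mulVf ?gt_eqF // powRr1 // ltW.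
Qed.

Lemma real_approximation (R : realType) (alpha theta r : R) :
  0 < theta -> theta <= 1 -> - (1 / 2) < alpha -> alpha + 1 / 2 < r ->
  exists (K : nat) (C : R), [/\ (0 < K)%N, 0 < C & forall L, orthonormal_system alpha L ->
    forall u : R -> R, {within `[-1, 1], continuous u} ->
    (forall M, \sum_(j < M) powR (powR (1 + j%:R) r * `|gip alpha u (horner (L j))|) theta <= 1) ->
    (forall x, -1 <= x <= 1 -> `|u x| <= C) /\
    forall n : nat, (0 < n)%N -> exists (J : seq nat) (b : nat -> R),
      [/\ uniq J, (size J <= K * n)%N & forall x, -1 <= x <= 1 ->
        `|u x - \sum_(j <- J) b j * (L j).[x]| <= C * powR n%:R (- (r + theta^-1 - 1 / 2))]].
Proof.
move=> th0 th1 a2 lr.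
have a1 : -1 < alpha by apply: lt_trans a2; rewrite ltrN2 mul1r invf_lt1 // ltr1n.
have dr : 0 < r - (alpha + 1 / 2) by rewrite subr_gt0.
(* Even, and large enough that [1/(p+2) < r - lam]. *)
pose p := (2 * (Num.truncn (r - (alpha + 1 / 2))^-1).+1)%N.
have podd : ~~ odd p by rewrite oddM.
have pr : alpha + 1 / 2 + p.+2%:R^-1 < r.
  rewrite -ltrBrDl -[ltRHS]invrK ltf_pV2 ?posrE ?ltr0n ?invr_gt0 //.
  apply: lt_le_trans (truncnS_gt _) _; rewrite ler_nat /p.
  by rewrite mul2n -addnn -!addnS -[leqLHS]addn0 leq_add.
have [K [C [C0 approx]]] := series_approximation a2 th0 th1 podd pr.
have [D D0 sup] := orthonormal_sup_bound a2.
exists K.+1, (C + 4 * D + 1); split => //.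
  by rewrite !addr_gt0 // mulr_gt0.
move=> L oL u cu au.
have tail x (x1 : -1 <= x <= 1) := @series_tail _ _ _ _ _ (fun j => (L j).[x])
  (fun j => gip alpha u (horner (L j))) th0 th1 lr D0 (fun j => sup L oL j x x1) au.
split.
  move=> x x1; have T0 M' z : (0 <= M')%N -> -1 <= z <= 1 ->
      `|\sum_(0 <= j < M') gip alpha u (horner (L j)) * (L j).[z]| <= D.
    by move=> _ z1; apply: le_trans (tail z z1 0%N M') _; rewrite addr0 powR1 mulr1.
  have := gexp_uniform_limit a1 oL cu (ltW D0) T0 x1.
  rewrite big_geq // subr0 => h; apply: le_trans h _.
  by rewrite addrAC lerDr addr_ge0 // ltW.
move=> n n0; set s := r + theta^-1 - 1 / 2.
have nR : 0 < n%:R :> R by rewrite ltr0n.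
have e0 : 0 < powR n%:R (- s) / (4 * D) by rewrite divr_gt0 ?powR_gt0 // mulr_gt0.
(* [k] may depend on [n], because the constants of [series_approximation] do not depend on the
   number of blocks. *)
have [k small] := powR_neg_small dr e0.
have [J [b [uJ Js Jb]]] := approx L oL n k (fun j => gip alpha u (horner (L j))) n0 au.
exists J, b; split => // [|x x1].
  by apply: leq_trans Js _; rewrite leq_mul2r leqnSn orbT.
have kM : (k <= n * 2 ^ k)%N.
  by apply: (leq_trans (ltnW (ltn_expl k (ltnSn 1)))); rewrite leq_pmull.
have T M' z : (n * 2 ^ k <= M')%N -> -1 <= z <= 1 ->
    `|\sum_(n * 2 ^ k <= j < M') gip alpha u (horner (L j)) * (L j).[z]| <= powR n%:R (- s) / 4.
  move=> _ z1; apply: le_trans (tail z z1 _ M') _.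
  rewrite -opprB; apply: le_trans (ler_wpM2l (ltW D0) (small _ kM)) _.
  by rewrite le_eqVlt; apply/orP; left; apply/eqP; field; rewrite gt_eqF.
have t0 : 0 <= powR n%:R (- s) / 4 by rewrite divr_ge0 ?powR_ge0.
have U := gexp_uniform_limit a1 oL cu t0 T x1.
have -> : u x - \sum_(j <- J) b j * (L j).[x] =
  (u x - \sum_(0 <= j < n * 2 ^ k) gip alpha u (horner (L j)) * (L j).[x]) +
  (\sum_(0 <= j < n * 2 ^ k) gip alpha u (horner (L j)) * (L j).[x] - \sum_(j <- J) b j * (L j).[x]).
  by rewrite addrA subrK.
apply: le_trans (ler_normD _ _) _.
have -> : (C + 4 * D + 1) * powR n%:R (- s) =
  4 * (powR n%:R (- s) / 4) + C * powR n%:R (- s) + 4 * D * powR n%:R (- s) by field.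
apply: ler_wpDr; first by rewrite mulr_ge0 ?powR_ge0 // mulr_ge0 // ltW.
by apply: lerD => //; exact: Jb.
Qed.

(** * Complex functions and the upper bound *)

(** Approximants have exactly [n] indices, so smaller sets are padded and given zero
    coefficients. *)
Lemma uniq_pad (J : seq nat) (n : nat) : uniq J -> (size J <= n)%N ->
  exists J' : seq nat, [/\ uniq J', size J' = n & {subset J <= J'}].
Proof.
move=> uJ Jn; exists (J ++ iota (\max_(j <- J) j).+1 (n - size J)); split.
- rewrite cat_uniq uJ iota_uniq andbT /=; apply/hasPn => j; rewrite mem_iota => /andP[mj _].
  apply/negP => jJ; move: mj; rewrite ltnNge; apply/negP; rewrite negbK.
  exact: (@leq_bigmax_seq _ _ _ id).
- by rewrite size_cat size_iota subnKC.
- by move=> j jJ; rewrite mem_cat jJ.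
Qed.

Lemma sum_extend (R : realType) (J J' : seq nat) (b f : nat -> R) :
  uniq J -> uniq J' -> {subset J <= J'} ->
  \sum_(j <- J') (if j \in J then b j else 0) * f j = \sum_(j <- J) b j * f j.
Proof.
move=> uJ uJ' JJ'.
rewrite (eq_bigr (fun j => if j \in J then b j * f j else 0)); last first.
  by move=> j _; case: ifP => //; rewrite mul0r.
rewrite -big_mkcond -big_filter; apply: perm_big; apply: uniq_perm => //.
  exact: filter_uniq.
by move=> j; rewrite mem_filter; apply/andP/idP => [[]//|jJ]; split => //; exact: JJ'.
Qed.

Lemma cmod_ge_l (R : realType) (x y : R) : `|x| <= cmod x y.
Proof. by rewrite /cmod -sqrtr_sqr ler_wsqrtr // lerDl sqr_ge0. Qed.

Lemma cmod_ge_r (R : realType) (x y : R) : `|y| <= cmod x y.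
Proof. by rewrite /cmod -sqrtr_sqr ler_wsqrtr // lerDr sqr_ge0. Qed.

Lemma cmod_le (R : realType) (x y c : R) : `|x| <= c -> `|y| <= c -> cmod x y <= 2 * c.
Proof.
move=> xc yc; have c0 : 0 <= c by exact: le_trans xc.
have c2 : 0 <= 2 * c by rewrite mulr_ge0.
rewrite /cmod -(ger0_norm c2) -sqrtr_sqr ler_wsqrtr //.
have x2 : x ^+ 2 <= c ^+ 2 by rewrite -(real_normK (num_real x)) lerXn2r ?nnegrE.
have y2 : y ^+ 2 <= c ^+ 2 by rewrite -(real_normK (num_real y)) lerXn2r ?nnegrE.
apply: le_trans (lerD x2 y2) _.
have -> : (2 * c) ^+ 2 = c ^+ 2 + c ^+ 2 + (c ^+ 2 + c ^+ 2) by ring.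
by rewrite lerDl addr_ge0 // sqr_ge0.
Qed.

Lemma in_A_partial_sum (R : realType) (alpha r theta : R) (L : nat -> {poly R}) (u v : R -> R)
    (h : nat -> R) : 0 <= theta -> in_A alpha L r theta u v ->
  (forall j, `|h j| <= coef_abs alpha L u v j) ->
  forall M, \sum_(j < M) powR (powR (1 + j%:R) r * `|h j|) theta <= 1.
Proof.
move=> th0 [_ [_ A]] hc M; rewrite -lee_fin; apply: le_trans A.
apply: (@le_trans _ _ (\sum_(0 <= j < M) (powR (powR (1 + j%:R) r * coef_abs alpha L u v j) theta)%:E)%E).
  rewrite sumEFin big_mkord lee_fin; apply: ler_sum => j _.
  have hc' := hc j; have c0 : 0 <= coef_abs alpha L u v j by exact: le_trans hc'.
  apply: ge0_ler_powR; rewrite ?nnegrE ?mulr_ge0 ?powR_ge0 //.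
  by apply: ler_wpM2l => //; exact: powR_ge0.
by apply: nneseries_lim_ge => j _ _; rewrite lee_fin powR_ge0.
Qed.

Lemma best_nterm_err_le (R : realType) (L : nat -> {poly R}) (u v : R -> R) (Ju Jv : seq nat)
    (a b : nat -> R) (n : nat) (e : R) :
  uniq Ju -> uniq Jv -> (size Ju + size Jv <= n)%N ->
  (forall x, -1 <= x <= 1 -> `|u x - \sum_(j <- Ju) a j * (L j).[x]| <= e) ->
  (forall x, -1 <= x <= 1 -> `|v x - \sum_(j <- Jv) b j * (L j).[x]| <= e) ->
  (best_nterm_err L n u v <= (2 * e)%:E)%E.
Proof.
move=> uJu uJv Jn ue ve.
have Jn' : (size (undup (Ju ++ Jv)) <= n)%N.
  by apply: leq_trans (size_undup _) _; rewrite size_cat.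
have [J [uJ Js JJ]] := uniq_pad (undup_uniq _) Jn'.
have JuJ : {subset Ju <= J} by move=> j jJ; apply: JJ; rewrite mem_undup mem_cat jJ.
have JvJ : {subset Jv <= J} by move=> j jJ; apply: JJ; rewrite mem_undup mem_cat jJ orbT.
pose a' (j : nat) := if j \in Ju then a j else 0.
pose b' (j : nat) := if j \in Jv then b j else 0.
apply: (@le_trans _ _ (supnorm (fun x => u x - \sum_(j <- J) a' j * (L j).[x])
                      (fun x => v x - \sum_(j <- J) b' j * (L j).[x]))).
  by apply: ereal_inf_lbound; exists J, a', b'.
apply: ge_ereal_sup => y [x /=]; rewrite in_itv /= => x1 <-.
by rewrite lee_fin; apply: cmod_le; rewrite sum_extend //; [exact: ue|exact: ve].
Qed.

Lemma sigma_n_upper (R : realType) (alpha theta r : R) :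
  0 < theta -> theta <= 1 -> - (1 / 2) < alpha -> alpha + 1 / 2 < r ->
  exists2 C : R, 0 < C & forall L, orthonormal_system alpha L -> forall n : nat, (0 < n)%N ->
    (sigma_n alpha L r theta n <= (C * powR n%:R (- (r + theta^-1 - 1 / 2)))%:E)%E.
Proof.
move=> th0 th1 a2 lr.
have [K [C [K0 C0 approx]]] := real_approximation th0 th1 a2 lr.
set s := r + theta^-1 - 1 / 2.
have s0 : 0 <= s.
  rewrite /s -addrA addr_ge0 ?subr_ge0 //.
    apply: ltW; apply: lt_trans lr; move: a2; rewrite -subr_gt0 opprK addrC; exact.
  apply: (@le_trans _ _ 1); last by rewrite invf_ge1.
  by rewrite mul1r invf_le1 // ler1n.
have K4 : 0 < (4 * K)%:R :> R by rewrite ltr0n muln_gt0.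
exists (2 * (C * powR (4 * K)%:R s)).
  by rewrite mulr_gt0 // mulr_gt0 // powR_gt0.
move=> L oL n n0; apply: ge_ereal_sup => y [u [v [uvA ->]]].
have [cu [cv _]] := uvA.
have nR : 0 < n%:R :> R by rewrite ltr0n.
have hu := in_A_partial_sum (ltW th0) uvA (fun j => cmod_ge_l _ _).
have hv := in_A_partial_sum (ltW th0) uvA (fun j => cmod_ge_r _ _).
have [bu au] := approx L oL u cu hu.
have [bv av] := approx L oL v cv hv.
rewrite -!mulrA.
have scale (m : nat) : (0 < m)%N -> (n <= 4 * K * m)%N ->
    powR m%:R (- s) <= powR (4 * K)%:R s * powR n%:R (- s).
  move=> m0 nm; have P0 : 0 < powR (4 * K)%:R (- s) :> R by exact: powR_gt0.
  rewrite -(ler_pM2l P0) mulrA [powR _ (- s) * powR _ s]mulrC powR_cancel // mul1r.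
  by rewrite -powRM // -natrM; apply: powR_anti => //; rewrite ler_nat.
(* Here [n / (2K)] would be 0; as [n] is bounded, the zero approximant and the sup bound on [u] and
   [v] suffice. *)
have [nK|nK] := ltnP n (2 * K).
  have small : C <= C * (powR (4 * K)%:R s * powR n%:R (- s)).
    rewrite -[leLHS]mulr1 ler_pM2l //; have := scale 1%N isT; rewrite powR1; apply.
    by rewrite muln1; apply: (leq_trans (ltnW nK)); rewrite leq_mul2r orbT.
  apply: (@best_nterm_err_le _ _ _ _ [::] [::] (fun=> 0) (fun=> 0)) => //.
    by move=> x x1; rewrite big_nil subr0; apply: le_trans small; exact: bu.
  by move=> x x1; rewrite big_nil subr0; apply: le_trans small; exact: bv.
(* Real and imaginary parts use at most [K (n / (2K))] indices each, together at most [n]. *)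
have m0 : (0 < n %/ (2 * K))%N by rewrite divn_gt0 // muln_gt0.
have [Ju [a [uJu Jus ua]]] := au _ m0.
have [Jv [b [uJv Jvs vb]]] := av _ m0.
have nm : (n <= 4 * K * (n %/ (2 * K)))%N.
  have lt := ltn_ceil n (d := (2 * K)%N); rewrite muln_gt0 K0 in lt.
  apply: (leq_trans (ltnW (lt isT))); rewrite mulSn.
  have -> : (4 * K * (n %/ (2 * K)))%N = (n %/ (2 * K) * (2 * K) + n %/ (2 * K) * (2 * K))%N.
    by clear; move: (n %/ _)%N => m; rewrite -mulnDr addnn -mul2n [RHS]mulnC mulnA.
  by rewrite leq_add2r leq_pmull.
have P := ler_wpM2l (ltW C0) (scale _ m0 nm).
apply: (best_nterm_err_le uJu uJv).
- apply: (leq_trans (leq_add Jus Jvs)); rewrite addnn -mul2n mulnA mulnC.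
  exact: leq_trunc_div.
- by move=> x x1; apply: le_trans P; exact: ua.
- by move=> x x1; apply: le_trans P; exact: vb.
Qed.

(** * The lower bound *)

Lemma pexp0 (R : realType) (alpha : R) : -1 < alpha -> pexp alpha 0 = 0.
Proof. by move=> a1; rewrite -[0](scale0r 0) pexpZ // mul0r. Qed.

Lemma pexp_bigsum (R : realType) (alpha : R) (J : seq nat) (p : nat -> {poly R}) : -1 < alpha ->
  pexp alpha (\sum_(j <- J) p j) = \sum_(j <- J) pexp alpha (p j).
Proof.
move=> a1; elim: J => [|j J IH]; first by rewrite !big_nil pexp0.
by rewrite !big_cons pexpD // IH.
Qed.

Lemma pexp_lincomb (R : realType) (alpha : R) (L : nat -> {poly R}) (J : seq nat) (a : nat -> R)
    (k : nat) : -1 < alpha -> orthonormal_system alpha L -> uniq J ->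
  pexp alpha ((\sum_(j <- J) a j *: L j) * L k) = if k \in J then a k else 0.
Proof.
move=> a1 [_ oL2] uJ; rewrite mulr_suml pexp_bigsum //.
under eq_bigr do rewrite -scalerAl pexpZ // -gip_poly oL2.
case: ifP => kJ.
  rewrite (bigD1_seq k) //= eqxx mulr1 big1 ?addr0 // => j /negPf ->.
  by rewrite mulr0.
rewrite big1_seq // => j /= jJ; case: eqP => [jk|_]; last by rewrite mulr0.
by rewrite -jk jJ in kJ.
Qed.

(** Bessel: [h - c g] has squared norm equal to that of [h] minus [|S| c^2], and the norm of [h] is
    at most [e]. *)
Lemma flat_part_le_sup (R : realType) (alpha : R) (L : nat -> {poly R}) (h : {poly R})
    (S : seq nat) (c e : R) : -1 < alpha -> orthonormal_system alpha L -> uniq S ->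
  (forall k, k \in S -> pexp alpha (h * L k) = c) ->
  (forall x, -1 <= x <= 1 -> `|h.[x]| <= e) -> (size S)%:R * c ^+ 2 <= e ^+ 2.
Proof.
move=> a1 oL uS hS he.
pose g := \sum_(k <- S) 1 *: L k.
have hg : pexp alpha (h * g) = (size S)%:R * c.
  rewrite /g mulr_sumr pexp_bigsum // (eq_big_seq (fun=> c)).
    by rewrite big_const_seq count_predT iter_addr_0 mulr_natl.
  by move=> k kS; rewrite scale1r hS.
have gg : pexp alpha (g * g) = (size S)%:R.
  rewrite {2}/g mulr_sumr pexp_bigsum // (eq_big_seq (fun=> 1)).
    by rewrite big_const_seq count_predT iter_addr_0.
  by move=> k kS; rewrite scale1r pexp_lincomb // kS.
have sq0 : 0 <= pexp alpha ((h - c *: g) * (h - c *: g)).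
  rewrite -(gexp_cst 0 a1); apply: le_gexp => //.
  - exact: within_continuous_cst.
  - exact: within_continuous_poly.
  - by move=> x _; rewrite hornerM -expr2 sqr_ge0.
have hh : pexp alpha (h * h) <= e ^+ 2.
  rewrite -(gexp_cst (e ^+ 2) a1); apply: le_gexp => //.
  - exact: within_continuous_poly.
  - exact: within_continuous_cst.
  - move=> x x1; have hx := he x x1; have e0 : 0 <= e by exact: le_trans hx.
    by rewrite hornerM -expr2 -(real_normK (num_real _)) lerXn2r ?nnegrE.
have E : (h - c *: g) * (h - c *: g) = h * h + (- (2 * c)) *: (h * g) + c ^+ 2 *: (g * g).
  rewrite -!mul_polyC !rmorphN !rmorphM /=.
  rewrite (_ : 2%:P = 2 :> {poly R}); last by rewrite -polyC_natr.
  by ring.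
rewrite E !pexpD // !pexpZ // hg gg in sq0.
apply: le_trans hh; rewrite -subr_ge0; apply: le_trans sq0 _.
by rewrite le_eqVlt; apply/orP; left; apply/eqP; ring.
Qed.

Lemma supnorm_lt (R : realType) (u v : R -> R) (e0 : R) : (supnorm u v < e0%:E)%E ->
  exists2 e : R, e < e0 & forall x, -1 <= x <= 1 -> `|u x| <= e.
Proof.
move=> lt.
have ub x : -1 <= x <= 1 -> ((cmod (u x) (v x))%:E <= supnorm u v)%E.
  by move=> x1; apply: ereal_sup_ubound; exists x => //=; rewrite in_itv.
have ub0 : ((cmod (u 0) (v 0))%:E <= supnorm u v)%E by apply: ub; rewrite oppr_le0 !ler01.
have fin : supnorm u v \is a fin_num.
  rewrite fin_numE; apply/andP; split; apply/eqP => E.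
    by rewrite E leeNy_eq in ub0.
  by rewrite E in lt; have := lt; rewrite ltNge leey.
rewrite -(fineK fin) in ub lt; exists (fine (supnorm u v)) => // x x1.
by apply: le_trans (cmod_ge_l _ _) _; rewrite -lee_fin; exact: ub.
Qed.

Lemma sum_window_le (R : realType) (g : nat -> R) (n m M : nat) : (n <= m)%N ->
  (forall j, 0 <= g j) -> (forall j, ~~ (n <= j < m)%N -> g j = 0) ->
  \sum_(0 <= j < M) g j <= \sum_(n <= j < m) g j.
Proof.
move=> nm g0 gz.
apply: (@le_trans _ _ (\sum_(0 <= j < m + M) g j)).
  by rewrite [leRHS](big_cat_nat (n := M)) ?leq_addl //= lerDl sumr_ge0.
rewrite (big_cat_nat (n := m)) ?leq_addr //= (big_cat_nat (n := n)) //=.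
rewrite [X in X + _ + _]big_nat_cond [X in X + _ + _]big1; last first.
  by move=> j /andP[/andP[_ jn] _]; apply: gz; rewrite leqNgt jn.
rewrite [X in _ + X]big_nat_cond [X in _ + X]big1 ?add0r ?addr0 //.
by move=> j /andP[/andP[mj _] _]; apply: gz; rewrite negb_and -leqNgt mj orbT.
Qed.

(** For [n <= j < 3n] one has [1 + j <= 3n], so each of the [2n] terms contributes at most
    [1 / (2n)]. *)
Lemma flat_in_A (R : realType) (alpha r theta : R) (L : nat -> {poly R}) (n : nat) :
  -1 < alpha -> orthonormal_system alpha L -> 0 < theta -> 0 <= r -> (0 < n)%N ->
  in_A alpha L r theta
    (horner (\sum_(j <- iota n (2 * n))
       (powR (3 * n)%:R (- r) * powR (2 * n)%:R (- theta^-1)) *: L j)) (fun=> 0).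
Proof.
move=> a1 oL th0 r0 n0; set c := _ * _.
have n3 : 0 < (3 * n)%:R :> R by rewrite ltr0n muln_gt0.
have n2 : 0 < (2 * n)%:R :> R by rewrite ltr0n muln_gt0.
have c0 : 0 <= c by rewrite mulr_ge0 ?powR_ge0.
split; [exact: within_continuous_poly|split; first exact: within_continuous_cst].
set f := \sum_(j <- _) _.
pose g (j : nat) : R := if (n <= j < 3 * n)%N then (2 * n)%:R^-1 else 0.
have gsum M : \sum_(0 <= j < M) g j <= 1.
  have nm : (n <= 3 * n)%N by rewrite leq_pmull.
  apply: le_trans (sum_window_le (n := n) (m := (3 * n)%N) M nm _ _) _.
  - by move=> j; rewrite /g; case: ifP => // _; rewrite invr_ge0 ltW.
  - by move=> j /negPf; rewrite /g => ->.
  rewrite (eq_big_nat _ _ (F2 := fun=> (2 * n)%:R^-1)); last by move=> j; rewrite /g => ->.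
  rewrite sumr_const_nat -[(_ - _)%N]/((3 * n - n)%N).
  have -> : (3 * n - n)%N = (2 * n)%N by rewrite mulSn addKn.
  by rewrite -[leLHS]mulr_natl mulfV // gt_eqF.
have term (j : nat) : powR (powR (1 + j%:R) r * coef_abs alpha L (horner f) (fun=> 0) j) theta <= g j.
  rewrite /coef_abs.
  have -> : gip alpha (fun=> 0) (fun x => (L j).[x]) = 0.
    have -> : (fun=> 0) = horner (0 : {poly R}) by apply/funext => x; rewrite horner0.
    by rewrite -[fun x => _]/(horner (L j)) gip_poly mul0r pexp0.
  rewrite -[fun x => _]/(horner (L j)) gip_poly pexp_lincomb // ?iota_uniq //.
  rewrite /cmod expr0n addr0 sqrtr_sqr mem_iota -mulSn /g.
  case: ifP => [/andP[_ jn]|_]; last by rewrite normr0 mulr0 powR0 // gt_eqF.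
  rewrite ger0_norm //.
  apply: (@le_trans _ _ (powR (powR (3 * n)%:R r * c) theta)).
    apply: ge0_ler_powR; rewrite ?nnegrE ?mulr_ge0 ?powR_ge0 // ?(ltW th0) //.
    apply: ler_wpM2r => //; apply: ge0_ler_powR; rewrite ?nnegrE ?addr_ge0 // ?(ltW n3) //.
    by rewrite nat1r ler_nat.
  rewrite /c mulrA powR_cancel // mul1r -powRrM mulNr mulVf ?gt_eqF //.
  by rewrite powR_inv1 // ltW.
apply: lime_le.
  by apply: is_cvg_nneseries => j _ _; rewrite lee_fin powR_ge0.
near=> M; rewrite sumEFin lee_fin.
by apply: le_trans (gsum M); apply: ler_sum => j _; exact: term.
Unshelve. all: by end_near.
Qed.

Lemma sigma_n_lower (R : realType) (alpha theta r : R) (L : nat -> {poly R}) (n : nat) :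
  -1 < alpha -> orthonormal_system alpha L -> 0 < theta -> 0 <= r -> (0 < n)%N ->
  ((powR 3 (- r) * powR 2 (- theta^-1) * powR n%:R (- (r + theta^-1 - 1 / 2)))%:E
     <= sigma_n alpha L r theta n)%E.
Proof.
move=> a1 oL th0 r0 n0.
have nR : 0 < n%:R :> R by rewrite ltr0n.
set c : R := powR (3 * n)%:R (- r) * powR (2 * n)%:R (- theta^-1).
set f := \sum_(j <- iota n (2 * n)) c *: L j.
apply: (@le_trans _ _ (best_nterm_err L n (horner f) (fun=> 0))); last first.
  by apply: ereal_sup_ubound; exists (horner f), (fun=> 0); split => //; exact: flat_in_A.
have -> : powR 3 (- r) * powR 2 (- theta^-1) * powR n%:R (- (r + theta^-1 - 1 / 2)) =
    c * Num.sqrt n%:R.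
  rewrite /c !natrM !powRM // -powR12_sqrt ?(ltW nR) //.
  have -> : - (r + theta^-1 - 1 / 2) = - r + - theta^-1 + 2^-1 by field; rewrite gt_eqF.
  by rewrite !powRDp //; ring.
have c0 : 0 <= c by rewrite mulr_ge0 ?powR_ge0.
apply: le_ereal_inf_tmp => _ [J [a [b [uJ Js ->]]]].
rewrite leNgt; apply/negP => /supnorm_lt[e ee he].
pose h := f - \sum_(j <- J) a j *: L j.
have hE x : -1 <= x <= 1 -> `|h.[x]| <= e.
  have -> : h.[x] = f.[x] - \sum_(j <- J) a j * (L j).[x].
    rewrite /h hornerD hornerN [X in - X]horner_sum; congr (_ - _).
    by apply: eq_bigr => j _; rewrite hornerZ.
  exact: he.
pose S := [seq j <- iota n (2 * n) | j \notin J].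
have uS : uniq S by rewrite filter_uniq // iota_uniq.
have Sn : (n <= size S)%N.
  have := count_predC (mem J) (iota n (2 * n)); rewrite size_iota mul2n -addnn => E.
  have le : (count (mem J) (iota n (n + n)) <= n)%N.
    rewrite -size_filter -[leqRHS]Js; apply: uniq_leq_size; first by rewrite filter_uniq // iota_uniq.
    by move=> j; rewrite mem_filter => /andP[].
  rewrite /S size_filter mul2n -addnn -(leq_add2l (count (mem J) (iota n (n + n)))).
  by rewrite [leqRHS]E leq_add2r.
have hS k : k \in S -> pexp alpha (h * L k) = c.
  rewrite mem_filter => /andP[kJ kI].
  rewrite /h mulrBl -[- _]scaleN1r pexpD // pexpZ // !pexp_lincomb // ?iota_uniq //.
  by rewrite kI (negPf kJ) mulr0 addr0.
have := flat_part_le_sup a1 oL uS hS hE.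
have e0 : 0 <= e by apply: (le_trans _ (hE 0 _)) => //; rewrite oppr_le0 !ler01.
apply/negP; rewrite -ltNge.
apply: (@lt_le_trans _ _ ((c * Num.sqrt n%:R) ^+ 2)).
  by rewrite ltrXn2r ?nnegrE // mulr_ge0 // sqrtr_ge0.
rewrite exprMn sqr_sqrtr ?(ltW nR) // mulrC; apply: ler_wpM2r; first exact: sqr_ge0.
by rewrite ler_nat.
Qed.

Theorem theorem6p3 (R : realType) (alpha theta r : R) :
  0 < theta -> theta <= 1 -> - (1 / 2) < alpha -> alpha + 1 / 2 < r ->
  exists c1 C2 : R, 0 < c1 /\ 0 < C2 /\
    forall L : nat -> {poly R}, orthonormal_system alpha L ->
    forall n : nat, (0 < n)%N ->
      ((c1 * powR n%:R (- (r + theta^-1 - 1 / 2)))%:E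
         <= sigma_n alpha L r theta n)%E /\
      (sigma_n alpha L r theta n
         <= (C2 * powR n%:R (- (r + theta^-1 - 1 / 2)))%:E)%E.
Proof.
move=> th0 th1 a2 lr.
have a1 : -1 < alpha by apply: lt_trans a2; rewrite ltrN2 mul1r invf_lt1 // ltr1n.
have r0 : 0 <= r.
  by apply: ltW; apply: lt_trans lr; move: a2; rewrite -subr_gt0 opprK.
have [C C0 upper] := sigma_n_upper th0 th1 a2 lr.
exists (powR 3 (- r) * powR 2 (- theta^-1)), C.
split; first by rewrite mulr_gt0 // powR_gt0.
split=> // L oL n n0; split; last exact: upper.
exact: sigma_n_lower.
Qed.
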